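(* Let $0<c\le\infty$ and let $f\in C((-c,c),\mathbb R)$ satisfy: ($f_1$) $f$ is odd, $f(0)=0$, and there exist $0<b<\beta<c$ such that $f(s)>0$ for $s>b$, $f(s)\le 0$ and $f(s)\not\equiv 0$ for $s\in[0,b]$, and $F(\beta)=0$, where $F(s):=\int_0^s f(t)\,dt$; ($f_2$) $f$ is continuously differentiable in $(0,c)$ and $f'\in L^1(0,1)$. Let $q$ satisfy: ($q_1$) $q\in C^1(\mathbb R^+;\mathbb R^+)$, $q\ge 0$, $q(0)=0$ and $q'>0$ on $(0,\infty)$; ($q_2$) $q'/q$ is strictly decreasing on $(0,\infty)$. Assume in addition: ($q_4$) $\frac1q\in L^1(1,\infty)\setminus L^1(0,1)$ and the function $h(r):=q(r)\int_r^\infty\frac{ds}{q(s)}$ satisfies: $h'(r)$ is strictly positive and nonincreasing for all $r>0$, with $\ell_\infty:=\lim_{r\to\infty}h'(r)>0$; ($f_4$) $\frac{sf'(s)}{f(s)}$ decreases for all $s>b$. Then the problem $$(q\,u')'+q(r)f(u)=0,\quad r>0,\qquad u'(0)=0,\qquad \lim_{r\to+\infty}u(r)=0,$$ has at most one nonnegative solution satisfying $u(0)>0$.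
   Context: $'$ denotes $\frac{d}{dr}$ for functions of $r$ (and $\frac{d}{ds}$ for functions of $s$). $\mathbb R^+=[0,\infty)$. Conditions on $f$ for $s>b$ are understood for $s<c$. A solution $u=u(r)$, $r\ge0$, is a classical solution with values in $(-c,c)$. The condition $\frac1q\in L^1(1,\infty)\setminus L^1(0,1)$ means that $1/q$ is integrable on $(1,\infty)$ and not integrable on $(0,1)$. *)

(* Defs.v *)
(* Functions given on an interval are total functions [R -> R] of which only
   the values on that interval are ever used.  At interior points [derive1 g]
   is therefore the ordinary derivative; only the endpoint [0] of the half-line
   needs a one-sided derivative. *)
From HB Require Import structures.
From mathcomp Require Import all_boot all_order all_algebra.
From mathcomp Require Import all_classical all_reals all_analysis.

Set Implicit Arguments.
Unset Strict Implicit.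
Unset Printing Implicit Defensive.

Import Order.TTheory GRing.Theory Num.Theory.
Import numFieldNormedType.Exports.

Local Open Scope classical_set_scope.
Local Open Scope ring_scope.

Section Definitions.
Context {R : realType}.
Implicit Types (c : \bar R) (b beta l x r s t : R) (f q g u : R -> R).

Local Notation mu := (@lebesgue_measure R).

(* The open interval (-c, c); it is all of [R] when [c = +oo]. *)
Definition sym_itv c : set R := [set s | (- c < s%:E < c)%E].

Definition is_rderive g x l : Prop :=
  h^-1 *: (g (h + x) - g x) @[h --> 0^'+] --> l.

(* [g] is of class C^1 on the closed half-line [0, +oo), and its (one-sided)
   derivative at 0 is [l]. *)
Definition C1_halfline g l : Prop :=
  [/\ forall r, 0 < r -> derivable g r 1 /\ {for r, continuous (derive1 g)},
      is_rderive g 0 l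
    & derive1 g r @[r --> 0^'+] --> l].

Definition cond_f1 c f b beta : Prop :=
  [/\ forall s, sym_itv c s -> f (- s) = - f s,
      f 0 = 0,
      [/\ 0 < b, b < beta & (beta%:E < c)%E],
      (forall s, b < s -> (s%:E < c)%E -> 0 < f s) /\
      ((forall s, 0 <= s <= b -> f s <= 0) /\
       (exists2 s : R, 0 <= s <= b & f s != 0))
    & \int[mu]_(t in `[0, beta]) f t = 0].

(* Integrability of f' on (0,1) refers to the part of (0,1) on which f is
   defined; the intersection is proper only if [c < 1]. *)
Definition cond_f2 c f : Prop :=
  (forall s, 0 < s -> (s%:E < c)%E ->
     derivable f s 1 /\ {for s, continuous (derive1 f)}) /\
  mu.-integrable (`]0, 1[ `&` sym_itv c) (EFin \o (derive1 f)).

Definition cond_f4 c f b : Prop :=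
  forall s t, b < s -> s <= t -> (t%:E < c)%E ->
    t * derive1 f t / f t <= s * derive1 f s / f s.

Definition cond_q1 q : Prop :=
  [/\ exists l, C1_halfline q l,
      forall r, 0 <= r -> 0 <= q r,
      q 0 = 0
    & forall r, 0 < r -> 0 < derive1 q r].

Definition cond_q2 q : Prop :=
  forall r s, 0 < r -> r < s -> derive1 q s / q s < derive1 q r / q r.

Definition hfun q r : R := q r * \int[mu]_(s in `]r, +oo[) (q s)^-1.

Definition cond_q4 q : Prop :=
  [/\ mu.-integrable `]1, +oo[ (fun s => (q s)^-1%:E),
      ~ mu.-integrable `]0, 1[ (fun s => (q s)^-1%:E),
      forall r, 0 < r -> derivable (hfun q) r 1 /\ 0 < derive1 (hfun q) r,
      forall r s, 0 < r -> r <= s -> derive1 (hfun q) s <= derive1 (hfun q) r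
    & exists2 l : R, 0 < l & derive1 (hfun q) r @[r --> +oo] --> l].

(* Classical solutions: u is C^1 on [0, +oo) with u'(0) = 0, and q u' is
   differentiable on (0, +oo); continuity of (q u')' follows from the
   equation. *)
Definition is_solution c f q u : Prop :=
  [/\ forall r, 0 <= r -> sym_itv c (u r),
      C1_halfline u 0,
      forall r, 0 < r -> derivable (fun s => q s * derive1 u s) r 1,
      forall r, 0 < r ->
        derive1 (fun s => q s * derive1 u s) r + q r * f (u r) = 0
    & u r @[r --> +oo] --> 0].

End Definitions.

(* Main.v *)
Require Import Defs.
From HB Require Import structures.
From mathcomp Require Import all_boot all_order all_algebra.
From mathcomp Require Import ring lra.
From mathcomp Require Import all_classical all_reals all_analysis.
From mathcomp Require Import measurable_realfun.

Set Implicit Arguments.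
Unset Strict Implicit.
Unset Printing Implicit Defensive.

Import Order.TTheory GRing.Theory Num.Theory.
Import numFieldNormedType.Exports.

Local Open Scope classical_set_scope.
Local Open Scope ring_scope.

(** The equation is read in the coordinate [V = int_r^oo 1/q = h / q], in which
    it becomes [u_VV = - q ^ 2 f(u)], and then in the logarithmic plane of
    [t = ln V] and [e = ln u].  There a solution is a graph with
      [e'' = e' - e' ^ 2 - N],   [N = h ^ 2 f(u) / u],
    and the hypotheses on [h'] and on [s f'(s) / f(s)] say exactly that [ln N] is
    the sum of a concave decreasing function of [t] and, above the level [b], of
    a concave function of [e].  The slope [e'] is [theta = h G / u], where [G = - u'].

    A single solution starts above [b] and decreases strictly until it vanishes,
    by an energy argument ([start_gt_b], [G_pos]).  Its slope [theta] increases
    with [r] above the level [b] ([tilt_pos]): this uses a Pohozaev function, and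
    the fact that the solution tends to [0], which forces [theta >= 1] at the level
    [b] ([hG_ge]).  So above [b] each solution is a strictly concave curve of the
    logarithmic plane, parametrized by its slope.

    For two solutions with [u1 0 = u2 0] there is local uniqueness
    ([unique_start]).  Suppose [u1 0 < u2 0].  Below the level [b], where [f] is
    nonpositive, monotone separation holds: one solution reaches all these levels
    later than the other, and at the level [b] it has the larger [h G] and the
    smaller [G] ([separation], [later_hG_ge], [later_G_lt]), for otherwise the
    difference would persist down to the level [0], where both quantities vanish.

    For small slopes the curve of [u2] lies above that of [u1], in the sense of
    parallel tangent lines.  If they ever have a common tangent line, compare the
    values of [N] at the two points of contact.  It cannot be smaller at the second
    one: concavity of [ln N] would propagate this to all smaller slopes, against
    the behaviour of solutions near [r = 0] ([tangent_forcing_le]).  Concavity then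
    propagates the opposite inequality to all larger slopes, and the points of
    equal slope move apart ([tangent_separates]).

    If [u1] is the later one below [b], the order of the curves at the level [b]
    forces a common tangent line, and moving apart is incompatible with the order
    of the slopes there ([start_lt_absurd_later]).  If [u2] is the later one, a
    common tangent line is impossible, so [u1 < u2] down to the level [b]; then
    slopes at equal levels contradict the monotonicity of [q' / q]
    ([start_lt_absurd_earlier], [ordered_absurd]). *)

(** * One-variable calculus *)

Section Calculus.
Context {R : realType}.
Implicit Types (f g df dg phi : R -> R) (a b x l m : R).

Lemma der_eq f x l m : is_derive x 1 f l -> l = m -> is_derive x 1 f m.
Proof. by move=> H <-. Qed.

Lemma der_cst (c x : R) : is_derive x 1 (fun _ : R => c) 0.
Proof. exact: is_derive_cst. Qed.

Lemma der_id x : is_derive x 1 (fun y : R => y) 1.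
Proof. exact: is_derive_id. Qed.

Lemma derD f g x l m : is_derive x 1 f l -> is_derive x 1 g m ->
  is_derive x 1 (fun y => f y + g y) (l + m).
Proof. by move=> hf hg; apply: is_deriveD. Qed.

Lemma derN f x l : is_derive x 1 f l -> is_derive x 1 (fun y => - f y) (- l).
Proof. by move=> hf; apply: is_deriveN. Qed.

Lemma derB f g x l m : is_derive x 1 f l -> is_derive x 1 g m ->
  is_derive x 1 (fun y => f y - g y) (l - m).
Proof. by move=> hf hg; apply: is_deriveB. Qed.

Lemma derM f g x l m : is_derive x 1 f l -> is_derive x 1 g m ->
  is_derive x 1 (fun y => f y * g y) (l * g x + f x * m).
Proof.
move=> hf hg; apply: der_eq (is_deriveM hf hg) _.
by rewrite /GRing.scale /=; ring.
Qed.

Lemma derV f x l : is_derive x 1 f l -> f x != 0 ->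
  is_derive x 1 (fun y => (f y)^-1) (- l / f x ^+ 2).
Proof.
move=> hf f0; apply: der_eq (is_deriveV f0 hf) _.
by rewrite /GRing.scale /= !mulNr mulrC.
Qed.

Lemma der_div f g x l m : is_derive x 1 f l -> is_derive x 1 g m -> g x != 0 ->
  is_derive x 1 (fun y => f y / g y) ((l * g x - f x * m) / g x ^+ 2).
Proof.
move=> hf hg g0; apply: der_eq (derM hf (derV hg g0)) _.
by field.
Qed.

Lemma der_comp f g x l m : is_derive (g x) 1 f l -> is_derive x 1 g m ->
  is_derive x 1 (fun y => f (g y)) (l * m).
Proof. by move=> hf hg; exact: (is_derive1_comp hf hg). Qed.

Lemma der_ln f x l : is_derive x 1 f l -> 0 < f x ->
  is_derive x 1 (fun y => ln (f y)) (l / f x).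
Proof.
move=> hf f0; apply: der_eq (der_comp (is_derive1_ln f0) hf) _.
by rewrite mulrC.
Qed.

Lemma der_cts f x l : is_derive x 1 f l -> {for x, continuous f}.
Proof.
by move=> [d _]; apply: differentiable_continuous; exact/derivable1_diffP.
Qed.

Lemma der_near f g x l : (\forall y \near x, f y = g y) ->
  is_derive x 1 f l -> is_derive x 1 g l.
Proof.
move=> fg hf.
have fg' : {near x, f =1 g} by [].
by apply: near_eq_is_derive fg' hf; exact: oner_neq0.
Qed.

Lemma cts_within f a b :
  (forall x, a <= x <= b -> {for x, continuous f}) ->
  {within `[a, b], continuous f}.
Proof.
move=> cf; apply: continuous_in_subspaceT => x; rewrite inE /= in_itv /=.
exact: cf.
Qed.

Lemma mean_value f df a b : a < b ->
  (forall x, a <= x <= b -> is_derive x 1 f (df x)) ->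
  exists2 x, a < x < b & f b - f a = df x * (b - a).
Proof.
move=> ab hf.
have [||x xab e] := @MVT R f df a b ab.
- by move=> x; rewrite in_itv /= => /andP[x1 x2]; apply: hf; rewrite !ltW.
- by apply: cts_within => x /hf /der_cts.
by exists x => //; move: xab; rewrite in_itv.
Qed.

Lemma der_ge0_le f df a b : a <= b ->
  (forall x, a <= x <= b -> is_derive x 1 f (df x)) ->
  (forall x, a < x < b -> 0 <= df x) -> f a <= f b.
Proof.
rewrite le_eqVlt => /predU1P[->//|ab] hf h.
have [x xab e] := mean_value ab hf.
by rewrite -subr_ge0 e mulr_ge0 ?h // subr_ge0 ltW.
Qed.

Lemma der_gt0_lt f df a b : a < b ->
  (forall x, a <= x <= b -> is_derive x 1 f (df x)) ->
  (forall x, a < x < b -> 0 < df x) -> f a < f b.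
Proof.
move=> ab hf h.
have [x xab e] := mean_value ab hf.
by rewrite -subr_gt0 e mulr_gt0 ?h // subr_gt0.
Qed.

Lemma der_le0_ge f df a b : a <= b ->
  (forall x, a <= x <= b -> is_derive x 1 f (df x)) ->
  (forall x, a < x < b -> df x <= 0) -> f b <= f a.
Proof.
move=> ab hf h; rewrite -lerN2.
apply: (@der_ge0_le (fun x => - f x) (fun x => - df x)) => // x xab.
  by apply: derN; apply: hf.
by rewrite oppr_ge0; exact: h.
Qed.

Lemma der_lt0_gt f df a b : a < b ->
  (forall x, a <= x <= b -> is_derive x 1 f (df x)) ->
  (forall x, a < x < b -> df x < 0) -> f b < f a.
Proof.
move=> ab hf h; rewrite -ltrN2.
apply: (@der_gt0_lt (fun x => - f x) (fun x => - df x)) => // x xab.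
  by apply: derN; apply: hf.
by rewrite oppr_gt0; exact: h.
Qed.

Lemma lim_right_le f a b l m : a < b -> f x @[x --> a^'+] --> l ->
  (forall x, a < x < b -> f x <= m) -> l <= m.
Proof.
move=> ab fl h; rewrite leNgt; apply/negP => ml.
near a^'+ => x.
have fx : m < f x by near: x; exact: (cvgr_gt l).
have xab : a < x < b.
  apply/andP; split.
    by near: x; exact: nbhs_right_gt.
  by near: x; exact: nbhs_right_lt.
by have := h x xab; rewrite leNgt fx.
Unshelve. all: by end_near. Qed.

Lemma lim_right_ge f a b l m : a < b -> f x @[x --> a^'+] --> l ->
  (forall x, a < x < b -> m <= f x) -> m <= l.
Proof.
move=> ab fl h; rewrite -lerN2.
apply: (@lim_right_le (fun x => - f x) a b) => //; first exact: cvgN.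
by move=> x xab; rewrite lerN2; apply: h.
Qed.

Lemma der_ge0_lim_le f df a b l : a < b ->
  (forall x, a < x <= b -> is_derive x 1 f (df x)) ->
  f x @[x --> a^'+] --> l ->
  (forall x, a < x < b -> 0 <= df x) -> l <= f b.
Proof.
move=> ab hf fl h; apply: (lim_right_le ab fl) => x /andP[ax xb].
apply: (@der_ge0_le f df) => [|y /andP[y1 y2]|y /andP[y1 y2]]; first exact: ltW.
  by apply: hf; rewrite (lt_le_trans ax).
by apply: h; rewrite (lt_trans ax).
Qed.

Lemma der_gt0_lim_lt f df a b l : a < b ->
  (forall x, a < x <= b -> is_derive x 1 f (df x)) ->
  f x @[x --> a^'+] --> l ->
  (forall x, a < x < b -> 0 < df x) -> l < f b.
Proof.
move=> ab hf fl h; pose c := (a + b) / 2.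
have [ac cb] : a < c /\ c < b by rewrite /c; split; lra.
apply: (@le_lt_trans _ _ (f c)).
  apply: (@der_ge0_lim_le f df a) => // x /andP[ax xc].
    by apply: hf; rewrite ax (le_trans xc) // ltW.
  by apply/ltW/h; rewrite ax (lt_trans xc).
apply: (@der_gt0_lt f df) => // x /andP[cx xb].
  by apply: hf; rewrite (lt_le_trans ac).
by apply: h; rewrite (lt_trans ac).
Qed.

Lemma der_lt0_lim_gt f df a b l : a < b ->
  (forall x, a < x <= b -> is_derive x 1 f (df x)) ->
  f x @[x --> a^'+] --> l ->
  (forall x, a < x < b -> df x < 0) -> f b < l.
Proof.
move=> ab hf fl h; rewrite -ltrN2.
apply: (@der_gt0_lim_lt (fun x => - f x) (fun x => - df x) a) => //.
- by move=> x xab; apply: derN; apply: hf.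
- exact: cvgN.
- by move=> x xab; rewrite oppr_gt0; apply: h.
Qed.

Lemma cts_lt f x m : {for x, continuous f} -> f x < m ->
  exists2 e, 0 < e & forall y, `|y - x| < e -> f y < m.
Proof.
move=> cf fm.
have /nbhs_ballP[e /= e0 h] : nbhs x (fun y => f y < m) by exact: cvgr_lt (f x) cf m fm.
exists e => // y yx; apply: h; rewrite /ball /= distrC //.
Qed.

Lemma cts_gt f x m : {for x, continuous f} -> m < f x ->
  exists2 e, 0 < e & forall y, `|y - x| < e -> m < f y.
Proof.
move=> cf fm.
have /nbhs_ballP[e /= e0 h] : nbhs x (fun y => m < f y) by exact: cvgr_gt (f x) cf m fm.
exists e => // y yx; apply: h; rewrite /ball /= distrC //.
Qed.

Lemma first_zero f a b : a <= b ->
  (forall x, a <= x <= b -> {for x, continuous f}) -> f a < 0 -> 0 <= f b ->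
  exists t, [/\ a < t <= b, f t = 0 & forall x, a <= x < t -> f x < 0].
Proof.
move=> ab cf fa fb.
pose S := [set x | a <= x <= b /\ 0 <= f x].
have Sb : S b by split=> //; rewrite lexx ab.
have hS : has_inf S.
  split; first by exists b.
  by exists a => x [/andP[]].
pose t := inf S.
have at_ : a <= t by apply: lb_le_inf; [exists b|move=> x [/andP[]]].
have tb : t <= b by apply: ge_inf => //; exact: hS.2.
have low x : a <= x < t -> f x < 0.
  move=> /andP[ax xt]; rewrite ltNge; apply/negP => fx.
  have : t <= x.
    apply: ge_inf; first exact: hS.2.
    by split=> //; rewrite ax (le_trans (ltW xt)).
  by rewrite leNgt xt.
have ct : {for t, continuous f} by apply: cf; rewrite at_ tb.
have ft0 : 0 <= f t.
  rewrite leNgt; apply/negP => ft.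
  have [e e0 he] := cts_lt ct ft.
  have [x Sx xe] := inf_adherent e0 hS.
  have tx : t <= x by apply: ge_inf => //; exact: hS.2.
  have : f x < 0.
    by apply: he; rewrite ger0_norm ?subr_ge0 // ltrBlDl.
  by rewrite ltNge Sx.2.
have at' : a < t.
  by rewrite lt_neqAle at_ andbT; apply/eqP => E; move: ft0; rewrite -E leNgt fa.
exists t; split => //; first by rewrite at'.
apply/eqP; rewrite eq_le ft0 andbT leNgt; apply/negP => ft.
have [e e0 he] := cts_gt ct ft.
pose x := Num.max a (t - e / 2).
have xt : x < t by rewrite /x gt_max at' /=; lra.
have ax : a <= x by rewrite /x le_max lexx.
have xe : t - e / 2 <= x by rewrite /x le_max lexx orbT.
have : 0 < f x by apply: he; rewrite ltr0_norm; lra.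
by rewrite ltNge ltW // low // ax xt.
Qed.

Lemma last_zero f a b : a <= b ->
  (forall x, a <= x <= b -> {for x, continuous f}) -> f b < 0 -> 0 <= f a ->
  exists t, [/\ a <= t < b, f t = 0 & forall x, t < x <= b -> f x < 0].
Proof.
move=> ab cf fb fa.
have [||||t [tab ft h]] := @first_zero (fun x => f (- x)) (- b) (- a).
- by rewrite lerN2.
- move=> x /andP[x1 x2]; apply: continuous_comp; first exact: opp_continuous.
  by apply: cf; rewrite lerNr x2 lerNl x1.
- by rewrite opprK.
- by rewrite opprK.
move/andP: tab => [t1 t2].
exists (- t); split => //; first by rewrite lerNr t2 ltrNl t1.
move=> x /andP[x1 x2]; rewrite -[x]opprK; apply: h.
by rewrite lerN2 x2 ltrNl.
Qed.

(** Continuity induction: a negative sign can be lost only through a zero, so it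
    persists as soon as a zero preceded by negative values is impossible. *)
Lemma neg_propagates f a b : a <= b ->
  (forall x, a <= x <= b -> {for x, continuous f}) -> f a < 0 ->
  (forall t, a < t <= b -> (forall x, a <= x < t -> f x < 0) -> f t = 0 -> False) ->
  f b < 0.
Proof.
move=> ab cf fa h; rewrite ltNge; apply/negP => fb.
by have [t [tab ft ht]] := first_zero ab cf fa fb; apply: (h t).
Qed.

Lemma neg_propagates_left f a b : a <= b ->
  (forall x, a <= x <= b -> {for x, continuous f}) -> f b < 0 ->
  (forall t, a <= t < b -> (forall x, t < x <= b -> f x < 0) -> f t = 0 -> False) ->
  f a < 0.
Proof.
move=> ab cf fa h; rewrite ltNge; apply/negP => fb.
by have [t [tab ft ht]] := last_zero ab cf fa fb; apply: (h t).
Qed.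

Lemma der_pos_right f x l b : is_derive x 1 f l -> 0 < l -> x < b ->
  exists2 y, x < y < b & f x < f y.
Proof.
move=> hf l0 xb.
have [d e] := hf.
have fl : (fun h : R => h^-1 *: (f (h *: (1:R) + x) - f x)) @ 0^' --> l.
  by rewrite -e; exact: d.
have /nbhs_ballP[r /= r0 hr] :
    nbhs (0 : R) [set h | h != 0 -> 0 < h^-1 *: (f (h *: (1:R) + x) - f x)]
  by exact: cvgr_gt l fl 0 l0.
pose h := Num.min (r / 2) ((b - x) / 2).
have h0 : 0 < h by rewrite /h lt_min; apply/andP; split; lra.
have hr2 : h <= r / 2 by rewrite /h ge_min lexx.
have hb2 : h <= (b - x) / 2 by rewrite /h ge_min lexx orbT.
have hb : ball (0 : R) r h by rewrite /ball /= sub0r normrN gtr0_norm //; lra.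
exists (h + x); first by apply/andP; split; lra.
have : 0 < h^-1 *: (f (h *: (1:R) + x) - f x).
  by apply: hr => //; rewrite gt_eqF.
by rewrite /GRing.scale /= mulr1 pmulr_rgt0 ?invr_gt0 // subr_gt0.
Qed.

Lemma der_neg_left f x l a : is_derive x 1 f l -> l < 0 -> a < x ->
  exists2 y, a < y < x & f x < f y.
Proof.
move=> hf l0 ax.
have hx : is_derive (- x) 1 (fun y => f (- y)) (- l).
  have := @der_comp f (fun y => - y) (- x) l (- 1).
  rewrite opprK mulrN1 => H; apply: H => //; apply: derN; exact: der_id.
have [||y /andP[y1 y2] hy] := @der_pos_right _ _ _ (- a) hx.
- by rewrite oppr_gt0.
- by rewrite ltrN2.
exists (- y); first by rewrite ltrNr y2 ltrNl y1.
by rewrite opprK in hy.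
Qed.

(** Beyond the last zero before [b] the function would be negative, and there
    [f x * exp (- C * x)] is nondecreasing.  This uses the bound on the
    derivative only where [f < 0], which is how it is applied. *)
Lemma gronwall_ge0 f df (C a b : R) : a <= b ->
  (forall x, a <= x <= b -> is_derive x 1 f (df x)) -> 0 <= f a ->
  (forall x, a < x < b -> f x < 0 -> C * f x <= df x) -> 0 <= f b.
Proof.
move=> ab hf fa h; rewrite leNgt; apply/negP => fb.
have [|t [/andP[t1 t2] ft neg]] := last_zero ab _ fb fa.
  by move=> x hx; exact: der_cts (hf _ hx).
have : f t * expR (- C * t) <= f b * expR (- C * b).
  apply: (@der_ge0_le (fun x => f x * expR (- C * x))
            (fun x => (df x - C * f x) * expR (- C * x))) => [|x /andP[x1 x2]|x /andP[x1 x2]].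
  - exact: ltW.
  - have hx : is_derive x 1 (fun y => - C * y) (0 * x + - C * 1).
      exact: derM (der_cst _ _) (der_id _).
    have h1 : is_derive x 1 f (df x) by apply: hf; rewrite (le_trans t1) //= x2.
    apply: der_eq (derM h1 (der_comp (is_derive_expR _) hx)) _.
    by rewrite mul0r add0r mulr1; ring.
  - rewrite mulr_ge0 ?expR_ge0 // subr_ge0; apply: h.
      by rewrite (le_lt_trans t1) //= (lt_le_trans x2).
    by apply: neg; rewrite x1 ltW.
rewrite ft mul0r leNgt pmulr_llt0 ?expR_gt0 //.
by rewrite fb.
Qed.

Lemma gronwall_eq0 f df (C a b x0 : R) : a <= x0 <= b ->
  (forall x, a <= x <= b -> is_derive x 1 f (df x)) -> f x0 = 0 ->
  (forall x, a <= x <= b -> 0 <= f x) ->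
  (forall x, a <= x <= b -> `|df x| <= C * f x) ->
  forall x, a <= x <= b -> f x = 0.
Proof.
move=> /andP[ax0 x0b] hf fx0 f0 hC x /andP[ax xb].
apply/eqP; rewrite eq_le f0 ?ax // andbT.
have [x0x|xx0] := leP x0 x.
- rewrite -oppr_ge0.
  apply: (@gronwall_ge0 (fun y => - f y) (fun y => - df y) C x0 x) => //.
  + move=> y /andP[y1 y2]; apply: derN; apply: hf.
    by rewrite (le_trans ax0) // (le_trans y2).
  + by rewrite fx0 oppr0.
  + move=> y /andP[y1 y2] _; rewrite mulrN lerN2.
    apply: le_trans (ler_norm _) _; apply: hC.
    by rewrite (le_trans ax0 (ltW y1)) // (le_trans (ltW y2)).
- rewrite -oppr_ge0 -[x]opprK.
  apply: (@gronwall_ge0 (fun y => - f (- y)) (fun y => df (- y)) C (- x0) (- x)) => //.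
  + by rewrite lerN2 ltW.
  + move=> y /andP[y1 y2].
    have yab : a <= - y <= b.
      by rewrite lerNr (le_trans y2) ?lerN2 //= lerNl (le_trans _ y1) ?lerN2.
    have := derN (@der_comp f (fun y => - y) y _ _ (hf _ yab) (derN (der_id y))).
    by rewrite mulrN1 opprK.
  + by rewrite opprK fx0 oppr0.
  + move=> y /andP[y1 y2] _.
    have yab : a <= - y <= b.
      rewrite lerNr (le_trans (ltW y2)) ?lerN2 //= lerNl (le_trans _ (ltW y1)) //.
      by rewrite lerN2.
    by rewrite mulrN lerNl; apply: le_trans (hC _ yab); rewrite -normrN ler_norm.
Qed.

Lemma der_inverse f df a b :
  (forall x, a < x < b -> is_derive x 1 f (df x)) ->
  (forall x, a < x < b -> 0 < df x) ->
  exists g, forall x, a < x < b -> g (f x) = x /\ is_derive (f x) 1 g (df x)^-1.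
Proof.
move=> hf df0.
have incr x y : a < x < b -> a < y < b -> x < y -> f x < f y.
  move=> /andP[ax xb] /andP[ay yb] xy; apply: (@der_gt0_lt f df) => // z /andP[z1 z2].
    by apply: hf; rewrite (lt_le_trans ax) // (le_lt_trans z2).
  by apply: df0; rewrite (lt_trans ax) // (lt_trans z2).
have inj x y : a < x < b -> a < y < b -> f x = f y -> x = y.
  by move=> hx hy e; case: (ltgtP x y) => // h;
    [have := incr _ _ hx hy h|have := incr _ _ hy hx h]; rewrite e ltxx.
pose g y := xget 0 [set x | a < x < b /\ f x = y].
have gf x : a < x < b -> g (f x) = x.
  move=> hx; rewrite /g; case: xgetP => [z _ [hz e]|/(_ x)]; first exact: inj.
  by move=> []; split.
exists g => x hx; split; first exact: gf.
have nx : \forall y \near x, a < y < b.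
  move/andP: hx => [ax xb]; near=> y; apply/andP; split.
    by near: y; exact: lt_nbhsr.
  by near: y; exact: lt_nbhsl.
apply: is_derive_inverse; last by rewrite gt_eqF // df0.
- by near=> y; apply: gf; near: y.
- by near=> y; apply: (@der_cts _ _ (df y)); apply: hf; near: y.
- exact: hf.
Unshelve. all: by end_near. Qed.

Lemma ivt f a b v : a <= b -> (forall x, a <= x <= b -> {for x, continuous f}) ->
  f a <= v <= f b -> exists2 x, a <= x <= b & f x = v.
Proof.
move=> ab cf /andP[h1 h2].
have [|x xab e] := @IVT R f a b v ab (cts_within cf).
  by rewrite ge_min h1 /= le_max h2 orbT.
by exists x => //; move: xab; rewrite in_itv.
Qed.

Lemma ivt_decr f a b v : a <= b ->
  (forall x, a <= x <= b -> {for x, continuous f}) ->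
  f b <= v <= f a -> exists2 x, a <= x <= b & f x = v.
Proof.
move=> ab cf /andP[h1 h2].
have [|x xab e] := @IVT R f a b v ab (cts_within cf).
  by rewrite ge_min h1 orbT /= le_max h2.
by exists x => //; move: xab; rewrite in_itv.
Qed.

Lemma cts_bounded f a b : a <= b ->
  (forall x, a <= x <= b -> {for x, continuous f}) ->
  exists2 C, 0 < C & forall x, a <= x <= b -> `|f x| <= C.
Proof.
move=> ab cf.
have cn : {within `[a, b], continuous (fun x => `|f x|)}.
  apply: cts_within => x hx; apply: continuous_comp; first exact: cf.
  exact: norm_continuous.
have [c cab h] := EVT_max ab cn.
exists (`|f c| + 1); first by rewrite ltr_wpDl.
by move=> x hx; rewrite (le_trans (h x _)) ?in_itv // lerDl.
Qed.

Lemma antiderivative phi a : continuous phi ->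
  exists Phi : R -> R, forall x, a < x -> is_derive x 1 Phi (phi x).
Proof.
move=> cphi.
exists (fun x => (\int[lebesgue_measure]_(t in [set` `[a, x]]) phi t)%R) => x ax.
have x1 : x < x + 1 by rewrite ltrDl.
have int : (@lebesgue_measure R).-integrable `[a, x + 1] (EFin \o phi).
  apply: continuous_compact_integrable; first exact: segment_compact.
  exact: continuous_subspaceT.
have [d e] := @continuous_FTC1_closed R phi a x (x + 1) x1 int ax (cphi x).
by rewrite -e derive1E; exact: derivableP.
Qed.

(** The monotone form of l'Hopital's rule, for [P' = c J'] with [c]
    nonincreasing: [P / J] is a [J']-weighted mean of [c], hence is at least the
    last value of [c], and nonincreasing.  Quotients are cleared because [J]
    may vanish. *)
Lemma ratio_nonincreasing (P J dJ c : R -> R) a x y : x <= y ->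
  a < x ->
  (forall t, a < t <= y -> is_derive t 1 J (dJ t)) ->
  (forall t, a < t <= y -> is_derive t 1 P (c t * dJ t)) ->
  (forall t, a < t <= y -> 0 <= dJ t) ->
  (forall s t, a < s -> s <= t -> t <= y -> c t <= c s) ->
  J t @[t --> a^'+] --> 0 -> (exists2 p : R, 0 <= p & P t @[t --> a^'+] --> p) ->
  [/\ 0 <= J x, c x * J x <= P x & P y * J x <= P x * J y].
Proof.
move=> xy ax hJ hP dJ0 cmono J0 [p p0 Pp].
have Jx : 0 <= J x.
  apply: (@der_ge0_lim_le J dJ a) => // t /andP[t1 t2].
    by apply: hJ; rewrite t1 (le_trans t2).
  by apply: dJ0; rewrite t1 (le_trans (ltW t2)).
have h1 : c x * J x <= P x.
  have : p - c x * 0 <= P x - c x * J x.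
    apply: (@der_ge0_lim_le (fun t => P t - c x * J t)
       (fun t => c t * dJ t - (0 * J t + c x * dJ t)) a) => //.
    - move=> t /andP[t1 t2]; have ty : a < t <= y by rewrite t1 (le_trans t2).
      exact: derB (hP _ ty) (derM (der_cst _ _) (hJ _ ty)).
    - by apply: cvgB => //; apply: cvgM => //; exact: cvg_cst.
    - move=> t /andP[t1 t2]; rewrite mul0r add0r -mulrBl mulr_ge0 //.
        by rewrite subr_ge0; apply: cmono => //; exact: ltW.
      by apply: dJ0; rewrite t1 (le_trans (ltW t2)).
  by rewrite mulr0 subr0 => hh; rewrite -subr_ge0 (le_trans p0 hh).
have h2 : P y - c x * J y <= P x - c x * J x.
  apply: (@der_le0_ge (fun t => P t - c x * J t)
       (fun t => c t * dJ t - (0 * J t + c x * dJ t))) => //.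
  - move=> t /andP[t1 t2]; have ty : a < t <= y by rewrite (lt_le_trans ax).
    exact: derB (hP _ ty) (derM (der_cst _ _) (hJ _ ty)).
  - move=> t /andP[t1 t2]; rewrite mul0r add0r -mulrBl mulr_le0_ge0 //.
      by rewrite subr_le0; apply: cmono => //; exact: ltW.
    by apply: dJ0; rewrite (lt_trans ax) //= ltW.
have Jxy : J x <= J y.
  apply: (@der_ge0_le J dJ) => // t /andP[t1 t2].
    by apply: hJ; rewrite (lt_le_trans ax).
  by apply: dJ0; rewrite (lt_trans ax) //= ltW.
split => //; nra.
Qed.

End Calculus.
(** * The abstract equation and the shape of its solutions *)

Section Solutions.
Context {R : realType}.

(** The primitive [J] of [q] and the function [h] are parameters, so that the
    integrals which define them are used only once, to build an instance.  The
    field [h_dq] expresses that [h / q] has derivative [- 1 / q]. *)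
Record weight (q dq h dh J : R -> R) : Prop := Weight {
  q_gt0 : forall r : R, 0 < r -> 0 < q r;
  q_der : forall r : R, 0 < r -> is_derive r 1 q (dq r);
  dq_gt0 : forall r : R, 0 < r -> 0 < dq r;
  q_lim : q r @[r --> 0^'+] --> 0;
  h_gt0 : forall r : R, 0 < r -> 0 < h r;
  h_der : forall r : R, 0 < r -> is_derive r 1 h (dh r);
  dh_gt0 : forall r : R, 0 < r -> 0 < dh r;
  dh_mono : forall r s : R, 0 < r -> r <= s -> dh s <= dh r;
  h_dq : forall r : R, 0 < r -> h r * dq r = q r * (1 + dh r);
  k_decr : forall r s : R, 0 < r -> r < s -> dq s / q s < dq r / q r;
  J_der : forall r : R, 0 < r -> is_derive r 1 J (q r);
  J_lim : J r @[r --> 0^'+] --> 0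
}.

(** The bound [M] stands for the largest value of the two solutions, which is
    below [c].  A primitive [F] of [f] is a parameter; its derivative at [0] and
    at [M] is two-sided, so that the chain rule applies to [F] composed with a
    solution. *)
Record nonlinearity (f df F : R -> R) (b M : R) : Prop := Nonlinearity {
  b_gt0 : 0 < b;
  f_der : forall s : R, 0 < s <= M -> is_derive s 1 f (df s);
  df_cts : forall s : R, 0 < s <= M -> {for s, continuous df};
  f_gt0 : forall s : R, b < s <= M -> 0 < f s;
  f_le0 : forall s : R, 0 <= s <= b -> f s <= 0;
  g_mono : forall s t : R, b < s -> s <= t -> t <= M ->
    t * df t / f t <= s * df s / f s;
  F_der : forall s : R, 0 <= s <= M -> is_derive s 1 F (f s)
}.

(** [G] is the slope [- u'], which turns out to be positive as long as [u] is. *)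
Record ground_state (q f : R -> R) (M : R) (u G : R -> R) : Prop := GroundState {
  u_der : forall r : R, 0 < r -> is_derive r 1 u (- G r);
  qG_der : forall r : R, 0 < r -> is_derive r 1 (fun x => q x * G x) (q r * f (u r));
  u_range : forall r : R, 0 <= r -> 0 <= u r <= M;
  u0_pos : 0 < u 0;
  u_lim : u r @[r --> 0^'+] --> u 0;
  G_lim : G r @[r --> 0^'+] --> 0;
  u_inf : forall e : R, 0 < e -> exists X : R, forall r : R, X < r -> u r < e
}.

Section OneSolution.
Implicit Types (r s t e m x : R).
Context (q dq h dh J f df F : R -> R) (b M : R) (u G : R -> R).
Context (W : weight q dq h dh J) (N : nonlinearity f df F b M)
  (S : ground_state q f M u G).

Lemma q_neq0 r : 0 < r -> q r != 0.
Proof. by move=> r0; rewrite gt_eqF // (q_gt0 W). Qed.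

Lemma h_dk r : 0 < r -> h r * (dq r / q r) = 1 + dh r.
Proof.
move=> r0; rewrite mulrA (h_dq W) // mulrAC divff ?mul1r //.
exact: q_neq0.
Qed.

Lemma k_gt0 r : 0 < r -> 0 < dq r / q r.
Proof. by move=> r0; rewrite divr_gt0 ?(dq_gt0 W) ?(q_gt0 W). Qed.

Lemma h_incr r s : 0 < r -> r < s -> h r < h s.
Proof.
move=> r0 rs; apply: (@der_gt0_lt R h dh) => // x /andP[x1 x2].
  by apply: (h_der W); rewrite (lt_le_trans r0).
by apply: (dh_gt0 W); rewrite (lt_trans r0).
Qed.

Lemma q_incr r s : 0 < r -> r < s -> q r < q s.
Proof.
move=> r0 rs; apply: (@der_gt0_lt R q dq) => // x /andP[x1 x2].
  by apply: (q_der W); rewrite (lt_le_trans r0).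
by apply: (dq_gt0 W); rewrite (lt_trans r0).
Qed.

Lemma lim0_mulh (x : R -> R) : x r @[r --> 0^'+] --> 0 ->
  (h r * x r) @[r --> 0^'+] --> 0.
Proof.
move=> xl.
have nl : (`|h 1| * `|x r|) @[r --> 0^'+] --> 0.
  have := @cvgM _ _ (0 : R)^'+ _ (fun=> `|h 1|) (fun r => `|x r|) _ _ (@cvg_cst _ `|h 1| _ _ _) (cvg_norm xl).
  by rewrite normr0 mulr0; apply.
apply: norm_cvg0; apply: (squeeze_cvgr _ (cvg_cst 0) nl).
near=> r; rewrite normr_ge0 /= normrM ler_wpM2r //.
have r0 : 0 < r by near: r; exact: nbhs_right_gt.
have r1 : r < 1 by near: r; exact: nbhs_right_lt.
by rewrite !gtr0_norm ?(h_gt0 W) // ltW // h_incr.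
Unshelve. all: by end_near. Qed.

Lemma h_linear r : 1 <= r -> h r <= (h 1 + dh 1) * r.
Proof.
move=> r1.
have : h r - dh 1 * r <= h 1 - dh 1 * 1.
  apply: (@der_le0_ge R (fun x => h x - dh 1 * x) (fun x => dh x - (0 * x + dh 1 * 1))) => //.
    move=> x /andP[x1 x2]; have x0 : 0 < x by apply: lt_le_trans x1.
    exact: derB (h_der W x0) (derM (der_cst _ _) (der_id _)).
  move=> x /andP[x1 x2]; rewrite mul0r add0r mulr1 subr_le0.
  by apply: (dh_mono W) => //; exact: ltW.
have := h_gt0 W (@ltr01 R); have := dh_gt0 W (@ltr01 R); nra.
Qed.

Lemma G_der r : 0 < r -> is_derive r 1 G (f (u r) - dq r / q r * G r).
Proof.
move=> r0.
have H := der_div (qG_der S r0) (q_der W r0) (q_neq0 r0).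
apply: (@der_near R (fun y => q y * G y / q y)).
  near=> y; rewrite mulrAC divff ?mul1r // q_neq0 //.
  by near: y; exact: lt_nbhsr.
by apply: der_eq H _; field; exact: q_neq0.
Unshelve. all: by end_near. Qed.

Lemma u_cts r : 0 < r -> {for r, continuous u}.
Proof. by move=> /(u_der S) /der_cts. Qed.

Lemma G_cts r : 0 < r -> {for r, continuous G}.
Proof. by move=> /G_der /der_cts. Qed.

Lemma u_ge0 r : 0 <= r -> 0 <= u r.
Proof. by move=> r0; have /andP[] := u_range S r0. Qed.

Lemma u_leM r : 0 <= r -> u r <= M.
Proof. by move=> r0; have /andP[] := u_range S r0. Qed.

Lemma M_gt0 : 0 < M.
Proof. exact: lt_le_trans (u0_pos S) (u_leM (lexx 0)). Qed.

(** Decreasing along a solution and bounded below by [F 0], its value for the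
    zero solution, the energy excludes critical points at levels in [(0, b]]. *)
Definition energy r := G r * G r / 2 + F (u r).

Lemma energy_der r : 0 < r -> is_derive r 1 energy (- (dq r / q r) * (G r * G r)).
Proof.
move=> r0.
have hF : is_derive r 1 (fun x => F (u x)) (f (u r) * - G r).
  by apply: der_comp (u_der S r0); apply: (F_der N); apply: (u_range S); exact: ltW.
apply: der_eq (derD (derM (derM (G_der r0) (G_der r0)) (der_cst _ _)) hF) _.
by lra.
Qed.

Lemma energy_noninc r s : 0 < r -> r <= s -> energy s <= energy r.
Proof.
move=> r0 rs; apply: (@der_le0_ge R energy _ r s rs).
  by move=> x /andP[x1 x2]; apply: energy_der; exact: lt_le_trans x1.
move=> x /andP[x1 x2] /=; rewrite mulNr oppr_le0 mulr_ge0 //.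
  by rewrite ltW // k_gt0 // (lt_trans r0).
by rewrite -expr2 sqr_ge0.
Qed.

Lemma F_cts s : 0 <= s <= M -> {for s, continuous F}.
Proof. by move=> /(F_der N) /der_cts. Qed.

Lemma energy_ge r : 0 < r -> F 0 <= energy r.
Proof.
move=> r0; rewrite leNgt; apply/negP => E.
have M0 := ltW M_gt0.
have c0 : {for 0, continuous F} by apply: F_cts; rewrite lexx.
have [e e0 he] := cts_gt c0 E.
have [X hX] := u_inf S e0.
pose r' := Num.max r (X + 1).
have rr' : r <= r' by rewrite le_max lexx.
have Xr : X < r' by rewrite lt_max ltrDl ltr01 orbT.
have r'0 : 0 < r' by exact: lt_le_trans rr'.
have : energy r < F (u r').
  by apply: he; rewrite subr0 ger0_norm ?hX // u_ge0 // ltW.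
rewrite ltNge => /negP; apply.
apply: le_trans (energy_noninc r0 rr').
by rewrite /energy lerDr divr_ge0 // -expr2 sqr_ge0.
Qed.

(** The energy is also at least [F 0], so it is constant beyond [r0]; since it
    dissipates a positive multiple of [G ^ 2], the solution is constant there. *)
Lemma flat_zero r0 : 0 <= r0 -> (forall r, r0 < r -> energy r <= F 0) ->
  forall r, r0 < r -> u r = 0.
Proof.
move=> r00 hE.
have Ec r : r0 < r -> energy r = F 0.
  by move=> rr; apply/eqP; rewrite eq_le hE // energy_ge // (le_lt_trans r00).
have G0 r : r0 < r -> G r = 0.
  move=> rr; apply/eqP; apply: contraT => Gr.
  have r1 : 0 < r by exact: le_lt_trans rr.
  have neg : - (dq r / q r) * (G r * G r) < 0.
    by rewrite mulNr oppr_lt0 mulr_gt0 ?k_gt0 // -expr2 exprn_even_gt0.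
  have [y /andP[y1 y2]] := der_neg_left (energy_der r1) neg rr.
  by rewrite !Ec // ltxx.
move=> r rr.
have r1 : 0 < r by exact: le_lt_trans rr.
have uc s : r <= s -> u r <= u s.
  move=> rs; apply: (@der_ge0_le R u (fun x => - G x)) => // x /andP[x1 x2].
    by apply: (u_der S); exact: lt_le_trans x1.
  by rewrite G0 ?oppr0 // (lt_trans rr).
apply/eqP; rewrite eq_le (u_ge0 (ltW r1)) andbT leNgt; apply/negP => ur.
have [X hX] := u_inf S ur.
pose s := Num.max r (X + 1).
have rs : r <= s by rewrite le_max lexx.
have Xr : X < s by rewrite lt_max ltrDl ltr01 orbT.
by have := hX _ Xr; rewrite ltNge uc.
Qed.

Lemma F_noninc s : 0 <= s -> s <= b -> s <= M -> F s <= F 0.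
Proof.
move=> s0 sb sM; apply: (@der_le0_ge R F f) => // x /andP[x1 x2].
  by apply: (F_der N); rewrite x1 (le_trans x2).
by apply: (f_le0 N); rewrite (ltW x1) (le_trans (ltW x2)).
Qed.

Lemma critical_zero r0 : 0 < r0 -> G r0 = 0 -> u r0 <= b ->
  forall r, r0 <= r -> u r = 0.
Proof.
move=> r00 Gr ub.
have H r : r0 < r -> u r = 0.
  apply: flat_zero => [|x rx]; first exact: ltW.
  apply: le_trans (energy_noninc r00 (ltW rx)) _.
  rewrite /energy Gr !mul0r add0r; apply: F_noninc => //.
    by rewrite u_ge0 // ltW.
  by rewrite u_leM // ltW.
move=> r; rewrite le_eqVlt => /predU1P[<-|]; last exact: H.
apply/eqP; rewrite eq_le (u_ge0 (ltW r00)) andbT leNgt; apply/negP => ut.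
have [d d0 hd] := cts_gt (u_cts r00) ut.
have r0d : r0 < r0 + d / 2 by lra.
have : 0 < u (r0 + d / 2) by apply: hd; rewrite gtr0_norm; lra.
by rewrite H // ltxx.
Qed.

Lemma zero_critical r : 0 < r -> u r = 0 -> G r = 0.
Proof.
move=> r0 ur; apply/eqP; rewrite eq_le !leNgt; apply/andP; split; apply/negP => Gr.
- have d := derN (u_der S r0); rewrite opprK in d.
  have [|y /andP[y1 y2]] := der_pos_right d Gr (_ : r < r + 1); first by rewrite ltrDl.
  by rewrite ur oppr0 oppr_gt0 ltNge u_ge0 // ltW // (lt_trans r0).
- have d := derN (u_der S r0); rewrite opprK in d.
  have [y /andP[y1 y2]] := der_neg_left d Gr r0.
  by rewrite ur oppr0 oppr_gt0 ltNge u_ge0 // ltW.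
Qed.

Lemma zero_after r s : 0 < r -> u r = 0 -> r <= s -> u s = 0.
Proof.
move=> r0 ur; apply: critical_zero => //; first exact: zero_critical.
by rewrite ur ltW // (b_gt0 N).
Qed.

Lemma pos_before r s : 0 < r -> r <= s -> 0 < u s -> 0 < u r.
Proof.
move=> r0 rs us; rewrite lt_neqAle (u_ge0 (ltW r0)) andbT; apply/eqP => E.
by move: us; rewrite (@zero_after r s) // ltxx.
Qed.

(** Otherwise the initial energy [F (u 0)] is at most its lower bound [F 0]. *)
Lemma start_gt_b : b < u 0.
Proof.
rewrite ltNge; apply/negP => ub.
have El : energy r @[r --> 0^'+] --> 0 * 0 / 2 + F (u 0).
  apply: cvgD.
    apply: cvgM; last exact: cvg_cst.
    by apply: cvgM; exact: (G_lim S).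
  apply: (cvg_comp u F (u_lim S)).
  by apply: F_cts; rewrite u_ge0 // u_leM.
have Fu : F (u 0) <= F 0 by apply: F_noninc; rewrite ?u_ge0 ?u_leM.
have z : forall r, 0 < r -> u r = 0.
  apply: flat_zero => // r r0.
  apply: le_trans Fu.
  rewrite -[leRHS]add0r -{1}(mul0r (2^-1)) -{1}(mul0r (0:R)).
  apply: (@lim_right_ge R energy 0 r) => // x /andP[x1 x2].
  by apply: energy_noninc => //; exact: ltW.
have : u 0 <= 0.
  apply: (@lim_right_le R u 0 1 _ _ ltr01 (u_lim S)) => x /andP[x1 _].
  by rewrite z.
by rewrite leNgt (u0_pos S).
Qed.

Lemma near0_gt m : m < u 0 -> exists2 e, 0 < e & forall r, 0 < r <= e -> m < u r.
Proof.
move=> mu.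
have /nbhs_ballP[e /= e0 he] : nbhs (0 : R) [set r | 0 < r -> m < u r]
  by exact: cvgr_gt (u 0) (u_lim S) m mu.
exists (e / 2); first lra.
move=> r /andP[r0 re]; apply: he => //.
by rewrite /ball /= sub0r normrN gtr0_norm //; lra.
Qed.

Lemma qG_lim : (q r * G r) @[r --> 0^'+] --> 0.
Proof. by have := cvgM (q_lim W) (G_lim S); rewrite mulr0; apply. Qed.

Lemma qG_pos r : 0 < r -> (forall x, 0 < x <= r -> b < u x) -> 0 < G r.
Proof.
move=> r0 hb.
have : 0 < q r * G r.
  apply: (@der_gt0_lim_lt R (fun x => q x * G x) (fun x => q x * f (u x)) 0 r 0 r0) => //.
  - by move=> x /andP[x1 x2]; exact: (qG_der S).
  - exact: qG_lim.
  - move=> x /andP[x1 x2]; rewrite mulr_gt0 ?(q_gt0 W) // (f_gt0 N) //.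
    by rewrite (u_leM (ltW x1)) andbT; apply: hb; rewrite x1 ltW.
by rewrite pmulr_rgt0 // (q_gt0 W).
Qed.

(** At a first critical point, a level above [b] is excluded because [q G] has
    increased so far, and a level in [(0, b]] by the energy. *)
Lemma G_pos r : 0 < r -> 0 < u r -> 0 < G r.
Proof.
move=> r0 ur; rewrite ltNge; apply/negP => Gr.
have [e e0 he] := near0_gt start_gt_b.
pose e' := Num.min e r.
have e'0 : 0 < e' by rewrite lt_min e0 r0.
have e'r : e' <= r by rewrite ge_min lexx orbT.
have he' x : 0 < x <= e' -> b < u x.
  move=> /andP[x0 xe]; apply: he; rewrite x0 (le_trans xe) //.
  by rewrite ge_min lexx.
have Ge : 0 < G e' by exact: qG_pos.
have [|||t [/andP[t1 t2] Gt ht]] := @first_zero R (fun x => - G x) e' r e'r.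
- move=> x /andP[x1 x2]; apply: cvgN; apply: G_cts; exact: lt_le_trans x1.
- by rewrite oppr_lt0.
- by rewrite oppr_ge0.
have t0 : 0 < t by exact: lt_trans t1.
have Gt0 : G t = 0 by apply/eqP; rewrite -oppr_eq0 Gt.
have [utb|utb] := leP (u t) b.
  by move: ur; rewrite (critical_zero t0 Gt0 utb) // ltxx.
have : 0 < G t.
  apply: qG_pos => // x /andP[x0 xt].
  have [xe|ex] := leP x e'; first by apply: he'; rewrite x0.
  apply: lt_le_trans utb _.
  apply: (@der_le0_ge R u (fun y => - G y)) => // y /andP[y1 y2].
    by apply: (u_der S); exact: lt_le_trans y1.
  by apply/ltW/ht; rewrite y2 andbT ltW // (lt_trans ex).
by rewrite Gt0 ltxx.
Qed.

Lemma G_ge0 r : 0 < r -> 0 <= G r.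
Proof.
move=> r0; have := u_ge0 (ltW r0); rewrite le_eqVlt => /predU1P[E|/(G_pos r0)/ltW//].
by rewrite zero_critical.
Qed.

Lemma u_noninc r s : 0 < r -> r <= s -> u s <= u r.
Proof.
move=> r0 rs; apply: (@der_le0_ge R u (fun y => - G y)) => // y /andP[y1 y2].
  by apply: (u_der S); exact: lt_le_trans y1.
by rewrite oppr_le0 G_ge0 // (lt_trans r0).
Qed.

Lemma u_decr r s : 0 < r -> r < s -> 0 < u r -> u s < u r.
Proof.
move=> r0 rs ur.
have := u_ge0 (ltW (lt_trans r0 rs)); rewrite le_eqVlt => /predU1P[<-//|us].
apply: (@der_lt0_gt R u (fun y => - G y)) => // y /andP[y1 y2].
  by apply: (u_der S); exact: lt_le_trans y1.
have y0 : 0 < y by exact: lt_trans y1.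
rewrite oppr_lt0 G_pos // (@pos_before y s) //; exact: ltW.
Qed.

Lemma u_lt_start r : 0 < r -> u r < u 0.
Proof.
move=> r0; have [ur|] := ltP 0 (u r); last first.
  by move=> ur; exact: le_lt_trans (u0_pos S).
apply: (@der_lt0_lim_gt R u (fun y => - G y) 0 r) => //.
- by move=> x /andP[x1 _]; exact: (u_der S).
- exact: (u_lim S).
- move=> x /andP[x1 x2]; rewrite oppr_lt0 G_pos //.
  by apply: (@pos_before x r) => //; exact: ltW.
Qed.

Lemma level_exists s : 0 < s -> s < u 0 -> exists2 r, 0 < r & u r = s.
Proof.
move=> s0 su.
have [e e0 he] := near0_gt su.
have [X hX] := u_inf S s0.
pose Y := Num.max e (X + 1).
have eY : e <= Y by rewrite le_max lexx.
have XY : X < Y by rewrite lt_max ltrDl ltr01 orbT.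
have [||r /andP[r1 r2] ur] := @ivt_decr R u e Y s eY.
- by move=> x /andP[x1 x2]; apply: u_cts; exact: lt_le_trans x1.
- by rewrite ltW ?hX //= ltW // he // e0 lexx.
by exists r => //; exact: lt_le_trans r1.
Qed.

Lemma hG_der r : 0 < r -> is_derive r 1 (fun x => h x * G x) (h r * f (u r) - G r).
Proof.
move=> r0; apply: der_eq (derM (h_der W r0) (G_der r0)) _.
have := h_dk r0; set k := dq r / q r => E.
have -> : dh r = h r * k - 1 by rewrite E; ring.
ring.
Qed.

(** Below the level [b] the solution is convex as a function of the harmonic
    coordinate [V = int_r^oo 1/q = h / q], in which [h G] is [V du/dV]: the
    tangent lines lie below the graph, which ends at height [0] at [V = 0].
    Concretely, [u - h G] is nondecreasing and cannot become positive. *)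
Lemma hG_ge r : 0 < r -> 0 < u r -> u r <= b -> u r <= h r * G r.
Proof.
move=> r0 ur ub; rewrite leNgt; apply/negP => P.
have P' : 0 < u r - h r * G r by rewrite subr_gt0.
have [X hX] := u_inf S P'.
pose s := Num.max r (X + 1).
have rs : r <= s by rewrite le_max lexx.
have Xr : X < s by rewrite lt_max ltrDl ltr01 orbT.
have s0 : 0 < s by exact: lt_le_trans rs.
have : u r - h r * G r <= u s - h s * G s.
  apply: (@der_ge0_le R (fun x => u x - h x * G x)
    (fun x => - G x - (h x * f (u x) - G x))) => // x /andP[x1 x2].
    have x0 : 0 < x by exact: lt_le_trans x1.
    exact: derB (u_der S x0) (hG_der x0).
  have x0 : 0 < x by exact: lt_trans x1.
  have : 0 <= - (h x * f (u x)).
    rewrite -mulrN mulr_ge0 //; first by rewrite ltW // (h_gt0 W).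
    rewrite oppr_ge0 (f_le0 N) // (u_ge0 (ltW x0)) /= (le_trans _ ub) //.
    by apply: u_noninc => //; exact: ltW.
  lra.
have := hX _ Xr; have := mulr_ge0 (ltW (h_gt0 W s0)) (G_ge0 s0); lra.
Qed.

(** If the solution vanishes at some point, so does its slope there.  If not,
    [h] grows at most linearly, hence [h G >= e] would force a logarithmic decay
    down to negative values. *)
Lemma hG_small e : 0 < e ->
  exists r, [/\ 0 < r, 0 < u r, u r <= b & h r * G r < e].
Proof.
move=> e0; apply: contrapT => H.
have big r : 0 < r -> 0 < u r -> u r <= b -> e <= h r * G r.
  by move=> r0 ur ub; rewrite leNgt; apply/negP => lt; apply: H; exists r.
have [rb rb0 urb] := level_exists (b_gt0 N) start_gt_b.
have pos r : rb <= r -> 0 < u r.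
  move=> rr; have r0 : 0 < r by exact: lt_le_trans rr.
  rewrite lt_neqAle (u_ge0 (ltW r0)) andbT; apply/eqP => E.
  have [|||t [/andP[t1 t2] ut ht]] := @first_zero R (fun x => - u x) rb r rr.
  - by move=> x /andP[x1 _]; apply: cvgN; apply: u_cts; exact: lt_le_trans x1.
  - by rewrite urb oppr_lt0 (b_gt0 N).
  - by rewrite -E oppr0.
  have t0 : 0 < t by exact: lt_trans t1.
  have ut0 : u t = 0 by apply/eqP; rewrite -oppr_eq0 ut.
  have c : {for t, continuous (fun x => h x * G x)} by exact: der_cts (hG_der t0).
  have lt : h t * G t < e by rewrite zero_critical // mulr0.
  have [d d0 hd] := cts_lt c lt.
  pose x := Num.max rb (t - d / 2).
  have xt : x < t by rewrite gt_max t1 /=; lra.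
  have rx : rb <= x by rewrite le_max lexx.
  have dx : t - d / 2 <= x by rewrite le_max lexx orbT.
  have x0 : 0 < x by exact: lt_le_trans rx.
  have : h x * G x < e by apply: hd; rewrite ltr0_norm; lra.
  rewrite ltNge big //.
    by rewrite -oppr_lt0; apply: ht; rewrite rx.
  by rewrite -urb u_noninc.
pose C := h 1 + dh 1.
have C0 : 0 < C by rewrite addr_gt0 ?(h_gt0 W) ?(dh_gt0 W).
pose r1 := Num.max rb 1.
have r1b : rb <= r1 by rewrite le_max lexx.
have r11 : 1 <= r1 by rewrite le_max lexx orbT.
have log s : r1 <= s -> u s + e / C * ln s <= u r1 + e / C * ln r1.
  move=> rs; apply: (@der_le0_ge R (fun x => u x + e / C * ln x)
    (fun x => - G x + (0 * ln x + e / C * (1 / x)))) => // x /andP[x1 x2].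
    have x0 : 0 < x by apply: lt_le_trans x1; apply: lt_le_trans r11.
    exact: derD (u_der S x0) (derM (der_cst _ _) (der_ln (der_id _) x0)).
  have x0 : 0 < x by apply: lt_trans x1; apply: lt_le_trans r11.
  have x11 : 1 <= x by rewrite (le_trans r11) // ltW.
  have rbx : rb <= x by rewrite (le_trans r1b) // ltW.
  have hx : h x <= C * x by exact: h_linear.
  have := big x x0 (pos _ rbx) _; rewrite -urb u_noninc // => /(_ isT) eh.
  have Gx := G_ge0 x0.
  have : e / (C * x) <= G x.
    rewrite ler_pdivrMr ?mulr_gt0 //; apply: le_trans eh _.
    by rewrite mulrC ler_wpM2l.
  by rewrite mul0r add0r div1r -mulrA -invfM; lra.
pose K := u r1 + e / C * ln r1.
(* There the logarithmic bound gives [u s <= - 1]. *)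
pose s := Num.max r1 (expR ((K + 1) * (C / e))).
have rs : r1 <= s by rewrite le_max lexx.
have s0 : 0 < s by apply: lt_le_trans rs; apply: lt_le_trans r11.
have eC : 0 < e / C by rewrite divr_gt0.
have : (K + 1) * (C / e) <= ln s.
  rewrite -ler_expR lnK ?posrE // le_max lexx orbT //.
have ee : e / C * (C / e) = 1 by field; rewrite !gt_eqF.
move=> /(ler_wpM2l (ltW eC)); rewrite mulrCA ee mulr1 => l1.
have l2 := log s rs; have us := u_ge0 (ltW s0).
move: l1 l2 us; rewrite -/K; lra.
Qed.

(** Up to a positive factor, [tilt] is the derivative of [h G / u]. *)
Definition tilt r := h r * (G r * G r) - u r * G r + h r * (u r * f (u r)).

Lemma lim_fu : f (u r) @[r --> 0^'+] --> f (u 0).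
Proof.
apply: (cvg_comp u f (u_lim S)).
by apply: der_cts; apply: (f_der N); rewrite (u0_pos S) u_leM.
Qed.

Lemma qh_lim : (h r * q r) @[r --> 0^'+] --> 0.
Proof. exact: lim0_mulh (q_lim W). Qed.

(** [s f(s)] has derivative [(1 + s f'(s) / f(s)) f(s)], with a nonincreasing
    first factor, so its ratio to the primitive [F s - F s1] is governed by the
    monotone rule of l'Hopital. *)
Lemma virial s1 s t : b <= s1 -> s1 < s -> s <= t -> t <= M ->
  [/\ 0 < F s - F s1, (1 + s * df s / f s) * (F s - F s1) <= s * f s
    & t * f t * (F s - F s1) <= s * f s * (F t - F s1)].
Proof.
move=> bs1 s1s st tM.
have b0 := b_gt0 N.
have s10 : 0 < s1 by exact: lt_le_trans bs1.
have rng x : s1 < x -> x <= t -> [/\ 0 < x, b < x, x <= M & 0 < f x].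
  move=> x1 x2; have bx : b < x by exact: le_lt_trans x1.
  have xM : x <= M by exact: le_trans tM.
  by split => //; [exact: lt_trans bx|apply: (f_gt0 N); rewrite bx].
have s1M : s1 <= M by rewrite (le_trans (ltW s1s)) // (le_trans st).
have bM : b <= M by exact: le_trans s1M.
have bs : b < s by exact: le_lt_trans s1s.
have [||||||h1 h2 h3] := @ratio_nonincreasing R (fun x => x * f x) (fun x => F x - F s1)
  f (fun x => 1 + x * df x / f x) s1 s t st s1s.
- move=> x /andP[x1 x2]; have [x0 _ xM _] := rng x x1 x2.
  rewrite -[f x]subr0; apply: derB (der_cst _ _).
  by apply: (F_der N); rewrite ltW.
- move=> x /andP[x1 x2]; have [x0 _ xM fx] := rng x x1 x2.
  have d : is_derive x 1 f (df x) by apply: (f_der N); rewrite x0.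
  apply: der_eq (derM (der_id x) d) _; field; exact: lt0r_neq0.
- by move=> x /andP[x1 x2]; have [_ _ _ fx] := rng x x1 x2; exact: ltW.
- move=> x y x1 xy yt; have [_ bx _ _] := rng x x1 (le_trans xy yt).
  by rewrite lerD2l; apply: (g_mono N) => //; exact: le_trans tM.
- rewrite -(subrr (F s1)); apply: cvgB; last exact: cvg_cst.
  by apply: cvg_at_right_filter; apply: F_cts; rewrite ltW.
- exists (s1 * f s1).
    rewrite mulr_ge0 ?(ltW s10) //; case: (ltrgtP b s1) bs1 => // [bs1 _|<- _].
      by apply/ltW/(f_gt0 N); rewrite bs1.
    rewrite leNgt; apply/negP => fb.
    have cb : {for b, continuous f} by apply: der_cts; apply: (f_der N); rewrite b0 bM.
    have [e e0 he] := cts_lt cb fb.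
    pose x := Num.min s (b + e / 2).
    have bx : b < x by rewrite lt_min; apply/andP; split; [exact: bs|lra].
    have xs : x <= s by rewrite ge_min lexx.
    have xe : x <= b + e / 2 by rewrite ge_min lexx orbT.
    have : f x < 0 by apply: he; rewrite gtr0_norm; lra.
    rewrite ltNge ltW // (f_gt0 N) // bx (le_trans xs) // (le_trans st) //.
  apply: cvg_at_right_filter; apply: cvgM; first exact: cvg_id.
  by apply: der_cts; apply: (f_der N); rewrite s10.
- split => //.
  rewrite subr_gt0; apply: (@der_gt0_lt R F f) => // x /andP[x1 x2].
    by apply: (F_der N); rewrite (le_trans (ltW s10)) // (le_trans x2) // (le_trans st).
  by have [] := rng x x1 (le_trans (ltW x2) st).
Qed.


Lemma hq_der r : 0 < r -> is_derive r 1 (fun x => h x * q x) (q r * (1 + 2 * dh r)).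
Proof.
move=> r0; apply: der_eq (derM (h_der W r0) (q_der W r0)) _.
by rewrite (h_dq W) //; ring.
Qed.

Lemma dh_E r : 0 < r -> dh r = h r * (dq r / q r) - 1.
Proof. by move=> r0; rewrite h_dk //; ring. Qed.

(** Pohozaev's function, for the primitive [F - a] of [f]. *)
Definition pohozaev a r :=
  h r * q r * (G r * G r / 2 + (F (u r) - a)) - q r * G r * u r / 2.

Lemma pohozaev_der a r : 0 < r -> is_derive r 1 (pohozaev a)
  (q r * ((1 + 2 * dh r) * (F (u r) - a) - u r * f (u r) / 2)).
Proof.
move=> r0; have du := u_der S r0; have dG := G_der r0.
have dF : is_derive r 1 (fun x => F (u x)) (f (u r) * - G r).
  by apply: der_comp du; apply: (F_der N); apply: (u_range S); exact: ltW.
have d1 := derM (hq_der r0) (derD (derM (derM dG dG) (der_cst (2^-1) r))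
             (derB dF (der_cst a r))).
have d2 := derM (derM (qG_der S r0) du) (der_cst (2^-1) r).
apply: der_eq (derB d1 d2) _.
rewrite (dh_E r0); set k := dq r / q r.
lra.
Qed.

Lemma pohozaev_lim a : pohozaev a r @[r --> 0^'+] --> 0.
Proof.
have c2 : (fun _ : R => (2^-1 : R)) r @[r --> 0^'+] --> (2^-1 : R) by exact: cvg_cst.
have ca : (fun _ : R => a) r @[r --> 0^'+] --> a by exact: cvg_cst.
have cF : F (u r) @[r --> 0^'+] --> F (u 0).
  by apply: (cvg_comp u F (u_lim S)); apply: F_cts; rewrite u_ge0 // u_leM.
have := cvgB (cvgM qh_lim (cvgD (cvgM (cvgM (G_lim S) (G_lim S)) c2) (cvgB cF ca)))
  (cvgM (cvgM qG_lim (u_lim S)) c2).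
by rewrite !mul0r subrr; apply.
Qed.

Lemma q_tilt_der r : 0 < r -> 0 < u r -> is_derive r 1 (fun x => q x * tilt x)
  (q r * (2 * dh r * (u r * f (u r)) - h r * G r * (u r * df (u r) - f (u r)))).
Proof.
move=> r0 ur; have du := u_der S r0; have dG := G_der r0.
have d_f : is_derive r 1 (fun x => f (u x)) (df (u r) * - G r).
  by apply: der_comp du; apply: (f_der N); rewrite ur u_leM // ltW.
have d := derM (q_der W r0)
  (derD (derB (derM (h_der W r0) (derM dG dG)) (derM du dG))
        (derM (h_der W r0) (derM du d_f))).
apply: der_eq d _.
rewrite (dh_E r0); set k := dq r / q r.
have -> : dq r = k * q r by rewrite /k divfK // q_neq0.
ring.
Qed.

Lemma q_tilt_lim : (q r * tilt r) @[r --> 0^'+] --> 0.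
Proof.
rewrite (_ : (fun r => q r * tilt r) = (fun r => h r * q r * (G r * G r)
  - q r * G r * u r + h r * q r * (u r * f (u r)))); last first.
  by apply/funext => r; rewrite /tilt; ring.
have := cvgD (cvgB (cvgM qh_lim (cvgM (G_lim S) (G_lim S))) (cvgM qG_lim (u_lim S)))
  (cvgM qh_lim (cvgM (u_lim S) lim_fu)).
by rewrite !mul0r subrr addr0; apply.
Qed.

(** The key monotonicity, that [h G / u] increases in [r] above the level [b].
    It is clear where [h G >= u].  Otherwise let [r1] be the next point where
    [h G = u], which exists because [h G >= u] at the level [b].  The Pohozaev
    function normalized at the level [u r1] vanishes at [0] and at [r1]; by the
    monotonicity of [s f(s) / (F s - F s1)] and of [h'] its derivative changes
    sign at most once, from positive to negative, so it is nonnegative.  This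
    gives the claim where [u f(u) > 2 (F u - F (u r1))].  In the remaining case
    [s f'(s) / f(s) <= 1] at all higher levels, and there [q * tilt] increases
    from [0]. *)
Lemma tilt_pos r : 0 < r -> b < u r -> 0 < tilt r.
Proof.
move=> r0 bu.
have b0 := b_gt0 N.
have h0 := h_gt0 W r0; have q0 := q_gt0 W r0.
have ur : 0 < u r by exact: lt_trans bu.
have G0 := G_pos r0 ur.
have uM x : 0 < x -> u x <= M by move=> x0; rewrite u_leM // ltW.
have f0 : 0 < f (u r) by apply: (f_gt0 N); rewrite bu uM.
have huf : 0 < h r * (u r * f (u r)) by rewrite !mulr_gt0.
have [Au|uA] := leP (u r) (h r * G r).
  have : 0 <= G r * (h r * G r - u r) by rewrite mulr_ge0 ?subr_ge0 // ltW.
  by rewrite /tilt; nra.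
have [rb rb0 urb] := level_exists b0 start_gt_b.
have rrb : r < rb.
  by rewrite ltNge; apply/negP => /(u_noninc rb0); rewrite urb leNgt bu.
have pb : 0 <= h rb * G rb - u rb.
  by rewrite subr_ge0 hG_ge // urb.
have [|||r1 [/andP[rr1 r1b] e1 low]] :=
    @first_zero R (fun x => h x * G x - u x) r rb (ltW rrb).
- move=> x /andP[x1 _]; have x0 : 0 < x by exact: lt_le_trans x1.
  exact: der_cts (derB (hG_der x0) (u_der S x0)).
- by rewrite subr_lt0.
- by [].
have r10 : 0 < r1 by exact: lt_trans rr1.
have bu1 : b <= u r1 by rewrite -urb u_noninc.
have above x : 0 < x -> x < r1 -> u r1 < u x.
  move=> x0 xr; apply: u_decr => //; apply: lt_le_trans b0 _.
  by apply: le_trans bu1 _; apply: u_noninc => //; exact: ltW.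
set a := F (u r1).
have X1 : pohozaev a r1 = 0.
  rewrite /pohozaev subrr addr0.
  have -> : u r1 = h r1 * G r1 by apply/esym/eqP; rewrite -subr_eq0 e1.
  by field.
have Xge : 0 <= pohozaev a r.
  rewrite leNgt; apply/negP => Xneg.
  pose dX x := q x * ((1 + 2 * dh x) * (F (u x) - a) - u x * f (u x) / 2).
  have [t2 [t20 t2r X2]] : exists t2, [/\ 0 < t2, t2 < r & dX t2 < 0].
    apply: contrapT => H.
    have : 0 <= pohozaev a r.
      apply: (@der_ge0_lim_le R (pohozaev a) dX 0 r 0 r0) => //.
      - by move=> x /andP[x1 _]; exact: pohozaev_der.
      - exact: pohozaev_lim.
      - move=> x /andP[x1 x2]; rewrite leNgt; apply/negP => Hx; apply: H.
        by exists x.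
    by rewrite leNgt Xneg.
  have [t1 [t1r t1r1 X1']] : exists t1, [/\ r < t1, t1 < r1 & 0 < dX t1].
    apply: contrapT => H.
    have : pohozaev a r1 <= pohozaev a r.
      apply: (@der_le0_ge R (pohozaev a) dX) => // [|x /andP[x1 _]|x /andP[x1 x2]].
      - exact: ltW.
      - by apply: pohozaev_der; exact: lt_le_trans x1.
      - by rewrite leNgt; apply/negP => Hx; apply: H; exists x.
    by rewrite X1 leNgt Xneg.
  have t10 : 0 < t1 by exact: lt_trans t1r.
  have t2r1 : t2 < r1 by rewrite (lt_trans t2r) // (lt_trans t1r).
  have t21 : t2 <= t1 by rewrite ltW // (lt_trans t2r).
  have [F1 _ V] := virial bu1 (above _ t10 t1r1) (u_noninc t20 t21) (uM _ t20).
  have [F2 _ _] := virial bu1 (above _ t20 t2r1) (lexx _) (uM _ t20).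
  have hm := dh_mono W t20 t21.
  move: X2; rewrite /dX pmulr_rlt0 ?(q_gt0 W) // subr_lt0 => X2.
  move: X1'; rewrite /dX pmulr_rgt0 ?(q_gt0 W) // subr_gt0 => X1'.
  move: X1' X2 V F1 F2 hm; rewrite -/a.
  set A1 := F (u t1) - a; set A2 := F (u t2) - a.
  set B1 := u t1 * f (u t1); set B2 := u t2 * f (u t2).
  move=> X1' X2 V F1 F2 hm.
  have : B1 / 2 * A2 < (1 + 2 * dh t1) * A1 * A2 by rewrite ltr_pM2r.
  have : (1 + 2 * dh t2) * A2 * A1 < B2 / 2 * A1 by rewrite ltr_pM2r.
  have : 0 <= (dh t2 - dh t1) * (A1 * A2).
    by rewrite mulr_ge0 ?subr_ge0 // mulr_ge0 // ltW.
  nra.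
have [Fr V _] := virial bu1 (above _ r0 rr1) (lexx _) (uM _ r0).
rewrite -/a in Fr V.
have [big|small] := ltP (2 * (F (u r) - a)) (u r * f (u r)).
  have : 0 < q r * tilt r.
    have -> : q r * tilt r = 2 * pohozaev a r
      + h r * q r * (u r * f (u r) - 2 * (F (u r) - a)).
      by rewrite /tilt /pohozaev; field.
    by rewrite ltr_wpDl ?mulr_ge0 // !mulr_gt0 // subr_gt0.
  by rewrite pmulr_rgt0.
have g1 : u r * df (u r) / f (u r) <= 1.
  have : (1 + u r * df (u r) / f (u r)) * (F (u r) - a) <= 2 * (F (u r) - a).
    exact: le_trans small.
  by rewrite ler_pM2r //; lra.
have : 0 < q r * tilt r.
  apply: (@der_gt0_lim_lt R (fun x => q x * tilt x) (fun r =>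
    (q r * (2 * dh r * (u r * f (u r)) - h r * G r * (u r * df (u r) - f (u r))))) 0) => //.
  - move=> x /andP[x1 x2]; apply: q_tilt_der => //.
    by rewrite (lt_le_trans ur) // u_noninc.
  - exact: q_tilt_lim.
  move=> x /andP[x1 x2].
  have ux : u r <= u x by apply: u_noninc => //; exact: ltW.
  have bux : b < u x by exact: lt_le_trans ux.
  have ux0 : 0 < u x by exact: lt_trans bux.
  have fx : 0 < f (u x) by apply: (f_gt0 N); rewrite bux uM.
  have gx : u x * df (u x) / f (u x) <= 1.
    by apply: le_trans g1; apply: (g_mono N) => //; exact: uM.
  rewrite ler_pdivrMr // mul1r in gx.
  rewrite mulr_gt0 ?(q_gt0 W) // subr_gt0.
  apply: (@le_lt_trans _ _ 0).
    by rewrite mulr_ge0_le0 ?subr_le0 // ltW // mulr_gt0 ?(h_gt0 W) // G_pos.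
  by rewrite !mulr_gt0 // (dh_gt0 W).
by rewrite pmulr_rgt0.
Qed.

(** The slope of [ln u] with respect to [ln (h / q)]. *)
Definition theta r := h r * G r / u r.

Lemma theta_gt0 r : 0 < r -> 0 < u r -> 0 < theta r.
Proof. by move=> r0 ur; rewrite !mulr_gt0 ?invr_gt0 ?(h_gt0 W) ?G_pos. Qed.

Lemma theta_der r : 0 < r -> 0 < u r ->
  is_derive r 1 theta (h r * f (u r) / u r - G r / u r + theta r * G r / u r).
Proof.
move=> r0 ur; have u0 : u r != 0 by rewrite gt_eqF.
apply: der_eq (der_div (hG_der r0) (u_der S r0) u0) _.
by rewrite /theta; field.
Qed.

Definition forcing r := h r ^+ 2 * f (u r) / u r.

(** In the variables [t = ln (h / q)] and [e = ln u] the equation reads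
    [e'' = e' - e' ^ 2 - forcing], so that [kappa] is [- e'']. *)
Definition kappa r := theta r ^+ 2 - theta r + forcing r.

Lemma kappaE r : 0 < r -> 0 < u r -> kappa r = h r * tilt r / u r ^+ 2.
Proof.
move=> r0 ur; have u0 : u r != 0 by rewrite gt_eqF.
by rewrite /kappa /forcing /theta /tilt; field.
Qed.

Lemma kappa_pos r : 0 < r -> b < u r -> 0 < kappa r.
Proof.
move=> r0 bu; have ur : 0 < u r by exact: lt_trans (b_gt0 N) bu.
by rewrite kappaE // divr_gt0 ?exprn_gt0 // mulr_gt0 ?tilt_pos ?(h_gt0 W).
Qed.

Lemma theta_der_kappa r : 0 < r -> 0 < u r ->
  is_derive r 1 theta (kappa r / h r).
Proof.
move=> r0 ur; have u0 : u r != 0 by rewrite gt_eqF.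
have h0 : h r != 0 by rewrite gt_eqF // (h_gt0 W).
apply: der_eq (theta_der r0 ur) _.
by rewrite /kappa /forcing /theta; field; rewrite u0 h0.
Qed.

End OneSolution.
End Solutions.
(** * Uniqueness for the initial value problems *)

Section Uniqueness.
Context {R : realType}.
Context (q dq h dh J f df F : R -> R) (b M : R).
Context (W : weight q dq h dh J) (N : nonlinearity f df F b M).
Implicit Types (u G : R -> R) (r s t x m : R).

Lemma f_lipschitz m : 0 < m -> m <= M -> exists2 L, 0 < L &
  forall s t, m <= s <= M -> m <= t <= M -> `|f s - f t| <= L * `|s - t|.
Proof.
move=> m0 mM.
have [L L0 hL] : exists2 L, 0 < L & forall x, m <= x <= M -> `|df x| <= L.
  apply: cts_bounded => // x /andP[x1 x2].
  by apply: (df_cts N); rewrite (lt_le_trans m0) ?x1.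
exists L => //.
have key s t : m <= s -> s < t -> t <= M -> `|f t - f s| <= L * `|t - s|.
  move=> ms st tM.
  have [|x /andP[x1 x2] ->] := @mean_value R f df s t st.
    move=> x /andP[x1 x2]; apply: (f_der N).
    by rewrite (lt_le_trans m0) ?(le_trans ms) ?(le_trans x2).
  rewrite normrM ler_wpM2r // hL // (le_trans ms (ltW x1)) /=.
  exact: le_trans (ltW x2) tM.
move=> s t /andP[ms sM] /andP[mt tM].
case: (ltgtP s t) => [st|ts|->]; last by rewrite !subrr normr0 mulr0.
- by rewrite distrC [`|s - t|]distrC; exact: key.
- exact: key.
Qed.

Lemma der_unique (g : R -> R) x (l l' : R) : is_derive x 1 g l -> is_derive x 1 g l' -> l = l'.
Proof. by move=> [_ <-] [_ <-]. Qed.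

Section Pair.
Context (u1 G1 u2 G2 : R -> R).
Context (S1 : ground_state q f M u1 G1) (S2 : ground_state q f M u2 G2).

(** As [q'] need not be Lipschitz, the second unknown is the flux [q G] instead
    of [G]: the sum of the squares of the two differences satisfies Gronwall's
    inequality. *)
Lemma unique_segment a a' r0 : 0 < a -> a <= r0 <= a' ->
  0 < u1 a' -> 0 < u2 a' -> u1 r0 = u2 r0 -> G1 r0 = G2 r0 ->
  forall r, a <= r <= a' -> u1 r = u2 r.
Proof.
move=> a0 /andP[ar0 r0a'] p1 p2 eu eG.
have a'0 : 0 < a' by rewrite (lt_le_trans a0) // (le_trans ar0).
pose m := Num.min (u1 a') (u2 a').
have m0 : 0 < m by rewrite lt_min p1 p2.
have mM : m <= M by rewrite ge_min (u_leM S1 (ltW a'0)).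
have [L L0 hL] := f_lipschitz m0 mM.
have rng r : a <= r -> r <= a' -> (m <= u1 r <= M) /\ (m <= u2 r <= M).
  move=> ar ra'; have r0' : 0 < r by exact: lt_le_trans ar.
  rewrite (u_leM S1 (ltW r0')) (u_leM S2 (ltW r0')) !andbT /m !ge_min.
  by rewrite (u_noninc W N S1 r0' ra') (u_noninc W N S2 r0' ra') orbT.
pose d x := u1 x - u2 x; pose D x := q x * G1 x - q x * G2 x.
pose I x := d x * d x + D x * D x.
have dd x : 0 < x -> is_derive x 1 d (- G1 x - - G2 x).
  by move=> x0; exact: derB (u_der S1 x0) (u_der S2 x0).
have dD x : 0 < x -> is_derive x 1 D (q x * f (u1 x) - q x * f (u2 x)).
  by move=> x0; exact: derB (qG_der S1 x0) (qG_der S2 x0).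
have I0 : forall r, a <= r <= a' -> I r = 0.
  apply: (@gronwall_eq0 R I (fun x => 2 * (D x * (q x * (f (u1 x) - f (u2 x))) - d x * (D x / q x)))
     ((q a)^-1 + q a' * L) a a' r0).
  - by rewrite ar0.
  - move=> x /andP[ax xa]; have x0 : 0 < x by exact: lt_le_trans ax.
    apply: der_eq (derD (derM (dd x x0) (dd x x0)) (derM (dD x x0) (dD x x0))) _.
    by rewrite /D; field; exact: (q_neq0 W).
  - by rewrite /I /d /D eu eG !subrr !mul0r addr0.
  - by move=> x _; rewrite /I addr_ge0 // -expr2 sqr_ge0.
  move=> x /andP[ax xa]; have x0 : 0 < x by exact: lt_le_trans ax.
  have [r1 r2] := rng x ax xa.
  have hf := hL _ _ r1 r2.
  have q0 := q_gt0 W x0.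
  have qa : q a <= q x.
    move: ax; rewrite le_eqVlt => /predU1P[<-//|ax].
    by apply/ltW/(q_incr W).
  have qa' : q x <= q a'.
    move: xa; rewrite le_eqVlt => /predU1P[<-//|xa].
    by apply/ltW/(q_incr W).
  have q0a := q_gt0 W a0.
  have AM (y z : R) : 2 * (`|y| * `|z|) <= y * y + z * z.
    have : 0 <= (`|y| - `|z|) ^+ 2 by rewrite sqr_ge0.
    have : `|y| * `|y| = y * y by rewrite -!expr2 real_normK ?num_real.
    have : `|z| * `|z| = z * z by rewrite -!expr2 real_normK ?num_real.
    by rewrite expr2; nra.
  have dD0 : 0 <= `|d x| * `|D x| by rewrite mulr_ge0.
  have b1 : `|D x * (q x * (f (u1 x) - f (u2 x)))| <= q a' * L * (`|d x| * `|D x|).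
    rewrite !normrM (gtr0_norm q0).
    have -> : q a' * L * (`|d x| * `|D x|) = `|D x| * (q a' * (L * `|d x|)) by ring.
    by rewrite ler_wpM2l // ler_pM // ltW.
  have b2 : `|d x * (D x / q x)| <= (q a)^-1 * (`|d x| * `|D x|).
    rewrite !normrM normfV (gtr0_norm q0) mulrA mulrC ler_wpM2r //.
    by rewrite lef_pV2 ?posrE.
  rewrite normrM ger0_norm //.
  apply: (@le_trans _ _ (2 * (`|d x| * `|D x|) * ((q a)^-1 + q a' * L))).
    rewrite -mulrA ler_wpM2l //; apply: le_trans (ler_normB _ _) _.
    rewrite [leRHS]mulrDr [leRHS]addrC; apply: lerD.
      by apply: le_trans b1 _; rewrite [leRHS]mulrC.
    by apply: le_trans b2 _; rewrite [leRHS]mulrC.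
  rewrite mulrC ler_wpM2l ?AM //.
  by rewrite addr_ge0 ?invr_ge0 ?mulr_ge0 // ltW // (q_gt0 W).
move=> r rr; have := I0 r rr; rewrite /I => /eqP.
rewrite paddr_eq0 -?expr2 ?sqr_ge0 // => /andP[].
by rewrite expf_eq0 /= subr_eq0 => /eqP.
Qed.

Lemma unique_positive r0 : 0 < r0 -> u1 r0 = u2 r0 -> G1 r0 = G2 r0 -> 0 < u1 r0 ->
  forall r, 0 < r -> 0 < u1 r -> 0 < u2 r -> u1 r = u2 r.
Proof.
move=> r00 eu eG p0 r rp p1 p2.
have [rr|rr] := leP r r0.
  by apply: (@unique_segment r r0 r0) => //; rewrite -?eu ?lexx ?rr.
by apply: (@unique_segment r0 r r0) => //; rewrite ?lexx // ltW.
Qed.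

End Pair.

(** At a first zero of [u2] the two functions would be equal by continuity. *)
Lemma unique_support u1 G1 u2 G2 r0 :
  ground_state q f M u1 G1 -> ground_state q f M u2 G2 ->
  0 < r0 -> u1 r0 = u2 r0 -> G1 r0 = G2 r0 -> 0 < u1 r0 ->
  forall r, 0 < r -> 0 < u1 r -> 0 < u2 r.
Proof.
move=> S1 S2 r00 eu eG p0 r r10 p1.
rewrite lt_neqAle (u_ge0 S2 (ltW r10)) andbT; apply/eqP => E.
have r0r : r0 <= r.
  rewrite leNgt; apply/negP => rr; move: p0.
  by rewrite eu (@zero_after _ _ _ _ _ _ _ _ _ _ _ _ _ W N S2 r r0) ?ltxx ?ltW.
have [|||t [/andP[t1 t2] ut ht]] := @first_zero R (fun x => - u2 x) r0 r r0r.
- move=> x /andP[x1 _]; apply: cvgN; apply: (u_cts S2); exact: lt_le_trans x1.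
- by rewrite oppr_lt0 -eu.
- by rewrite -E oppr0.
have t0 : 0 < t by exact: lt_trans t1.
have u1t : 0 < u1 t by exact: (pos_before W N S1 t0 t2).
have u2t : u2 t = 0 by apply/eqP; rewrite -oppr_eq0 ut.
have c : {for t, continuous (fun x => u1 x - u2 x)}.
  exact: der_cts (derB (u_der S1 t0) (u_der S2 t0)).
have [|e e0 he] := cts_gt c (_ : 0 < u1 t - u2 t); first by rewrite u2t subr0.
pose x := Num.max r0 (t - e / 2).
have xt : x < t by rewrite gt_max t1 /=; lra.
have rx : r0 <= x by rewrite le_max lexx.
have dx : t - e / 2 <= x by rewrite le_max lexx orbT.
have x0 : 0 < x by exact: lt_le_trans rx.
have u2x : 0 < u2 x by rewrite -oppr_lt0 ht // rx.
have u1x : 0 < u1 x by exact: (pos_before W N S1 x0 (ltW xt) u1t).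
have : 0 < u1 x - u2 x by apply: he; rewrite ltr0_norm; lra.
by rewrite (unique_positive S1 S2 r00) // subrr ltxx.
Qed.

Lemma unique_interior u1 G1 u2 G2 r0 :
  ground_state q f M u1 G1 -> ground_state q f M u2 G2 ->
  0 < r0 -> u1 r0 = u2 r0 -> G1 r0 = G2 r0 -> 0 < u1 r0 ->
  forall r, 0 <= r -> u1 r = u2 r.
Proof.
move=> S1 S2 r00 eu eG p0.
have p0' : 0 < u2 r0 by rewrite -eu.
have pos r : 0 < r -> u1 r = u2 r.
  move=> r1; have s12 := unique_support S1 S2 r00 eu eG p0 r1.
  have s21 := unique_support S2 S1 r00 (esym eu) (esym eG) p0' r1.
  have := u_ge0 S1 (ltW r1); rewrite le_eqVlt => /predU1P[E|p1].
    rewrite -E; have := u_ge0 S2 (ltW r1); rewrite le_eqVlt => /predU1P[//|/s21].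
    by rewrite -E ltxx.
  by apply: (unique_positive S1 S2 r00) => //; exact: s12.
move=> r; rewrite le_eqVlt => /predU1P[<-|]; last exact: pos.
have l : (u1 x - u2 x) @[x --> 0^'+] --> u1 0 - u2 0.
  exact: cvgB (u_lim S1) (u_lim S2).
apply/eqP; rewrite -subr_eq0 eq_le; apply/andP; split.
  by apply: (lim_right_le ltr01 l) => x /andP[x0 _] /=; rewrite pos ?subrr.
by apply: (lim_right_ge ltr01 l) => x /andP[x0 _] /=; rewrite pos ?subrr.
Qed.

(** The weight degenerates at the origin, where the contraction argument on a
    short interval replaces Gronwall's inequality. *)
Lemma unique_start u1 G1 u2 G2 :
  ground_state q f M u1 G1 -> ground_state q f M u2 G2 ->
  u1 0 = u2 0 -> forall r, 0 <= r -> u1 r = u2 r.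
Proof.
move=> S1 S2 e0.
pose m := u1 0 / 2.
have u10 := u0_pos S1.
have m0 : 0 < m by rewrite divr_gt0.
have mu : m < u1 0 by rewrite /m; lra.
have mM : m <= M by rewrite (le_trans (ltW mu)) // (u_leM S1).
have [L L0 hL] := f_lipschitz m0 mM.
have [e1 e10 he1] := near0_gt S1 mu.
have [e2 e20 he2] : exists2 e, 0 < e & forall r, 0 < r <= e -> m < u2 r.
  by apply: (near0_gt S2); rewrite -e0.
(* With this length, a bound on the difference over [(0, e]] can be halved. *)
pose e := Num.min (Num.min e1 e2) (Num.min 1 (2 * L)^-1).
have ep : 0 < e by rewrite !lt_min e10 e20 ltr01 invr_gt0 mulr_gt0.
have ee1 : e <= e1 by rewrite !ge_min lexx.
have ee2 : e <= e2 by rewrite !ge_min lexx !orbT.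
have e_1 : e <= 1 by rewrite !ge_min lexx !orbT.
have eL : L * e <= 1 / 2.
  have : e <= (2 * L)^-1 by rewrite !ge_min lexx !orbT.
  move=> /(ler_wpM2l (ltW L0)) H; apply: le_trans H _.
  by rewrite invfM mulrCA divff ?gt_eqF // mulr1 div1r.
pose d x := u1 x - u2 x; pose D x := q x * G1 x - q x * G2 x.
have dd x : 0 < x -> is_derive x 1 d (- G1 x - - G2 x).
  by move=> x0; exact: derB (u_der S1 x0) (u_der S2 x0).
have dD x : 0 < x -> is_derive x 1 D (q x * f (u1 x) - q x * f (u2 x)).
  by move=> x0; exact: derB (qG_der S1 x0) (qG_der S2 x0).
have dl : d x @[x --> 0^'+] --> 0.
  by have := cvgB (u_lim S1) (u_lim S2); rewrite e0 subrr; apply.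
have Dl : D x @[x --> 0^'+] --> 0.
  by have H := cvgB (qG_lim W S1) (qG_lim W S2); rewrite subrr in H; exact: H.
have idl (C : R) : (C * x) @[x --> 0^'+] --> (0 : R).
  rewrite -[X in _ --> X](mulr0 C); apply: cvgM; first exact: cvg_cst.
  apply: cvg_at_right_filter; exact: cvg_id.
have bound (g dg : R -> R) C r : 0 < r -> (forall x, 0 < x <= r -> is_derive x 1 g (dg x)) ->
    g x @[x --> 0^'+] --> 0 -> (forall x, 0 < x < r -> `|dg x| <= C) -> `|g r| <= C * r.
  move=> r0 hg gl hC; rewrite ler_norml; apply/andP; split.
    rewrite -subr_ge0 opprK.
    apply: (@der_ge0_lim_le R (fun x => g x + C * x) (fun x => dg x + (0 * x + C * 1)) 0) => //.
    - by move=> x hx; exact: derD (hg x hx) (derM (der_cst _ _) (der_id _)).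
    - by have := cvgD gl (idl C); rewrite addr0; apply.
    - by move=> x hx; have := hC x hx; rewrite ler_norml => /andP[]; lra.
  rewrite -subr_ge0.
  apply: (@der_ge0_lim_le R (fun x => C * x - g x) (fun x => 0 * x + C * 1 - dg x) 0) => //.
  - by move=> x hx; exact: derB (derM (der_cst _ _) (der_id _)) (hg x hx).
  - by have := cvgB (idl C) gl; rewrite subrr; apply.
  - by move=> x hx; have := hC x hx; rewrite ler_norml => /andP[]; lra.
have step B : 0 <= B -> (forall x, 0 < x <= e -> `|d x| <= B) ->
    forall x, 0 < x <= e -> `|d x| <= B / 2.
  move=> B0 hB.
  have hG x : 0 < x <= e -> `|G1 x - G2 x| <= B / 2.
    move=> /andP[x0 xe].
    have q0 := q_gt0 W x0.
    have : `|D x| <= (q x * (L * B)) * x.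
      apply: (bound D (fun y => q y * f (u1 y) - q y * f (u2 y))) => //.
        by move=> y /andP[y0 _]; exact: dD.
      move=> y /andP[y0 yx]; have ye : y <= e by exact: le_trans (ltW yx) xe.
      rewrite -mulrBr normrM gtr0_norm ?(q_gt0 W) //.
      apply: ler_pM => //; [exact/ltW/(q_gt0 W)|exact/ltW/(q_incr W)|].
      apply: le_trans (hL _ _ _ _) _.
      - by rewrite ltW ?he1 ?(u_leM S1) ?y0 ?(le_trans ye) // ltW.
      - by rewrite ltW ?he2 ?(u_leM S2) ?y0 ?(le_trans ye) // ltW.
      by rewrite ler_wpM2l ?(ltW L0) // hB // y0.
    rewrite /D -mulrBr normrM gtr0_norm // -mulrA ler_pM2l // => H; apply: le_trans H _.
    rewrite mulrAC mulrC ler_wpM2l //.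
    apply: le_trans (_ : L * e <= _); first by rewrite ler_wpM2l // ltW.
    by rewrite (le_trans eL) // div1r.
  move=> x /andP[x0 xe].
  have : `|d x| <= B / 2 * x.
    apply: (bound d (fun y => - G1 y - - G2 y)) => //.
      by move=> y /andP[y0 _]; exact: dd.
    move=> y /andP[y0 yx]; rewrite -opprD normrN; apply: hG.
    by rewrite y0 (le_trans (ltW yx)).
  move=> H; apply: le_trans H _; rewrite -[leRHS]mulr1 ler_wpM2l ?divr_ge0 //.
  exact: le_trans e_1.
pose E := [set `|d x| | x in [set x | 0 < x <= e]].
have hE : has_sup E.
  split; first by exists `|d e|; exists e => //=; rewrite ep lexx.
  exists (M + M) => _ [x /andP[x0 _] <-].
  apply: le_trans (ler_normB _ _) _; apply: lerD.
    by rewrite ger0_norm ?(u_ge0 S1) ?(u_leM S1) // ltW.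
  by rewrite ger0_norm ?(u_ge0 S2) ?(u_leM S2) // ltW.
have le_sup x : 0 < x <= e -> `|d x| <= sup E.
  by move=> hx; apply: ub_le_sup; [exact: hE.2|exists x].
have sE0 : 0 <= sup E by apply: le_trans (le_sup e _); rewrite ?normr_ge0 ?ep ?lexx.
have : sup E <= sup E / 2.
  by apply: ge_sup => [|_ [x hx <-]]; [exact: hE.1|exact: step].
move=> sE; have {sE} sE : sup E = 0 by lra.
have d0 x : 0 < x <= e -> u1 x = u2 x.
  move=> hx; apply/eqP; rewrite -subr_eq0 -normr_le0 -sE; exact: le_sup.
have e2p : 0 < e / 2 by rewrite divr_gt0.
have ehe : e / 2 <= e by lra.
apply: (@unique_interior u1 G1 u2 G2 (e / 2)) => //.
- by apply: d0; rewrite e2p.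
- apply: oppr_inj; apply: (der_unique (u_der S1 e2p)).
  apply: der_near (u_der S2 e2p); near=> y; apply/esym/d0; apply/andP; split.
    by near: y; exact: lt_nbhsr.
  by apply/ltW; near: y; apply: lt_nbhsl; lra.
- by apply: lt_trans m0 _; apply: he1; rewrite e2p (le_trans ehe).
Unshelve. all: by end_near. Qed.

End Uniqueness.
(** * Solutions as functions of the level *)

Section Levels.
Context {R : realType}.
Context (q dq h dh J f df F : R -> R) (b M : R).
Context (W : weight q dq h dh J) (N : nonlinearity f df F b M).
Implicit Types (u G : R -> R) (r s t x m e : R).

(** [tau] is the logarithm of the harmonic coordinate [int_r^oo 1/q = h/q]. *)
Definition tau r := ln (h r / q r).

Lemma tau_der r : 0 < r -> is_derive r 1 tau (- (h r)^-1).
Proof.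
move=> r0; have h0 := h_gt0 W r0; have q0 := q_gt0 W r0.
have qn := q_neq0 W r0; have hn : h r != 0 by rewrite gt_eqF.
have d := der_ln (der_div (h_der W r0) (q_der W r0) qn) (divr_gt0 h0 q0).
apply: der_eq d _; rewrite (h_dq W r0); field.
by rewrite hn qn.
Qed.

Lemma tau_decr r s : 0 < r -> r < s -> tau s < tau r.
Proof.
move=> r0 rs; apply: (@der_lt0_gt R tau (fun x => - (h x)^-1)) => // x /andP[x1 x2].
  by apply: tau_der; exact: lt_le_trans x1.
by rewrite oppr_lt0 invr_gt0 (h_gt0 W) // (lt_trans r0).
Qed.

Lemma tau_le r s : 0 < r -> 0 < s -> (tau s <= tau r) = (r <= s).
Proof.
move=> r0 s0; case: (ltgtP r s) => [rs|sr|->]; last by rewrite lexx.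
- by rewrite ltW // tau_decr.
- by apply/negbTE; rewrite -ltNge tau_decr.
Qed.

(** The inverse function of [u] where [u] is positive; [0] is a default value. *)
Definition level_time u s := xget 0 [set r | 0 < r /\ u r = s].

Section OneLevel.
Context (u G : R -> R) (S : ground_state q f M u G).
Local Notation rho := (level_time u).

Lemma u_inj r s : 0 < r -> 0 < s -> 0 < u r -> u r = u s -> r = s.
Proof.
move=> r0 s0 ur e; case: (ltgtP r s) => // rs.
- by have := u_decr W N S r0 rs ur; rewrite e ltxx.
- by have := u_decr W N S s0 rs; rewrite -e => /(_ ur); rewrite ltxx.
Qed.

Lemma level_timeK r : 0 < r -> 0 < u r -> rho (u r) = r.
Proof.
move=> r0 ur; rewrite /level_time; case: xgetP => [z _ [z0 e]|/(_ r)].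
  by apply: u_inj; rewrite ?e.
by move=> []; split.
Qed.

Lemma level_time_gt0 s : 0 < s -> s < u 0 -> 0 < rho s.
Proof.
by move=> s0 su; have [r r0 e] := level_exists S s0 su; rewrite -e level_timeK ?e.
Qed.

Lemma level_timeE s : 0 < s -> s < u 0 -> u (rho s) = s.
Proof.
by move=> s0 su; have [r r0 e] := level_exists S s0 su; rewrite -e level_timeK ?e.
Qed.

Lemma level_time_der s : 0 < s -> s < u 0 ->
  is_derive s 1 rho (- (G (rho s))^-1).
Proof.
move=> s0 su; have r0 := level_time_gt0 s0 su; have e := level_timeE s0 su.
have ur : 0 < u (rho s) by rewrite e.
have G0 := G_pos W N S r0 ur.
rewrite -{1}e -invrN; apply: is_derive_inverse; last by rewrite oppr_eq0 gt_eqF.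
- have [d d0 hd] := cts_gt (u_cts S r0) ur.
  near=> y; apply: level_timeK; first by near: y; exact: lt_nbhsr.
  by near: y; exact: cvgr_gt (u (rho s)) (u_cts S r0) 0 ur.
- by near=> y; apply: (u_cts S); near: y; exact: lt_nbhsr.
- exact: (u_der S).
Unshelve. all: by end_near. Qed.

Lemma level_G_pos s : 0 < s -> s < u 0 -> 0 < G (rho s).
Proof.
by move=> s0 su; rewrite (G_pos W N S) ?level_timeE // level_time_gt0.
Qed.

Lemma level_G_der s : 0 < s -> s < u 0 -> is_derive s 1 (fun x => G (rho x))
  (dq (rho s) / q (rho s) - f s / G (rho s)).
Proof.
move=> s0 su; have r0 := level_time_gt0 s0 su.
apply: der_eq (der_comp (G_der W S r0) (level_time_der s0 su)) _.
rewrite level_timeE //; have := level_G_pos s0 su => G0.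
by field; rewrite (q_neq0 W r0) gt_eqF.
Qed.

Lemma level_hG_der s : 0 < s -> s < u 0 ->
  is_derive s 1 (fun x => h (rho x) * G (rho x)) (1 - h (rho s) * f s / G (rho s)).
Proof.
move=> s0 su; have r0 := level_time_gt0 s0 su.
apply: der_eq (der_comp (hG_der W S r0) (level_time_der s0 su)) _.
rewrite level_timeE //; have := level_G_pos s0 su => G0.
by field; rewrite gt_eqF.
Qed.

Lemma level_tau_der s : 0 < s -> s < u 0 ->
  is_derive s 1 (fun x => tau (rho x)) (h (rho s) * G (rho s))^-1.
Proof.
move=> s0 su; have r0 := level_time_gt0 s0 su.
apply: der_eq (der_comp (tau_der r0) (level_time_der s0 su)) _.
by rewrite mulrNN invfM.
Qed.

Lemma level_hG_pos s : 0 < s -> s < u 0 -> 0 < h (rho s) * G (rho s).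
Proof.
by move=> s0 su; rewrite mulr_gt0 ?level_G_pos // (h_gt0 W) // level_time_gt0.
Qed.

Lemma hG_small_level e m : 0 < e -> 0 < m -> m <= b ->
  exists2 s, 0 < s <= m & h (rho s) * G (rho s) < e.
Proof.
move=> e0 m0 mb.
have mu : m < u 0 by apply: le_lt_trans mb (start_gt_b W N S).
have [r [r0 ur ub hr]] := hG_small W N S e0.
have [um|mu'] := leP (u r) m.
  by exists (u r); rewrite ?ur ?um // level_timeK.
exists m; rewrite ?m0 ?lexx //; apply: le_lt_trans hr.
have rm := level_time_gt0 m0 mu; have em := level_timeE m0 mu.
have rr : r < rho m.
  by rewrite ltNge; apply/negP => /(u_noninc W N S rm); rewrite em leNgt mu'.
apply: (@der_le0_ge R (fun x => h x * G x) (fun x => h x * f (u x) - G x)) => //.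
- exact: ltW.
- by move=> x /andP[x1 x2]; apply: (hG_der W S); exact: lt_le_trans x1.
move=> x /andP[x1 x2]; have x0 : 0 < x by exact: lt_trans x1.
have := G_ge0 W N S x0.
have : h x * f (u x) <= 0.
  rewrite mulr_ge0_le0 //; first exact/ltW/(h_gt0 W).
  rewrite (f_le0 N) // (u_ge0 S (ltW x0)) /= (le_trans _ ub) //.
  by apply: (u_noninc W N S) => //; exact: ltW.
lra.
Qed.

Lemma G_small_level e m : 0 < e -> 0 < m -> m <= b ->
  exists2 s, 0 < s <= m & G (rho s) < e.
Proof.
move=> e0 m0 mb.
have mu : m < u 0 by apply: le_lt_trans mb (start_gt_b W N S).
have rm := level_time_gt0 m0 mu; have em := level_timeE m0 mu.
have hm := h_gt0 W rm.
have [s /andP[s0 sm] hs] := hG_small_level (mulr_gt0 hm e0) m0 mb.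
exists s; first by rewrite s0.
have su : s < u 0 by exact: le_lt_trans sm mu.
have rs := level_time_gt0 s0 su; have es := level_timeE s0 su.
have G0 := level_G_pos s0 su.
have hh : h (rho m) <= h (rho s).
  have : rho m <= rho s.
    rewrite leNgt; apply/negP => lt.
    have := u_decr W N S rs lt; rewrite em es => /(_ s0).
    by rewrite ltNge sm.
  rewrite le_eqVlt => /predU1P[->//|lt]; exact/ltW/(h_incr W).
rewrite -(ltr_pM2l hm); apply: le_lt_trans hs.
by rewrite ler_wpM2r // ltW.
Qed.

End OneLevel.

Section TwoLevels.
Context (u1 G1 u2 G2 : R -> R).
Context (S1 : ground_state q f M u1 G1) (S2 : ground_state q f M u2 G2).
Local Notation rho1 := (level_time u1).
Local Notation rho2 := (level_time u2).

Lemma b_levels s : s <= b -> s < u1 0 /\ s < u2 0.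
Proof.
by move=> sb; split; apply: le_lt_trans sb _; [exact: (start_gt_b W N S1)|exact: (start_gt_b W N S2)].
Qed.

(** Below [b] the solution reaching a level later has the larger [h G] there:
    otherwise the deficit would persist down to the level [0], where [h G]
    vanishes. *)
Lemma later_hG_ge s0 : 0 < s0 -> s0 <= b -> rho2 s0 <= rho1 s0 ->
  h (rho2 s0) * G2 (rho2 s0) <= h (rho1 s0) * G1 (rho1 s0).
Proof.
move=> s00 s0b r12; rewrite leNgt; apply/negP => lt.
pose A1 s := h (rho1 s) * G1 (rho1 s); pose A2 s := h (rho2 s) * G2 (rho2 s).
pose phi s := A1 s - A2 s.
have lev x : x <= s0 -> x < u1 0 /\ x < u2 0.
  by move=> xs; apply: b_levels; exact: le_trans xs s0b.
pose dphi x := 1 - h (rho1 x) * f x / G1 (rho1 x) - (1 - h (rho2 x) * f x / G2 (rho2 x)).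
have phi_der x : 0 < x -> x <= s0 -> is_derive x 1 phi (dphi x).
  move=> x0 xs; have [l1 l2] := lev x xs.
  exact: derB (level_hG_der S1 x0 l1) (level_hG_der S2 x0 l2).
have H t : 0 < t -> t <= s0 -> (forall x, t < x <= s0 -> phi x < 0) -> phi t <= phi s0.
  move=> t0 ts neg.
  apply: (@der_ge0_le R phi dphi) => // x /andP[x1 x2].
    by apply: phi_der => //; exact: lt_le_trans x1.
  have x0 : 0 < x by exact: lt_trans x1.
  have xs := ltW x2.
  have [l1 l2] := lev x xs.
  have p1 := level_time_gt0 S1 x0 l1; have p2 := level_time_gt0 S2 x0 l2.
  have g1 := level_G_pos S1 x0 l1; have g2 := level_G_pos S2 x0 l2.
  have a1 := level_hG_pos S1 x0 l1; have a2 := level_hG_pos S2 x0 l2.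
  have rr : rho2 x <= rho1 x.
    rewrite -tau_le //.
    have [m1 m2] := lev s0 (lexx _).
    have T0 : tau (rho1 s0) <= tau (rho2 s0).
      by rewrite tau_le // (level_time_gt0 S1, level_time_gt0 S2).
    have : tau (rho1 x) - tau (rho2 x) <= tau (rho1 s0) - tau (rho2 s0).
      apply: (@der_ge0_le R (fun x => tau (rho1 x) - tau (rho2 x))
        (fun x => (A1 x)^-1 - (A2 x)^-1)) => // y /andP[y1 y2].
        have y0 : 0 < y by exact: lt_le_trans y1.
        have [k1 k2] := lev y y2.
        exact: derB (level_tau_der S1 y0 k1) (level_tau_der S2 y0 k2).
      have y0 : 0 < y by exact: lt_trans y1.
      have [k1 k2] := lev y (ltW y2).
      have := neg y; rewrite (lt_trans x1 y1) (ltW y2) => /(_ isT).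
      rewrite /phi subr_lt0 => A12.
      rewrite subr_ge0 lef_pV2 ?posrE ?(ltW A12) //.
        exact: (level_hG_pos S2).
      exact: (level_hG_pos S1).
    lra.
  have hh : h (rho2 x) <= h (rho1 x).
    by move: rr; rewrite le_eqVlt => /predU1P[->//|rr]; exact/ltW/(h_incr W).
  have := neg x; rewrite x1 xs => /(_ isT); rewrite /phi subr_lt0 /A1 /A2 => A12.
  have h1 := h_gt0 W p1; have h2 := h_gt0 W p2.
  have f0 : f x <= 0 by rewrite (f_le0 N) // ltW //= (le_trans xs).
  have : h (rho2 x) / G2 (rho2 x) <= h (rho1 x) / G1 (rho1 x).
    rewrite ler_pdivrMr // mulrAC ler_pdivlMr //.
    have := ltW A12; nra.
  rewrite /dphi.
  have -> : h (rho1 x) * f x / G1 (rho1 x) = h (rho1 x) / G1 (rho1 x) * f x by rewrite mulrAC.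
  have -> : h (rho2 x) * f x / G2 (rho2 x) = h (rho2 x) / G2 (rho2 x) * f x by rewrite mulrAC.
  nra.
have phi0 : phi s0 < 0 by rewrite subr_lt0.
have neg s : 0 < s -> s <= s0 -> phi s < 0.
  move=> s1 ss; apply: (neg_propagates_left ss _ phi0) => [x /andP[x1 x2]|t /andP[t1 t2] ht e].
    by apply: der_cts (phi_der _ _ x2); exact: lt_le_trans x1.
  have := H t (lt_le_trans s1 t1) (ltW t2) ht.
  by rewrite e leNgt phi0.
have d0 : 0 < - phi s0 by rewrite oppr_gt0.
have [s /andP[s1 ss] hs] := hG_small_level S2 d0 s00 s0b.
have := H s s1 ss (fun x hx => neg x (lt_trans s1 (andP hx).1) (andP hx).2).
have := level_hG_pos S1 s1 (lev s ss).1.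
move: hs; rewrite {2}/phi -/(A1 s) -/(A2 s); lra.
Qed.

(** Since [q' / q] decreases, an excess of slope of the solution that arrives
    later would grow while the level decreases to [0], where slopes vanish. *)
Lemma later_G_lt : (forall s, 0 < s -> s <= b -> rho2 s < rho1 s) ->
  G1 (rho1 b) < G2 (rho2 b).
Proof.
move=> sep.
pose phi s := G2 (rho2 s) - G1 (rho1 s).
pose k r := dq r / q r.
pose dphi x := k (rho2 x) - f x / G2 (rho2 x) - (k (rho1 x) - f x / G1 (rho1 x)).
have phi_der x : 0 < x -> x <= b -> is_derive x 1 phi (dphi x).
  move=> x0 xs; have [l1 l2] := b_levels xs.
  exact: derB (level_G_der S2 x0 l2) (level_G_der S1 x0 l1).
have kk x : 0 < x -> x <= b -> k (rho1 x) < k (rho2 x).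
  move=> x0 xs; apply: (k_decr W); last exact: sep.
  by apply: (level_time_gt0 S2) => //; exact: (b_levels xs).2.
have H s0 t : 0 < t -> t <= s0 -> s0 <= b -> (forall x, t < x <= s0 -> phi x < 0) ->
    phi t <= phi s0.
  move=> t0 ts sb neg.
  apply: (@der_ge0_le R phi dphi) => // x /andP[x1 x2].
    by apply: phi_der; [exact: lt_le_trans x1|exact: le_trans sb].
  have x0 : 0 < x by exact: lt_trans x1.
  have xb : x <= b by exact: le_trans (ltW x2) sb.
  have [l1 l2] := b_levels xb.
  have g1 := level_G_pos S1 x0 l1; have g2 := level_G_pos S2 x0 l2.
  have := neg x; rewrite x1 (ltW x2) => /(_ isT); rewrite /phi subr_lt0 => G12.
  have := kk x x0 xb.
  have f0 : f x <= 0 by rewrite (f_le0 N) // ltW.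
  have : (G1 (rho1 x))^-1 <= (G2 (rho2 x))^-1 by rewrite lef_pV2 ?posrE // ltW.
  rewrite /dphi; nra.
have contra s0 : 0 < s0 -> s0 <= b -> phi s0 < 0 -> False.
  move=> s00 sb phi0.
  have neg s : 0 < s -> s <= s0 -> phi s < 0.
    move=> s1 ss; apply: (neg_propagates_left ss _ phi0) => [x /andP[x1 x2]|t /andP[t1 t2] ht e].
      by apply: der_cts (phi_der _ _ _); [exact: lt_le_trans x1|exact: le_trans sb].
    have := H s0 t (lt_le_trans s1 t1) (ltW t2) sb ht.
    by rewrite e leNgt phi0.
  have d0 : 0 < - phi s0 by rewrite oppr_gt0.
  have [s /andP[s1 ss] hs] := G_small_level S1 d0 s00 sb.
  have := H s0 s s1 ss sb (fun x hx => neg x (lt_trans s1 (andP hx).1) (andP hx).2).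
  have := level_G_pos S2 s1 (b_levels (le_trans ss sb)).2.
  move: hs; rewrite {2}/phi; lra.
have b0 := b_gt0 N.
rewrite -subr_gt0 -/(phi b) lt_neqAle; apply/andP; split; last first.
  by rewrite leNgt; apply/negP; exact: contra.
apply/eqP => e.
have G12 : G2 (rho2 b) = G1 (rho1 b) by apply/eqP; rewrite -subr_eq0 -/(phi b) -e.
have dn : is_derive b 1 (fun x => - phi x) (- dphi b) by apply: derN; exact: phi_der.
have neg : - dphi b < 0.
  by rewrite oppr_lt0 /dphi G12; have := kk b b0 (lexx b); lra.
have [y /andP[y0 yb] hy] := der_neg_left dn neg b0.
by apply: (contra y) => //; [exact: ltW|move: hy; rewrite -e oppr0 oppr_gt0].
Qed.

(** At the level [u1 0] the first solution has slope [0], so the order of the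
    slopes given at the level [b] must be reversed in between.  But at a level of
    equal slopes, [G2 - G1] has derivative the difference of the values of
    [q' / q], which has the wrong sign. *)
Lemma ordered_absurd : u1 0 < u2 0 ->
  (forall s, b <= s -> s < u1 0 -> rho1 s < rho2 s) ->
  G2 (rho2 b) < G1 (rho1 b) -> False.
Proof.
move=> u12 ord Gb.
have b0 := b_gt0 N.
have bu1 := start_gt_b W N S1.
have u10 := u0_pos S1.
have c2 : {for u1 0, continuous (fun x => G2 (rho2 x))}.
  by apply: der_cts (level_G_der S2 _ _).
have g0 := level_G_pos S2 u10 u12.
have hg : G2 (rho2 (u1 0)) / 2 < G2 (rho2 (u1 0)) by lra.
have [e e0 he] := cts_gt c2 hg.
have mx : Num.max b (u1 0 - e) < u1 0 by rewrite gt_max bu1 /=; lra.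
have [d d0 hd] := near0_gt S1 mx.
have /nbhs_ballP[d' /= d'0 hd'] :
    nbhs (0 : R) [set r | 0 < r -> G1 r < G2 (rho2 (u1 0)) / 2].
  apply: cvgr_lt 0 (G_lim S1) _ _; lra.
pose r := Num.min d (d' / 2).
have r0 : 0 < r by rewrite lt_min d0 /=; lra.
have rd : r <= d by rewrite ge_min lexx.
have rd' : r <= d' / 2 by rewrite ge_min lexx orbT.
have := hd r; rewrite r0 rd gt_max => /(_ isT) /andP[bu ue].
have Gr : G1 r < G2 (rho2 (u1 0)) / 2.
  apply: hd' => //; rewrite /ball /= sub0r normrN gtr0_norm //; lra.
pose s := u1 r.
have s0 : 0 < s by exact: lt_trans bu.
have su : s < u1 0 by exact: (u_lt_start W N S1).
have rs : rho1 s = r by apply: (level_timeK S1).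
have Gs : G2 (rho2 (u1 0)) / 2 < G2 (rho2 s).
  have ue' : u1 0 - e < s by [].
  by apply: he; rewrite ltr0_norm; lra.
pose phi s := G2 (rho2 s) - G1 (rho1 s).
have phi_der x : b <= x -> x <= s -> is_derive x 1 phi
   (dq (rho2 x) / q (rho2 x) - f x / G2 (rho2 x) - (dq (rho1 x) / q (rho1 x) - f x / G1 (rho1 x))).
  move=> bx xs; have x0 : 0 < x by exact: lt_le_trans bx.
  have xu : x < u1 0 by exact: le_lt_trans su.
  exact: derB (level_G_der S2 x0 (lt_trans xu u12)) (level_G_der S1 x0 xu).
have [|||t [/andP[bt ts] et ht]] := @first_zero R phi b s (ltW bu).
- by move=> x /andP[x1 x2]; exact: der_cts (phi_der x x1 x2).
- by rewrite subr_lt0.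
- by rewrite /phi rs; lra.
have G12 : G2 (rho2 t) = G1 (rho1 t) by apply/eqP; rewrite -subr_eq0 -/(phi t) et.
have tu : t < u1 0 by exact: le_lt_trans su.
have t0 : 0 < t by exact: lt_trans bt.
have [|y /andP[y1 y2] hy] := der_neg_left (phi_der t (ltW bt) ts) _ bt.
  have := k_decr W (level_time_gt0 S1 t0 tu) (ord t (ltW bt) tu).
  by rewrite G12; lra.
by have := ht y; rewrite y2 (ltW y1) -et ltNge (ltW hy) => /(_ isT).
Qed.

End TwoLevels.

(** If two solutions reach a level of [(0, b]] simultaneously, [later_hG_ge] used
    in both directions gives equal slopes there. *)
Lemma separation u1 G1 u2 G2 :
  ground_state q f M u1 G1 -> ground_state q f M u2 G2 ->
  (exists2 r, 0 <= r & u1 r <> u2 r) ->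
  (forall s, 0 < s -> s <= b -> level_time u2 s < level_time u1 s) \/
  (forall s, 0 < s -> s <= b -> level_time u1 s < level_time u2 s).
Proof.
move=> S1 S2 [r r0 ne].
have neq s : 0 < s -> s <= b -> level_time u1 s <> level_time u2 s.
  move=> s0 sb e; have [l1 l2] := b_levels S1 S2 sb.
  have r1 := level_time_gt0 S1 s0 l1.
  have E1 := level_timeE S1 s0 l1; have E2 := level_timeE S2 s0 l2.
  have H1 : h (level_time u2 s) * G2 (level_time u2 s)
      <= h (level_time u1 s) * G1 (level_time u1 s).
    by apply: (later_hG_ge S1 S2) => //; rewrite e.
  have H2 : h (level_time u1 s) * G1 (level_time u1 s)
      <= h (level_time u2 s) * G2 (level_time u2 s).
    by apply: (later_hG_ge S2 S1) => //; rewrite e.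
  apply: ne; apply: (unique_interior W N S1 S2 r1) => //; last by rewrite E1.
    by rewrite E1 e E2.
  apply: (mulfI (lt0r_neq0 (h_gt0 W r1))); apply/eqP.
  by rewrite eq_le; move: H1 H2; rewrite -e => -> ->.
pose d s := level_time u1 s - level_time u2 s.
have b0 := b_gt0 N.
have cd s : 0 < s -> s <= b -> {for s, continuous d}.
  move=> s0 sb; have [l1 l2] := b_levels S1 S2 sb.
  exact: der_cts (derB (level_time_der S1 s0 l1) (level_time_der S2 s0 l2)).
have dn s : 0 < s -> s <= b -> d s != 0.
  by move=> s0 sb; rewrite subr_eq0; apply/eqP; exact: neq.
have [db|db] := ltP 0 (d b); [left|right] => s s0 sb; rewrite ltNge; apply/negP => ds.
- have [||x /andP[x1 x2] dx] := @ivt R d s b 0 sb.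
  + by move=> x /andP[x1 x2]; apply: cd => //; exact: lt_le_trans x1.
  + by rewrite (ltW db) andbT subr_le0.
  by have := dn x (lt_le_trans s0 x1) x2; rewrite dx eqxx.
- have [||x /andP[x1 x2] dx] := @ivt_decr R d s b 0 sb.
  + by move=> x /andP[x1 x2]; apply: cd => //; exact: lt_le_trans x1.
  + by rewrite db subr_ge0.
  by have := dn x (lt_le_trans s0 x1) x2; rewrite dx eqxx.
Qed.

End Levels.
(** * Two concave curves and their common tangent line *)

Section TangentLine.
Context {R : realType}.
Implicit Types (x y l : R).

(** A curve of the logarithmic plane parametrized by its slope [l]: [t] and
    [e] are its coordinates, [n] is the logarithm of the forcing along it, with
    partial derivatives [a] in [t] and [g] in [e], and [k] is minus the second derivative of
    the curve as a graph. *)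
Record slope_curve (L : R) (t e n k a g : R -> R) : Prop := SlopeCurve {
  sc_t : forall l : R, 0 < l < L -> is_derive l 1 t (- (k l)^-1);
  sc_e : forall l : R, 0 < l < L -> is_derive l 1 e (- (l / k l));
  sc_n : forall l : R, 0 < l < L -> is_derive l 1 n (- ((l * g l + a l) / k l));
  sc_k : forall l : R, 0 < l < L -> 0 < k l;
  sc_kE : forall l : R, 0 < l < L -> k l = l ^+ 2 - l + expR (n l);
  sc_a0 : forall l : R, 0 < l < L -> a l < 0;
  sc_a : forall l m : R, 0 < l -> l <= m -> m < L -> a l <= a m;
  sc_g : forall l m : R, 0 < l -> l <= m -> m < L -> g l <= g m
}.

Context (L : R) (t1 e1 n1 k1 a1 g1 t2 e2 n2 k2 a2 g2 : R -> R).
Context (C1 : slope_curve L t1 e1 n1 k1 a1 g1).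
Context (C2 : slope_curve L t2 e2 n2 k2 a2 g2).
Context (comparison : forall l : R, 0 < l < L -> t1 l < t2 l -> e1 l < e2 l ->
  [/\ a2 l <= a1 l, g2 l <= g1 l,
      (t2 l - t1 l) * a2 l + (e2 l - e1 l) * g2 l <= n2 l - n1 l
    & n2 l - n1 l <= (t2 l - t1 l) * a1 l + (e2 l - e1 l) * g1 l]).
Context (asymptotics : forall eps : R, 0 < eps -> exists2 l0 : R, 0 < l0 &
  forall l : R, 0 < l < L -> l < l0 -> t1 l < t2 l -> n1 l - n2 l < eps).

Let dt l := t2 l - t1 l.
Let de l := e2 l - e1 l.
Let nu l := n2 l - n1 l.
(* The height of the tangent line of slope [l] to the second curve above the
   parallel tangent line to the first one. *)
Let gap l := de l - l * dt l.

Lemma dt_der l : 0 < l < L -> is_derive l 1 dt ((k1 l)^-1 - (k2 l)^-1).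
Proof.
move=> hl; apply: der_eq (derB (sc_t C2 hl) (sc_t C1 hl)) _.
by rewrite opprK addrC.
Qed.

Lemma de_der l : 0 < l < L -> is_derive l 1 de (l * ((k1 l)^-1 - (k2 l)^-1)).
Proof.
move=> hl; apply: der_eq (derB (sc_e C2 hl) (sc_e C1 hl)) _.
by rewrite opprK addrC mulrBr.
Qed.

Lemma nu_der l : 0 < l < L ->
  is_derive l 1 nu ((l * g1 l + a1 l) / k1 l - (l * g2 l + a2 l) / k2 l).
Proof.
move=> hl; apply: der_eq (derB (sc_n C2 hl) (sc_n C1 hl)) _.
by rewrite opprK addrC.
Qed.

Lemma gap_der l : 0 < l < L -> is_derive l 1 gap (- dt l).
Proof.
move=> hl; apply: der_eq (derB (de_der hl) (derM (der_id l) (dt_der hl))) _.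
ring.
Qed.

Lemma k_diff l : 0 < l < L -> k2 l - k1 l = expR (n1 l) * (expR (nu l) - 1).
Proof.
move=> hl; rewrite (sc_kE C1 hl) (sc_kE C2 hl) mulrBr mulr1 /nu -expRD.
by rewrite [n1 l + _]addrC subrK; ring.
Qed.

Lemma k_lt l : 0 < l < L -> nu l < 0 -> k2 l < k1 l.
Proof.
move=> hl nl; rewrite -subr_lt0 k_diff // pmulr_rlt0 ?expR_gt0 // subr_lt0.
by rewrite -expR0 ltr_expR.
Qed.

Lemma k_le l : 0 < l < L -> 0 <= nu l -> k1 l <= k2 l.
Proof.
move=> hl nl; rewrite -subr_ge0 k_diff // mulr_ge0 ?expR_ge0 // subr_ge0.
by rewrite -expR0 ler_expR.
Qed.

(** Suppose that the forcing is smaller on the second curve.  As the logarithm of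
    the forcing is a concave function on the plane, it decreases at the second
    point in the direction of the tangent line; when the slope decreases, this
    persists, the two points move apart and the logarithmic difference of the
    forcings becomes more negative, against the asymptotics at slope [0]. *)
Lemma tangent_forcing_le T : 0 < T < L -> 0 < dt T -> de T = T * dt T ->
  0 <= nu T.
Proof.
move=> hT dtT deT; rewrite leNgt; apply/negP => nuT.
have /andP[T0 TL] := hT.
have deT0 : 0 < de T by rewrite deT mulr_gt0.
have [_ _ lo _] : [/\ a2 T <= a1 T, g2 T <= g1 T,
    dt T * a2 T + de T * g2 T <= nu T & nu T <= dt T * a1 T + de T * g1 T].
  by apply: comparison => //; rewrite -subr_gt0.
have psi2T : T * g2 T + a2 T < 0.
  have : dt T * (T * g2 T + a2 T) < 0.
    by apply: le_lt_trans nuT; apply: le_trans lo; rewrite deT; lra.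
  by rewrite pmulr_rlt0.
have rng x : 0 < x -> x <= T -> 0 < x < L.
  by move=> x0 xT; rewrite x0 (le_lt_trans xT).
have psi2 x : 0 < x -> x <= T -> x * g2 x + a2 x < 0.
  move=> x0 xT.
  have gm := sc_g C2 x0 xT TL; have am := sc_a C2 x0 xT TL.
  have a20 := sc_a0 C2 hT.
  have [g0|g0] := leP (g2 T) 0.
    have : x * g2 x <= 0 by rewrite mulr_ge0_le0 // ?(ltW x0) // (le_trans gm).
    lra.
  have : x * g2 x <= T * g2 T.
    by apply: (@le_trans _ _ (x * g2 T)); [rewrite ler_pM2l|rewrite ler_pM2r].
  lra.
have inv x : 0 < x -> x <= T -> nu x < 0 -> (k1 x)^-1 <= (k2 x)^-1.
  move=> x0 xT nx; have hx := rng x x0 xT.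
  rewrite lef_pV2 ?posrE ?(sc_k C1) ?(sc_k C2) //.
  exact/ltW/k_lt.
have step x : 0 < x -> x <= T -> (forall y, x < y <= T -> nu y < 0) ->
    dt T <= dt x /\ de T <= de x.
  move=> x0 xT neg; split.
    apply: (@der_le0_ge R dt (fun y => (k1 y)^-1 - (k2 y)^-1)) => // y /andP[y1 y2].
      by apply: dt_der; apply: rng => //; exact: lt_le_trans y1.
    by rewrite subr_le0 inv ?neg ?y1 ?(ltW y2) // (lt_trans x0).
  apply: (@der_le0_ge R de (fun y => y * ((k1 y)^-1 - (k2 y)^-1))) => // y /andP[y1 y2].
    by apply: de_der; apply: rng => //; exact: lt_le_trans y1.
  have y0 : 0 < y by exact: lt_trans y1.
  by rewrite mulr_ge0_le0 ?(ltW y0) // subr_le0 inv ?neg ?y1 ?(ltW y2).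
have nu_step x : 0 < x -> x <= T -> (forall y, x < y <= T -> nu y < 0) ->
    nu x <= nu T.
  move=> x0 xT neg.
  apply: (@der_ge0_le R nu
    (fun y => (y * g1 y + a1 y) / k1 y - (y * g2 y + a2 y) / k2 y)) => // y /andP[y1 y2].
    by apply: nu_der; apply: rng => //; exact: lt_le_trans y1.
  have y0 : 0 < y by exact: lt_trans y1.
  have yT := ltW y2.
  have hy := rng y y0 yT.
  have [|dy ey] := step y y0 yT.
    by move=> z /andP[z1 z2]; apply: neg; rewrite z2 (lt_trans y1).
  have [aa gg _ _] : [/\ a2 y <= a1 y, g2 y <= g1 y,
    dt y * a2 y + de y * g2 y <= nu y & nu y <= dt y * a1 y + de y * g1 y].
    by apply: comparison => //; rewrite -subr_gt0; [exact: lt_le_trans dy|exact: lt_le_trans ey].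
  have ny : nu y < 0 by apply: neg; rewrite y1.
  have iv := inv y y0 yT ny.
  have p2 := psi2 y y0 yT.
  have k10 : 0 <= (k1 y)^-1 by rewrite invr_ge0 ltW // (sc_k C1).
  have p12 : y * g2 y + a2 y <= y * g1 y + a1 y.
    by apply: lerD => //; rewrite ler_pM2l.
  rewrite subr_ge0.
  apply: (@le_trans _ _ ((y * g2 y + a2 y) / k1 y)).
    by rewrite ler_wnM2l // ltW.
  by rewrite ler_wpM2r.
have neg x : 0 < x -> x <= T -> nu x < 0.
  move=> x0 xT; apply: (neg_propagates_left xT _ nuT) => [y /andP[y1 y2]|y /andP[y1 y2] hy e].
    by apply: der_cts (nu_der (rng _ _ y2)); exact: lt_le_trans y1.
  have := nu_step y (lt_le_trans x0 y1) (ltW y2) hy.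
  by rewrite e leNgt nuT.
have eps0 : 0 < - nu T by rewrite oppr_gt0.
have [l0 l00 hl0] := asymptotics eps0.
pose x := Num.min T (l0 / 2).
have x0 : 0 < x by rewrite lt_min T0 divr_gt0.
have xT : x <= T by rewrite ge_min lexx.
have xl : x <= l0 / 2 by rewrite ge_min lexx orbT.
have negx y : x < y <= T -> nu y < 0.
  by move=> /andP[y1 y2]; apply: neg => //; exact: lt_trans y1.
have [dx _] := step x x0 xT negx.
have := nu_step x x0 xT negx.
have := hl0 x (rng x x0 xT); rewrite /nu => H1 H2.
have : n1 x - n2 x < - (n2 T - n1 T).
  apply: H1; first by lra.
  by rewrite -subr_gt0; exact: lt_le_trans dx.
move: H2; lra.
Qed.

(** By concavity again, the forcing increases at the first point in the direction
    of the tangent line, and this persists for larger slopes.  The forcing thus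
    stays at least as large on the second curve, which moves the two points of
    equal slope apart.  Equality is possible (pure powers), whence Gronwall's
    inequality rather than a strict sign. *)
Lemma tangent_separates T : 0 < T < L -> 0 < dt T -> de T = T * dt T ->
  forall l, T <= l -> l < L -> dt T <= dt l /\ de T <= de l.
Proof.
move=> hT dtT deT.
have nuT := tangent_forcing_le hT dtT deT.
have /andP[T0 TL] := hT.
have deT0 : 0 < de T by rewrite deT mulr_gt0.
have [_ _ _ hi] : [/\ a2 T <= a1 T, g2 T <= g1 T,
    dt T * a2 T + de T * g2 T <= nu T & nu T <= dt T * a1 T + de T * g1 T].
  by apply: comparison => //; rewrite -subr_gt0.
have psi1T : 0 <= T * g1 T + a1 T.
  have : 0 <= dt T * (T * g1 T + a1 T).
    by apply: le_trans nuT _; apply: le_trans hi _; rewrite deT; lra.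
  by rewrite pmulr_rge0.
have g1T : 0 < g1 T.
  have a10 := sc_a0 C1 hT.
  have : 0 < T * g1 T by lra.
  by rewrite pmulr_rgt0.
have rng x : T <= x -> x < L -> 0 < x < L.
  by move=> Tx xL; rewrite xL (lt_le_trans T0).
have psi1 x : T <= x -> x < L -> 0 <= x * g1 x + a1 x.
  move=> Tx xL; have gm := sc_g C1 T0 Tx xL; have am := sc_a C1 T0 Tx xL.
  apply: le_trans psi1T _; apply: lerD => //.
  apply: (@le_trans _ _ (x * g1 T)); first by rewrite ler_pM2r.
  by rewrite ler_pM2l // (lt_le_trans T0).
(* [nu' >= (l g1 + a1) expR n1 / (k1 k2) * nu], by [1 + x <= expR x]. *)
have nu_ge l : T <= l -> l < L -> (forall x, T <= x < l -> 0 < dt x /\ 0 < de x) ->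
    0 <= nu l.
  move=> Tl lL pos.
  have [B B0 hB] : exists2 B, 0 < B &
      forall x, T <= x <= l -> `|expR (n1 x) * ((k1 x)^-1 * (k2 x)^-1)| <= B.
    apply: cts_bounded => // x /andP[x1 x2].
    have hx : 0 < x < L by apply: rng => //; exact: le_lt_trans lL.
    have cK (t e n k a g : R -> R) : slope_curve L t e n k a g ->
        {for x, continuous (fun y => (k y)^-1)}.
      move=> C.
      have dk : is_derive x 1 (fun y => y * y - y + expR (n y))
          (1 * x + x * 1 - 1 + expR (n x) * - ((x * g x + a x) / k x)).
        exact: derD (derB (derM (der_id x) (der_id x)) (der_id x))
          (der_comp (is_derive_expR _) (sc_n C hx)).
      apply: continuousV; first by rewrite gt_eqF // (sc_k C).
      apply: der_cts (der_near _ dk); near=> y; rewrite -expr2; apply/esym/(sc_kE C).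
      apply/andP; split.
        by near: y; apply: lt_nbhsr; move: hx => /andP[].
      by near: y; apply: lt_nbhsl; move: hx => /andP[].
    apply: continuousM.
      exact: der_cts (der_comp (is_derive_expR _) (sc_n C1 hx)).
    by apply: continuousM; [exact: cK C1|exact: cK C2].
  apply: (@gronwall_ge0 R nu
    (fun y => (y * g1 y + a1 y) / k1 y - (y * g2 y + a2 y) / k2 y)
    ((l * g1 l) * B) T l) => //.
    by move=> x /andP[x1 x2]; apply: nu_der; apply: rng => //; exact: le_lt_trans lL.
  move=> x /andP[x1 x2] nx.
  have xL : x < L by exact: lt_trans lL.
  have hx := rng x (ltW x1) xL.
  have x0 : 0 < x by case/andP: hx.
  have [dx ex] := pos x (introT andP (conj (ltW x1) x2)).
  have [aa gg _ _] : [/\ a2 x <= a1 x, g2 x <= g1 x,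
    dt x * a2 x + de x * g2 x <= nu x & nu x <= dt x * a1 x + de x * g1 x].
    by apply: comparison => //; rewrite -subr_gt0.
  have k10 := sc_k C1 hx; have k20 := sc_k C2 hx.
  have p1 := psi1 x (ltW x1) xL.
  have p12 : x * g2 x + a2 x <= x * g1 x + a1 x.
    by apply: lerD => //; rewrite ler_pM2l.
  set P := x * g1 x + a1 x in p1 p12 *.
  set N := expR (n1 x) * ((k1 x)^-1 * (k2 x)^-1).
  have N0 : 0 <= N by rewrite mulr_ge0 ?expR_ge0 // mulr_ge0 // invr_ge0 ltW.
  have NB : N <= B.
    by have := hB x; rewrite (ltW x1) (ltW x2) => /(_ isT); rewrite ger0_norm.
  have PB : P <= l * g1 l.
    have a10 := sc_a0 C1 hx.
    have gm := sc_g C1 x0 (ltW x2) lL.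
    have gx : 0 < g1 x by exact: lt_le_trans (sc_g C1 T0 (ltW x1) xL).
    have : x * g1 x <= l * g1 l.
      apply: (@le_trans _ _ (x * g1 l)); first by rewrite ler_pM2l.
      by rewrite ler_pM2r ?ltW // (lt_le_trans gx).
    by rewrite /P; lra.
  have e_ge : nu x <= expR (nu x) - 1 by have := expR_ge1Dx (nu x); lra.
  apply: (@le_trans _ _ (P * N * nu x)).
    by apply: (ler_wnM2r (ltW nx)); apply: ler_pM.
  apply: (@le_trans _ _ (P * N * (expR (nu x) - 1))).
    by rewrite ler_wpM2l // mulr_ge0.
  have -> : P * N * (expR (nu x) - 1) = P / k1 x - P / k2 x.
    have kd := k_diff hx.
    have -> : P * N * (expR (nu x) - 1) = P * (k2 x - k1 x) / (k1 x * k2 x).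
      by rewrite kd /N invfM; ring.
    by field; rewrite !gt_eqF.
  by rewrite lerD2l lerN2 ler_wpM2r // invr_ge0 ltW.
have step l : T <= l -> l < L -> (forall x, T <= x < l -> 0 < dt x /\ 0 < de x) ->
    dt T <= dt l /\ de T <= de l.
  move=> Tl lL pos.
  have inv x : T < x < l -> (k2 x)^-1 <= (k1 x)^-1.
    move=> /andP[x1 x2]; have xL : x < L by exact: lt_trans lL.
    have hx := rng x (ltW x1) xL.
    rewrite lef_pV2 ?posrE ?(sc_k C1) ?(sc_k C2) // k_le // nu_ge //; first exact: ltW.
    by move=> y /andP[y1 y2]; apply: pos; rewrite y1 (lt_trans y2).
  split.
    apply: (@der_ge0_le R dt (fun y => (k1 y)^-1 - (k2 y)^-1)) => // y.
      by move=> /andP[y1 y2]; apply: dt_der; apply: rng => //; exact: le_lt_trans lL.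
    by move=> hy; rewrite subr_ge0 inv.
  apply: (@der_ge0_le R de (fun y => y * ((k1 y)^-1 - (k2 y)^-1))) => // y.
    by move=> /andP[y1 y2]; apply: de_der; apply: rng => //; exact: le_lt_trans lL.
  move=> hy; rewrite mulr_ge0 ?subr_ge0 ?inv //.
  by case/andP: hy => y1 _; apply/ltW/(lt_trans T0).
(* Both differences are propagated at once, through their minimum. *)
have both l : T <= l -> l < L -> - Num.min (dt l) (de l) < 0.
  move=> Tl lL.
  apply: (@neg_propagates R (fun x => - Num.min (dt x) (de x)) T l Tl).
  - move=> x /andP[x1 x2]; have hx := rng x x1 (le_lt_trans x2 lL).
    apply: continuousN; apply: continuous_min.
      exact: der_cts (dt_der hx).
    exact: der_cts (de_der hx).
  - by rewrite oppr_lt0 lt_min dtT deT0.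
  move=> x /andP[x1 x2] pos e.
  have [|dx ex] := step x (ltW x1) (le_lt_trans x2 lL).
    by move=> y /pos; rewrite oppr_lt0 lt_min => /andP[].
  have : 0 < Num.min (dt x) (de x).
    by rewrite lt_min (lt_le_trans dtT dx) (lt_le_trans deT0 ex).
  by rewrite -oppr_lt0 e ltxx.
move=> l Tl lL; apply: step => // x /andP[x1 x2].
by have := both x x1 (lt_trans x2 lL); rewrite oppr_lt0 lt_min => /andP[].
Unshelve. all: by end_near. Qed.

(** At the first slope where the two tangent lines coincide, the derivative
    [- dt] of [gap] is nonpositive, so the second point is not to the left of the
    first one; it is distinct from it by the last hypothesis. *)
Lemma common_tangent l0 l1 : 0 < l0 -> l0 <= l1 -> l1 < L ->
  0 < gap l0 -> gap l1 <= 0 ->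
  (forall l : R, 0 < l < L -> dt l = 0 -> de l = 0 -> False) ->
  exists T, [/\ l0 < T <= l1, 0 < de T
    & forall l, T <= l -> l < L -> 0 < dt l /\ de T <= de l].
Proof.
move=> l00 l01 l1L g0 g1' ne.
have rng x : l0 <= x <= l1 -> 0 < x < L.
  by move=> /andP[x1 x2]; rewrite (lt_le_trans l00 x1) (le_lt_trans x2).
have [|||T [/andP[T1 T2] eT neg]] := @first_zero R (fun x => - gap x) l0 l1 l01.
- by move=> x hx; apply: der_cts (derN (gap_der (rng x hx))).
- by rewrite oppr_lt0.
- by rewrite oppr_ge0.
have hT : 0 < T < L by apply: rng; rewrite (ltW T1).
have gT : gap T = 0 by apply/eqP; rewrite -oppr_eq0 eT.
have deT : de T = T * dt T by apply/eqP; rewrite -subr_eq0 -/(gap T) gT.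
have dtT : 0 < dt T.
  rewrite lt_neqAle; apply/andP; split.
    by apply/eqP => e; apply: (ne T) => //; rewrite deT -e mulr0.
  rewrite leNgt; apply/negP => dn.
  have d := derN (gap_der hT); rewrite opprK in d.
  have [y /andP[y1 y2]] := der_neg_left d dn T1.
  by rewrite eT ltNge ltW // neg // y2 ltW.
exists T; split; first by rewrite T1.
  by rewrite deT mulr_gt0 //; case/andP: hT.
move=> l Tl lL; have [dl el] := tangent_separates hT dtT deT Tl lL.
by split => //; exact: lt_le_trans dl.
Qed.

Lemma gap_stays_le0 T l : 0 < T -> gap T <= 0 -> T <= l -> l < L ->
  (forall x, T <= x -> x < L -> 0 < dt x) -> gap l <= 0.
Proof.
move=> T0 gT Tl lL pos; apply: le_trans gT.
apply: (@der_le0_ge R gap (fun x => - dt x)) => // x /andP[x1 x2].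
  by apply: gap_der; rewrite (lt_le_trans T0 x1) (le_lt_trans x2).
by rewrite oppr_le0 ltW // pos ?ltW // (lt_trans x2).
Qed.

End TangentLine.
(** * Solutions as curves of the logarithmic plane *)

Section SlopeParametrization.
Context {R : realType}.
Context (q dq h dh J f df F : R -> R) (b M : R).
Context (W : weight q dq h dh J) (N : nonlinearity f df F b M).
Implicit Types (u G : R -> R) (r s t x m e l p : R).

(** [ln h] is a concave function of [tau], with derivative [- h']. *)
Lemma ln_h_tangent r1 r2 : 0 < r2 -> r2 < r1 ->
  (tau q h r2 - tau q h r1) * (- 2 * dh r2) <= 2 * ln (h r2) - 2 * ln (h r1)
  <= (tau q h r2 - tau q h r1) * (- 2 * dh r1).
Proof.
move=> r20 r21.
have d c x : 0 < x -> is_derive x 1 (fun x => 2 * ln (h x) + 2 * c * tau q h x)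
    (2 * (dh x - c) / h x).
  move=> x0; apply: der_eq (derD (derM (der_cst 2 x) (der_ln (h_der W x0) (h_gt0 W x0)))
    (derM (der_cst (2 * c) x) (tau_der W x0))) _.
  by field; rewrite gt_eqF // (h_gt0 W).
have lo : 2 * ln (h r1) + 2 * dh r2 * tau q h r1 <= 2 * ln (h r2) + 2 * dh r2 * tau q h r2.
  apply: (@der_le0_ge R (fun x => 2 * ln (h x) + 2 * dh r2 * tau q h x)
    (fun x => 2 * (dh x - dh r2) / h x) _ _ (ltW r21)) => [x /andP[x1 x2]|x /andP[x1 x2]].
    by apply: d; exact: lt_le_trans x1.
  have x0 : 0 < x by exact: lt_trans x1.
  rewrite /= mulr_le0_ge0 // ?invr_ge0 ?(ltW (h_gt0 W x0)) //.
  by rewrite mulr_ge0_le0 // subr_le0 (dh_mono W) // ltW.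
have hi : 2 * ln (h r2) + 2 * dh r1 * tau q h r2 <= 2 * ln (h r1) + 2 * dh r1 * tau q h r1.
  apply: (@der_ge0_le R (fun x => 2 * ln (h x) + 2 * dh r1 * tau q h x)
    (fun x => 2 * (dh x - dh r1) / h x) _ _ (ltW r21)) => [x /andP[x1 x2]|x /andP[x1 x2]].
    by apply: d; exact: lt_le_trans x1.
  have x0 : 0 < x by exact: lt_trans x1.
  rewrite /= mulr_ge0 // ?invr_ge0 ?(ltW (h_gt0 W x0)) //.
  by rewrite mulr_ge0 // subr_ge0 (dh_mono W) // ltW.
apply/andP; split; lra.
Qed.

(** [ln (f s / s)] is a concave function of [ln s]. *)
Lemma ln_f_tangent s1 s2 : b < s1 -> s1 < s2 -> s2 <= M ->
  (ln s2 - ln s1) * (s2 * df s2 / f s2 - 1) <=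
    (ln (f s2) - ln s2) - (ln (f s1) - ln s1)
  <= (ln s2 - ln s1) * (s1 * df s1 / f s1 - 1).
Proof.
move=> bs1 s12 s2M; have b0 := b_gt0 N.
have rng x : s1 <= x -> x <= s2 -> [/\ 0 < x, b < x, x <= M & 0 < f x].
  move=> x1 x2; have bx : b < x by exact: lt_le_trans x1.
  have xM : x <= M by exact: le_trans s2M.
  by split => //; [exact: lt_trans bx|apply: (f_gt0 N); rewrite bx].
have d c x : s1 <= x -> x <= s2 -> is_derive x 1 (fun x => ln (f x) - c * ln x)
    ((x * df x / f x - c) / x).
  move=> x1 x2; have [x0 bx xM fx] := rng x x1 x2.
  have dfx : is_derive x 1 f (df x) by apply: (f_der N); rewrite x0.
  apply: der_eq (derB (der_ln dfx fx)
    (derM (der_cst c x) (der_ln (der_id x) x0))) _.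
  by field; rewrite !gt_eqF.
have lo : ln (f s1) - s2 * df s2 / f s2 * ln s1 <= ln (f s2) - s2 * df s2 / f s2 * ln s2.
  apply: (@der_ge0_le R (fun x => ln (f x) - s2 * df s2 / f s2 * ln x)
    (fun x => (x * df x / f x - s2 * df s2 / f s2) / x) _ _ (ltW s12)) => [x /andP[x1 x2]|x /andP[x1 x2]].
    exact: d.
  have [x0 bx xM fx] := rng x (ltW x1) (ltW x2).
  rewrite /= divr_ge0 ?(ltW x0) // subr_ge0 (g_mono N) //; exact: ltW.
have hi : ln (f s2) - s1 * df s1 / f s1 * ln s2 <= ln (f s1) - s1 * df s1 / f s1 * ln s1.
  apply: (@der_le0_ge R (fun x => ln (f x) - s1 * df s1 / f s1 * ln x)
    (fun x => (x * df x / f x - s1 * df s1 / f s1) / x) _ _ (ltW s12)) => [x /andP[x1 x2]|x /andP[x1 x2]].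
    exact: d.
  have [x0 bx xM fx] := rng x (ltW x1) (ltW x2).
  rewrite /= mulr_le0_ge0 ?invr_ge0 ?(ltW x0) // subr_le0 (g_mono N) //; exact: ltW.
apply/andP; split; lra.
Qed.

Section OneSlope.
Context (u G : R -> R) (S : ground_state q f M u G).
Let rb := level_time u b.
Local Notation th := (theta h u G).

Lemma rb_gt0 : 0 < rb.
Proof. exact: (level_time_gt0 W N S (b_gt0 N) (start_gt_b W N S)). Qed.

Lemma u_rb : u rb = b.
Proof. exact: (level_timeE W N S (b_gt0 N) (start_gt_b W N S)). Qed.

Lemma u_gt_b r : 0 < r -> r < rb -> b < u r.
Proof.
move=> r0 rr; rewrite -u_rb; apply: (u_decr W N S r0 rr).
by apply: lt_le_trans (u_noninc W N S r0 (ltW rr)); rewrite u_rb (b_gt0 N).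
Qed.

Lemma u_ge_b r : 0 < r -> r <= rb -> b <= u r.
Proof. by move=> r0 rr; rewrite -u_rb; exact: (u_noninc W N S). Qed.

Lemma u_gt0_rb r : 0 < r -> r <= rb -> 0 < u r.
Proof. by move=> r0 rr; exact: lt_le_trans (b_gt0 N) (u_ge_b r0 rr). Qed.

Lemma theta_incr r s : 0 < r -> r < s -> s <= rb -> th r < th s.
Proof.
move=> r0 rs sb; apply: (@der_gt0_lt R th (fun x => kappa h f u G x / h x)) => //.
  move=> x /andP[x1 x2]; have x0 : 0 < x by exact: lt_le_trans x1.
  by apply: (theta_der_kappa W S x0); apply: u_gt0_rb => //; exact: le_trans sb.
move=> x /andP[x1 x2]; have x0 : 0 < x by exact: lt_trans x1.
rewrite divr_gt0 ?(h_gt0 W) // (kappa_pos W N S) // u_gt_b //.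
exact: lt_le_trans sb.
Qed.

Lemma theta_le r s : 0 < r -> 0 < s -> r <= rb -> s <= rb ->
  (th r <= th s) = (r <= s).
Proof.
move=> r0 s0 rb_ sb; case: (ltgtP r s) => [rs|sr|->]; last by rewrite lexx.
- by rewrite ltW // theta_incr.
- by apply/negbTE; rewrite -ltNge theta_incr.
Qed.

Lemma theta_cts r : 0 < r -> r <= rb -> {for r, continuous th}.
Proof.
by move=> r0 rr; exact: der_cts (theta_der_kappa W S r0 (u_gt0_rb r0 rr)).
Qed.

Lemma theta_small e : 0 < e -> exists2 r, 0 < r < rb & th r < e.
Proof.
move=> e0.
have b0 := b_gt0 N.
have l := lim0_mulh W (G_lim S).
have /nbhs_ballP[d /= d0 hd] : nbhs (0 : R) [set r | 0 < r -> h r * G r < e * b].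
  by apply: cvgr_lt 0 l _ _; rewrite mulr_gt0.
pose r := Num.min (d / 2) (rb / 2).
have rb0 := rb_gt0.
have r0 : 0 < r by rewrite lt_min !divr_gt0.
have rd : r <= d / 2 by rewrite ge_min lexx.
have rr : r <= rb / 2 by rewrite ge_min lexx orbT.
have rrb : r < rb by lra.
exists r; first by rewrite r0.
have := hd r; rewrite /ball /= sub0r normrN gtr0_norm // => H.
rewrite /theta ltr_pdivrMr; last exact: (u_gt0_rb r0 (ltW rrb)).
apply: lt_le_trans (H _ r0) _; first by lra.
by rewrite ler_pM2l // u_ge_b // ltW.
Qed.

Lemma slope_time_exists : exists sr, forall l, 0 < l < th rb ->
  [/\ 0 < sr l < rb, th (sr l) = l
    & is_derive l 1 sr (h (sr l) / kappa h f u G (sr l))].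
Proof.
have [||sr hsr] := @der_inverse R th (fun x => kappa h f u G x / h x) 0 rb.
- move=> x /andP[x0 x2]; apply: (theta_der_kappa W S x0).
  by apply: u_gt0_rb => //; exact: ltW.
- move=> x /andP[x0 x2]; rewrite divr_gt0 ?(h_gt0 W) // (kappa_pos W N S) //.
  exact: u_gt_b.
exists sr => l /andP[l0 lb].
have [e /andP[e0 eb] he] := theta_small l0.
have [||x /andP[x1 x2] ex] := @ivt R th e rb l (ltW eb).
- by move=> x /andP[x1 x2]; apply: theta_cts => //; exact: lt_le_trans x1.
- by rewrite (ltW he) ltW.
have x0 : 0 < x by exact: lt_le_trans x1.
have xb : x < rb.
  by rewrite lt_neqAle x2 andbT; apply/eqP => E; move: lb; rewrite -ex E ltxx.
have [|E D] := hsr x; first by rewrite x0.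
rewrite -ex E; split => //; first by rewrite x0.
by apply: der_eq D _; rewrite invfM invrK mulrC.
Qed.

Lemma ln_u_der r : 0 < r -> r <= rb ->
  is_derive r 1 (fun x => ln (u x)) (- (th r / h r)).
Proof.
move=> r0 rr; have ur := u_gt0_rb r0 rr.
apply: der_eq (der_ln (u_der S r0) ur) _.
by rewrite /theta; field; rewrite !gt_eqF // (h_gt0 W).
Qed.

(** The curve is concave, its slope [theta] being increasing in [r] while [tau]
    decreases. *)
Lemma tangent_line_above r p : 0 < r -> r <= rb -> 0 < p -> p <= rb ->
  ln (u p) - th r * tau q h p <= ln (u r) - th r * tau q h r.
Proof.
move=> r0 rr p0 pr; set l := th r.
have d x : 0 < x -> x <= rb ->
    is_derive x 1 (fun x => ln (u x) - l * tau q h x) ((l - th x) / h x).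
  move=> x0 xr; apply: der_eq (derB (ln_u_der x0 xr)
    (derM (der_cst l x) (tau_der W x0))) _.
  by field; rewrite gt_eqF // (h_gt0 W).
have [pr'|rp] := leP p r.
  apply: (@der_ge0_le R (fun x => ln (u x) - l * tau q h x) (fun x => (l - th x) / h x)) => //.
    by move=> x /andP[x1 x2]; apply: d; [exact: lt_le_trans x1|exact: le_trans rr].
  move=> x /andP[x1 x2]; have x0 : 0 < x by exact: lt_trans x1.
  have xb : x <= rb by exact: le_trans (ltW x2) rr.
  by rewrite divr_ge0 ?(ltW (h_gt0 W x0)) // subr_ge0 /l theta_le // ltW.
apply: (@der_le0_ge R (fun x => ln (u x) - l * tau q h x) (fun x => (l - th x) / h x)).
- exact: ltW.
- by move=> x /andP[x1 x2]; apply: d; [exact: lt_le_trans x1|exact: le_trans pr].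
move=> x /andP[x1 x2]; have x0 : 0 < x by exact: lt_trans x1.
have xb : x <= rb by exact: le_trans (ltW x2) pr.
by rewrite mulr_le0_ge0 ?invr_ge0 ?(ltW (h_gt0 W x0)) // subr_le0 /l theta_le // ltW.
Qed.

Lemma slope_curve_of (sr : R -> R) L : L <= th rb ->
  (forall l, 0 < l < th rb -> [/\ 0 < sr l < rb, th (sr l) = l
    & is_derive l 1 sr (h (sr l) / kappa h f u G (sr l))]) ->
  slope_curve L (fun l => tau q h (sr l)) (fun l => ln (u (sr l)))
    (fun l => ln (forcing h f u (sr l))) (fun l => kappa h f u G (sr l))
    (fun l => - 2 * dh (sr l))
    (fun l => u (sr l) * df (u (sr l)) / f (u (sr l)) - 1).
Proof.
move=> Lb hsr.
have facts l : 0 < l < L -> [/\ 0 < sr l < rb, th (sr l) = l,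
    is_derive l 1 sr (h (sr l) / kappa h f u G (sr l))
    & [/\ b < u (sr l), u (sr l) <= M, 0 < f (u (sr l)), 0 < h (sr l)
        & 0 < kappa h f u G (sr l)]].
  move=> /andP[l0 lL]; have [|hr E D] := hsr l; first by rewrite l0 (lt_le_trans lL).
  have /andP[r0 rr] := hr; have bu := u_gt_b r0 rr.
  have uM : u (sr l) <= M by rewrite (u_leM S) // ltW.
  split => //; split => //.
  - by apply: (f_gt0 N); rewrite bu.
  - exact: (h_gt0 W).
  - exact: (kappa_pos W N S).
have mono l m : 0 < l -> l <= m -> m < L -> sr l <= sr m.
  move=> l0 lm mL.
  have [|/andP[r0 rr] E1 _ _] := facts l; first by rewrite l0 (le_lt_trans lm).
  have [|/andP[m0 mr] E2 _ _] := facts m; first by rewrite mL (lt_le_trans l0).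
  by rewrite -theta_le ?(ltW rr) ?(ltW mr) // E1 E2.
split.
- move=> l hl; have [/andP[r0 rr] E D [_ _ _ h0 k0]] := facts l hl.
  apply: der_eq (der_comp (tau_der W r0) D) _.
  by field; rewrite !gt_eqF.
- move=> l hl; have [/andP[r0 rr] E D [_ _ _ h0 k0]] := facts l hl.
  apply: der_eq (der_comp (ln_u_der r0 (ltW rr)) D) _.
  by rewrite E; field; rewrite !gt_eqF.
- move=> l hl; have [/andP[r0 rr] E D [bu uM f0 h0 k0]] := facts l hl.
  set r := sr l in r0 rr E D bu uM f0 h0 k0 *.
  have u0 : 0 < u r by exact: lt_trans (b_gt0 N) bu.
  have dF : is_derive r 1 (fun x => f (u x)) (df (u r) * - G r).
    by apply: der_comp (u_der S r0); apply: (f_der N); rewrite u0.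
  have dh2 : is_derive r 1 (fun x => h x ^+ 2) (dh r * h r + h r * dh r).
    exact: derM (h_der W r0) (h_der W r0).
  have un : u r != 0 by rewrite gt_eqF.
  have dforc := der_div (derM dh2 dF) (u_der S r0) un.
  have fo : 0 < forcing h f u r by rewrite /forcing !mulr_gt0 ?invr_gt0 ?exprn_gt0.
  apply: der_eq (der_comp (der_ln dforc fo) D) _.
  have Gr : G r = l * u r / h r by rewrite -E /theta; field; rewrite !gt_eqF.
  rewrite /forcing Gr; field.
  by rewrite !gt_eqF.
- by move=> l /facts[_ _ _ [_ _ _ _ k0]].
- move=> l hl; have [/andP[r0 rr] E D [bu uM f0 h0 k0]] := facts l hl.
  have u0 : 0 < u (sr l) by exact: lt_trans (b_gt0 N) bu.
  have fo : 0 < forcing h f u (sr l) by rewrite /forcing !mulr_gt0 ?invr_gt0 ?exprn_gt0.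
  by rewrite lnK ?posrE // {1}/kappa E.
- move=> l hl; have [/andP[r0 rr] E D [bu uM f0 h0 k0]] := facts l hl.
  by rewrite mulNr oppr_lt0 mulr_gt0 // (dh_gt0 W).
- move=> l m l0 lm mL; have rm := mono l m l0 lm mL.
  have [|/andP[r0 rr] _ _ _] := facts l; first by rewrite l0 (le_lt_trans lm).
  by rewrite ler_nM2l ?oppr_lt0 // (dh_mono W).
- move=> l m l0 lm mL; have rm := mono l m l0 lm mL.
  have [|/andP[r0 rr] _ _ [bl ulM _ _ _]] := facts l; first by rewrite l0 (le_lt_trans lm).
  have [|/andP[r0' rr'] _ _ [bm _ _ _ _]] := facts m; first by rewrite mL (lt_le_trans l0).
  by rewrite lerB // (g_mono N) // (u_noninc W N S).
Qed.

Lemma J_gt0 r : 0 < r -> 0 < J r.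
Proof.
move=> r0; apply: (@der_gt0_lim_lt R J q 0) => //.
- by move=> x /andP[x0 _]; exact: (J_der W).
- exact: (J_lim W).
- by move=> x /andP[x0 _]; exact: (q_gt0 W).
Qed.

Lemma flux_ratio_lim : (q r * G r / J r) @[r --> 0^'+] --> f (u 0).
Proof.
apply/cvgrPdist_le => e e0.
have /nbhs_ballP[d /= d0 hd] : nbhs (0 : R) [set r | 0 < r -> `|f (u 0) - f (u r)| <= e].
  have := lim_fu N S; move/cvgrPdist_le => /(_ e e0); exact.
near=> r.
have r0 : 0 < r by near: r; exact: nbhs_right_gt.
have rd : r < d by near: r; exact: nbhs_right_lt.
have J0 := J_gt0 r0.
have close x : 0 < x -> x <= r -> f (u 0) - e <= f (u x) <= f (u 0) + e.
  move=> x0 xr; have : `|f (u 0) - f (u x)| <= e.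
    by apply: hd => //; rewrite /ball /= sub0r normrN gtr0_norm // (le_lt_trans xr).
  by rewrite ler_distlC.
have Jl c : (c * J r) @[r --> 0^'+] --> (0 : R).
  by have := cvgM (@cvg_cst _ c _ (0 : R)^'+ _) (J_lim W); rewrite mulr0; apply.
have qGl := qG_lim W S.
have lo : (f (u 0) - e) * J r <= q r * G r.
  rewrite -subr_ge0.
  apply: (@der_ge0_lim_le R (fun x => q x * G x - (f (u 0) - e) * J x)
    (fun x => q x * f (u x) - (0 * J x + (f (u 0) - e) * q x)) 0) => //.
  - move=> x /andP[x0 _].
    exact: derB (qG_der S x0) (derM (der_cst _ _) (J_der W x0)).
  - by have := cvgB qGl (Jl (f (u 0) - e)); rewrite subrr; apply.
  - move=> x /andP[x0 xr]; rewrite mul0r add0r [_ * q x]mulrC -mulrBr.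
    rewrite mulr_ge0 ?(ltW (q_gt0 W x0)) // subr_ge0.
    by have /andP[] := close x x0 (ltW xr).
have hi : q r * G r <= (f (u 0) + e) * J r.
  rewrite -subr_ge0.
  apply: (@der_ge0_lim_le R (fun x => (f (u 0) + e) * J x - q x * G x)
    (fun x => (0 * J x + (f (u 0) + e) * q x) - q x * f (u x)) 0) => //.
  - move=> x /andP[x0 _].
    exact: derB (derM (der_cst _ _) (J_der W x0)) (qG_der S x0).
  - by have := cvgB (Jl (f (u 0) + e)) qGl; rewrite subrr; apply.
  - move=> x /andP[x0 xr]; rewrite mul0r add0r [_ * q x]mulrC -mulrBr.
    rewrite mulr_ge0 ?(ltW (q_gt0 W x0)) // subr_ge0.
    by have /andP[] := close x x0 (ltW xr).
rewrite ler_distlC; apply/andP; split.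
  by rewrite ler_pdivlMr.
by rewrite ler_pdivrMr.
Unshelve. all: by end_near. Qed.

Lemma f_start_gt0 : 0 < f (u 0).
Proof. by apply: (f_gt0 N); rewrite (start_gt_b W N S) (u_leM S). Qed.

(** Together with the next lemma this describes the forcing near slope [0]: at a
    point of slope [l] it equals [l] times [f (u r) / (q r * G r / J r)] times
    [h r * q r / J r]. *)
Lemma ln_flux_small e : 0 < e -> exists2 d, 0 < d &
  forall r, 0 < r -> r < d -> `|ln (f (u r) / (q r * G r / J r))| < e.
Proof.
move=> e0.
have f0 := f_start_gt0.
have fn : f (u 0) != 0 by rewrite gt_eqF.
have l1 : (f (u r) / (q r * G r / J r)) @[r --> 0^'+] --> f (u 0) / f (u 0).
  apply: cvgM; first exact: (lim_fu N S).
  by apply: cvgV => //; exact: flux_ratio_lim.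
rewrite divff // in l1.
have c1 : {for 1, continuous (@ln R)} by apply: continuous_ln.
have := cvg_comp _ (@ln R) l1 c1; rewrite ln1 => l2.
have /nbhs_ballP[d /= d0 hd] : nbhs (0 : R) [set r | 0 < r ->
    `|0 - ln (f (u r) / (q r * G r / J r))| < e].
  by move/cvgrPdist_lt: l2 => /(_ e e0); exact.
exists d => // r r0 rd.
have rB : ball (0 : R) d r by rewrite /ball /= sub0r normrN gtr0_norm.
by have := hd r rB r0; rewrite /= sub0r normrN.
Qed.

End OneSlope.

(** [h q / J] is a mean of the nonincreasing function [1 + 2 h']. *)
Lemma hq_J_noninc r s : 0 < r -> r <= s -> h s * q s * J r <= h r * q r * J s.
Proof.
move=> r0 rs.
have [||||||_ _ ] := @ratio_nonincreasing R (fun x => h x * q x) J q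
  (fun x => 1 + 2 * dh x) 0 r s rs r0 => //.
- by move=> x /andP[x0 _]; exact: (J_der W).
- move=> x /andP[x0 _]; apply: der_eq (hq_der W x0) _; exact: mulrC.
- by move=> x /andP[x0 _]; exact/ltW/(q_gt0 W).
- by move=> x y x0 xy _; rewrite lerD2l ler_pM2l // (dh_mono W).
- exact: (J_lim W).
- by exists 0 => //; exact: (qh_lim W).
Qed.

End SlopeParametrization.
(** * Comparison of two solutions *)

Section Comparison.
Context {R : realType}.
Context (q dq h dh J f df F : R -> R) (b M : R).
Context (W : weight q dq h dh J) (N : nonlinearity f df F b M).
Context (u1 G1 u2 G2 : R -> R).
Context (S1 : ground_state q f M u1 G1) (S2 : ground_state q f M u2 G2).
Context (u12 : u1 0 < u2 0).
Implicit Types (r s t x m e l p c : R).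

Let rb1 := level_time u1 b.
Let rb2 := level_time u2 b.
Local Notation th1 := (theta h u1 G1).
Local Notation th2 := (theta h u2 G2).
Local Notation T := (tau q h).

Let rb10 : 0 < rb1 := rb_gt0 W N S1.
Let rb20 : 0 < rb2 := rb_gt0 W N S2.

Definition slope_inverse u G sr := forall l, 0 < l < theta h u G (level_time u b) ->
  [/\ 0 < sr l < level_time u b, theta h u G (sr l) = l
    & is_derive l 1 sr (h (sr l) / kappa h f u G (sr l))].

Context (sr1 sr2 : R -> R).
Context (hsr1 : slope_inverse u1 G1 sr1) (hsr2 : slope_inverse u2 G2 sr2).

Lemma slope_comparison l : 0 < l < th1 rb1 -> 0 < l < th2 rb2 ->
  T (sr1 l) < T (sr2 l) -> ln (u1 (sr1 l)) < ln (u2 (sr2 l)) ->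
  [/\ - 2 * dh (sr2 l) <= - 2 * dh (sr1 l),
      u2 (sr2 l) * df (u2 (sr2 l)) / f (u2 (sr2 l)) - 1
        <= u1 (sr1 l) * df (u1 (sr1 l)) / f (u1 (sr1 l)) - 1,
      (T (sr2 l) - T (sr1 l)) * (- 2 * dh (sr2 l)) + (ln (u2 (sr2 l)) - ln (u1 (sr1 l)))
         * (u2 (sr2 l) * df (u2 (sr2 l)) / f (u2 (sr2 l)) - 1)
        <= ln (forcing h f u2 (sr2 l)) - ln (forcing h f u1 (sr1 l))
    & ln (forcing h f u2 (sr2 l)) - ln (forcing h f u1 (sr1 l)) <=
      (T (sr2 l) - T (sr1 l)) * (- 2 * dh (sr1 l)) + (ln (u2 (sr2 l)) - ln (u1 (sr1 l)))
         * (u1 (sr1 l) * df (u1 (sr1 l)) / f (u1 (sr1 l)) - 1)].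
Proof.
move=> hl1 hl2.
have [/andP[p1 q1] _ _] := hsr1 hl1; have [/andP[p2 q2] _ _] := hsr2 hl2.
set r1 := sr1 l in p1 q1 *; set r2 := sr2 l in p2 q2 *.
have bu1 := u_gt_b W N S1 p1 q1; have bu2 := u_gt_b W N S2 p2 q2.
have b0 := b_gt0 N.
have u1p : 0 < u1 r1 by exact: lt_trans bu1.
have u2p : 0 < u2 r2 by exact: lt_trans bu2.
have uM1 : u1 r1 <= M by rewrite (u_leM S1) // ltW.
have uM2 : u2 r2 <= M by rewrite (u_leM S2) // ltW.
have f1 : 0 < f (u1 r1) by apply: (f_gt0 N); rewrite bu1.
have f2 : 0 < f (u2 r2) by apply: (f_gt0 N); rewrite bu2.
have h1 := h_gt0 W p1; have h2 := h_gt0 W p2.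
rewrite ltr_ln ?posrE // => tt uu.
have rr : r2 < r1 by rewrite ltNge -(tau_le W) // -ltNge.
have /andP[a1 a2] := ln_h_tangent W p2 rr.
have /andP[c1 c2] := ln_f_tangent N bu1 uu uM2.
have forcE (u : R -> R) r : 0 < h r -> 0 < f (u r) -> 0 < u r ->
    ln (forcing h f u r) = 2 * ln (h r) + (ln (f (u r)) - ln (u r)).
  move=> hr fr ur; rewrite /forcing ln_div ?posrE ?mulr_gt0 ?exprn_gt0 //.
  rewrite lnM ?posrE ?exprn_gt0 // lnXn // -mulr_natl; ring.
rewrite !forcE //; split.
- by rewrite ler_nM2l ?oppr_lt0 // (dh_mono W) // ltW.
- by rewrite lerB // (g_mono N) // ltW.
- lra.
- lra.
Qed.

(** The quotient of the two forcings at equal slope has the limit behaviour of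
    the quotient of the values of [h q / J], which is nonincreasing. *)
Lemma slope_asymptotics eps : 0 < eps -> exists2 l0, 0 < l0 &
  forall l, 0 < l < th1 rb1 -> 0 < l < th2 rb2 -> l < l0 -> T (sr1 l) < T (sr2 l) ->
  ln (forcing h f u1 (sr1 l)) - ln (forcing h f u2 (sr2 l)) < eps.
Proof.
move=> e0.
have e20 : 0 < eps / 2 by rewrite divr_gt0.
have [d1 d10 hd1] := ln_flux_small W N S1 e20.
have [d2 d20 hd2] := ln_flux_small W N S2 e20.
pose x1 := Num.min (d1 / 2) rb1; pose x2 := Num.min (d2 / 2) rb2.
have x10 : 0 < x1 by rewrite lt_min divr_gt0 ?rb10.
have x20 : 0 < x2 by rewrite lt_min divr_gt0 ?rb20.
have x1r : x1 <= rb1 by rewrite ge_min lexx orbT.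
have x2r : x2 <= rb2 by rewrite ge_min lexx orbT.
have x1d : x1 <= d1 / 2 by rewrite ge_min lexx.
have x2d : x2 <= d2 / 2 by rewrite ge_min lexx.
exists (Num.min (th1 x1) (th2 x2)).
  rewrite lt_min (theta_gt0 W N S1 x10) ?(u_gt0_rb W N S1) //.
  by rewrite (theta_gt0 W N S2 x20) ?(u_gt0_rb W N S2).
move=> l hl1 hl2; rewrite lt_min => /andP[lx1 lx2].
have [/andP[p1 q1] E1 _] := hsr1 hl1; have [/andP[p2 q2] E2 _] := hsr2 hl2.
set r1 := sr1 l in p1 q1 E1 *; set r2 := sr2 l in p2 q2 E2 *.
have l0 : 0 < l by case/andP: hl1.
have r1d : r1 < d1.
  have : r1 < x1.
    by rewrite ltNge -(theta_le W N S1) ?(ltW q1) // -ltNge E1.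
  lra.
have r2d : r2 < d2.
  have : r2 < x2.
    by rewrite ltNge -(theta_le W N S2) ?(ltW q2) // -ltNge E2.
  lra.
move=> tt; have rr : r2 < r1 by rewrite ltNge -(tau_le W) // -ltNge.
have b0 := b_gt0 N.
have fct (u G : R -> R) (S : ground_state q f M u G) r : 0 < r ->
    r < level_time u b -> theta h u G r = l ->
    let X := f (u r) / (q r * G r / J r) in
    let Y := h r * q r / J r in
    [/\ 0 < X, 0 < Y & forcing h f u r = l * (X * Y)].
  move=> r0 rr0 E X Y.
  have bu := u_gt_b W N S r0 rr0.
  have ur : 0 < u r by exact: lt_trans bu.
  have fr : 0 < f (u r) by apply: (f_gt0 N); rewrite bu (u_leM S) // ltW.
  have Gr := G_pos W N S r0 ur; have hr := h_gt0 W r0; have qr := q_gt0 W r0.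
  have Jr := J_gt0 W r0.
  split; rewrite ?divr_gt0 ?mulr_gt0 ?invr_gt0 //.
  by rewrite /X /Y -E /forcing /theta; field; rewrite !gt_eqF.
have [X10 Y10 ->] := fct _ _ S1 r1 p1 q1 E1.
have [X20 Y20 ->] := fct _ _ S2 r2 p2 q2 E2.
have Y12 : h r1 * q r1 / J r1 <= h r2 * q r2 / J r2.
  rewrite ler_pdivrMr ?(J_gt0 W p1) // mulrAC ler_pdivlMr ?(J_gt0 W p2) //.
  by apply: (hq_J_noninc W) => //; exact: ltW.
have key (X1 X2 Y1 Y2 : R) : 0 < X1 -> 0 < Y1 -> 0 < X2 -> 0 < Y2 -> Y1 <= Y2 ->
    `|ln X1| < eps / 2 -> `|ln X2| < eps / 2 ->
    ln (l * (X1 * Y1)) - ln (l * (X2 * Y2)) < eps.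
  move=> X1p Y1p X2p Y2p YY; rewrite !ltr_norml => /andP[A1 A2] /andP[B1 B2].
  have lnE X Y : 0 < X -> 0 < Y -> ln (l * (X * Y)) = ln l + (ln X + ln Y).
    by move=> X0 Y0; rewrite (lnM l0 (mulr_gt0 X0 Y0)) (lnM X0 Y0).
  have : ln Y1 <= ln Y2 by rewrite ler_ln.
  by rewrite !lnE //; lra.
by apply: key => //; [exact: hd1|exact: hd2].
Qed.

Let gap l := (ln (u2 (sr2 l)) - l * T (sr2 l)) - (ln (u1 (sr1 l)) - l * T (sr1 l)).

(** Close to slope [0] the tangent line of the larger solution lies above. *)
Lemma gap_pos_small l1 : 0 < l1 -> exists l0, [/\ 0 < l0, l0 < l1 &
  (l0 < th1 rb1 -> l0 < th2 rb2 -> 0 < gap l0)].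
Proof.
move=> l10.
have [e e0 he] := near0_gt S2 u12.
pose p := Num.min e rb2.
have p0 : 0 < p by rewrite lt_min e0 rb20.
have pr : p <= rb2 by rewrite ge_min lexx orbT.
have up : u1 0 < u2 p by apply: he; rewrite p0 ge_min lexx.
have u10 := u0_pos S1.
pose d := ln (u2 p) - ln (u1 0).
have d0 : 0 < d by rewrite subr_gt0 ltr_ln ?posrE // (lt_trans u10).
pose C := `|T rb1 - T p| + 1.
have C0 : 0 < C by rewrite ltr_wpDl.
pose l0 := Num.min (l1 / 2) (d / C / 2).
have l00 : 0 < l0 by rewrite lt_min !divr_gt0.
have ll1 : l0 <= l1 / 2 by rewrite ge_min lexx.
have ldC : l0 <= d / C / 2 by rewrite ge_min lexx orbT.
exists l0; split => //; first by lra.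
move=> lt1 lt2.
have [|/andP[p1 q1] E1 _] := hsr1 (l := l0); first by rewrite l00.
have [|/andP[p2 q2] E2 _] := hsr2 (l := l0); first by rewrite l00.
have := tangent_line_above W N S2 p2 (ltW q2) p0 pr.
rewrite E2 /gap => H2.
have u1r : ln (u1 (sr1 l0)) < ln (u1 0).
  have ur : 0 < u1 (sr1 l0) by exact: (u_gt0_rb W N S1 p1 (ltW q1)).
  by rewrite ltr_ln ?posrE // (u_lt_start W N S1).
have Tr : T rb1 <= T (sr1 l0) by rewrite (tau_le W) // ltW.
have : l0 * (T p - T (sr1 l0)) <= l0 * C.
  rewrite ler_pM2l // /C; have := ler_norm (- (T rb1 - T p)); rewrite normrN; lra.
have : l0 * C <= d / 2.
  apply: (@le_trans _ _ (d / C / 2 * C)); first by rewrite ler_pM2r.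
  by rewrite mulrAC divfK // gt_eqF.
rewrite mulrBr; move: u1r d0; rewrite {2}/d; rewrite {1}/d; lra.
Qed.

(** Next to the level [b] the tangent line passes below a point [(c, ln b)]
    to the left of the end point of the curve. *)
Lemma tangent_at_level_b (u G : R -> R) (S : ground_state q f M u G) c m :
  c < T (level_time u b) -> m < level_time u b ->
  exists x, [/\ 0 < x, m < x, x < level_time u b
    & ln (u x) - theta h u G x * (T x - c) < ln b].
Proof.
move=> cT mr; set rb := level_time u b in cT mr *.
have rb0 : 0 < rb := rb_gt0 W N S.
have ub : u rb = b := u_rb W N S.
have b0 := b_gt0 N.
have u0 : 0 < u rb by rewrite ub.
pose phi x := ln (u x) - theta h u G x * (T x - c).
have d : is_derive rb 1 phi _ := derB (ln_u_der W N S rb0 (lexx _))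
  (derM (theta_der_kappa W S rb0 u0) (derB (tau_der W rb0) (der_cst c rb))).
have lt : phi rb < ln b.
  by rewrite /phi ub ltrBlDr ltrDl mulr_gt0 ?subr_gt0 // (theta_gt0 W N S).
have [e e0 he] := cts_lt (der_cts d) lt.
pose y := Num.max (Num.max 0 m) (rb - e).
have yr : y < rb by rewrite !gt_max rb0 mr /=; lra.
have y0 : 0 <= y by rewrite !le_max lexx.
have ym : m <= y by rewrite !le_max lexx orbT.
have ye : rb - e <= y by rewrite le_max lexx orbT.
exists ((y + rb) / 2); split; [lra|lra|lra|].
by apply: he; rewrite ltr0_norm; lra.
Qed.

Lemma sr_theta1 r : 0 < r -> r < rb1 -> sr1 (th1 r) = r.
Proof.
move=> r0 rr; have t0 := theta_gt0 W N S1 r0 (u_gt0_rb W N S1 r0 (ltW rr)).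
have [|/andP[p1 q1] E1 _] := hsr1 (l := th1 r).
  by rewrite t0 (theta_incr W N S1).
apply/eqP; rewrite eq_le -(theta_le W N S1 p1 r0 (ltW q1) (ltW rr)).
by rewrite -(theta_le W N S1 r0 p1 (ltW rr) (ltW q1)) E1 lexx.
Qed.

Lemma sr_theta2 r : 0 < r -> r < rb2 -> sr2 (th2 r) = r.
Proof.
move=> r0 rr; have t0 := theta_gt0 W N S2 r0 (u_gt0_rb W N S2 r0 (ltW rr)).
have [|/andP[p1 q1] E1 _] := hsr2 (l := th2 r).
  by rewrite t0 (theta_incr W N S2).
apply/eqP; rewrite eq_le -(theta_le W N S2 p1 r0 (ltW q1) (ltW rr)).
by rewrite -(theta_le W N S2 r0 p1 (ltW rr) (ltW q1)) E1 lexx.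
Qed.

Lemma separated_by_tangent L l1 : L <= th1 rb1 -> L <= th2 rb2 ->
  0 < l1 -> l1 < L -> gap l1 <= 0 ->
  exists t, [/\ 0 < t <= l1, ln (u1 (sr1 t)) < ln (u2 (sr2 t)) &
    forall l, t <= l -> l < L -> T (sr1 l) < T (sr2 l) /\
      ln (u2 (sr2 t)) - ln (u1 (sr1 t)) <= ln (u2 (sr2 l)) - ln (u1 (sr1 l))].
Proof.
move=> L1 L2 l10 l1L g1.
have C1 := slope_curve_of W N S1 L1 hsr1.
have C2 := slope_curve_of W N S2 L2 hsr2.
have [l0 [l00 l01 hg]] := gap_pos_small l10.
have g0 : 0 < gap l0.
  by apply: hg; [apply: lt_le_trans L1|apply: lt_le_trans L2]; exact: lt_trans l1L.
have in1 l : 0 < l < L -> 0 < l < th1 rb1.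
  by move=> /andP[-> lL]; exact: lt_le_trans L1.
have in2 l : 0 < l < L -> 0 < l < th2 rb2.
  by move=> /andP[-> lL]; exact: lt_le_trans L2.
have gapE l : gap l = ln (u2 (sr2 l)) - ln (u1 (sr1 l)) - l * (T (sr2 l) - T (sr1 l)).
  by rewrite /gap; ring.
have [|||||t [/andP[t0 t1] det hall]] := common_tangent C1 C2 _ _ l00 (ltW l01) l1L.
- by move=> l hl; apply: slope_comparison; [exact: in1|exact: in2].
- move=> eps e0; have [d d0 hd] := slope_asymptotics e0.
  by exists d => // l hl; apply: hd; [exact: in1|exact: in2].
- by rewrite -gapE.
- by rewrite -gapE.
- move=> l hl /eqP; rewrite subr_eq0 => /eqP tt /eqP; rewrite subr_eq0 => /eqP uu.
  have [/andP[p1 q1] E1 _] := hsr1 (in1 l hl); have [/andP[p2 q2] E2 _] := hsr2 (in2 l hl).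
  have u1p := u_gt0_rb W N S1 p1 (ltW q1); have u2p := u_gt0_rb W N S2 p2 (ltW q2).
  have rr : sr1 l = sr2 l.
    by apply/eqP; rewrite eq_le -(tau_le W p1 p2) -(tau_le W p2 p1) tt lexx.
  have ue : u1 (sr1 l) = u2 (sr1 l).
    by rewrite -rr in uu u2p; apply: ln_inj; rewrite ?posrE.
  have h0 := h_gt0 W p1.
  have : u1 0 = u2 0.
    apply: (unique_interior W N S1 S2 p1) => //.
    apply: (mulfI (lt0r_neq0 h0)).
    apply: (mulIf (invr_neq0 (lt0r_neq0 u1p))).
    by move: E1 E2; rewrite /theta -rr -ue => -> ->.
  by move=> E; move: u12; rewrite E ltxx.
exists t; split.
- by rewrite (lt_trans l00 t0).
- by rewrite -subr_gt0.
- move=> l tl lL; have [a1 a2] := hall l tl lL; split => //.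
  by rewrite -subr_gt0.
Qed.

(** The curve of [u2] begins, at the level [b], to the right of that of [u1] and
    with a slope at most as large, so its tangent line there lies below a parallel tangent
    line to the other curve, while for small slopes it lies above: there is a
    common tangent line.  From that slope on, [u2] stays above [u1] at equal
    slopes by a fixed factor, and [u1] reaches the level [b] first, against the
    order of the final slopes. *)
Lemma start_lt_absurd_later :
  (forall s, 0 < s -> s <= b -> level_time u2 s < level_time u1 s) -> False.
Proof.
move=> sep.
have b0 := b_gt0 N.
have r21 : rb2 < rb1 by exact: sep.
have L21 : th2 rb2 <= th1 rb1.
  rewrite /theta (u_rb W N S1) (u_rb W N S2) ler_pM2r ?invr_gt0 //.
  by apply: (later_hG_ge W N S1 S2) => //; exact: ltW.
have T12 : T rb1 < T rb2 by exact: (tau_decr W).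
have [x [x0 _ xr hx]] := tangent_at_level_b S2 T12 rb20.
have tx := theta_gt0 W N S2 x0 (u_gt0_rb W N S2 x0 (ltW xr)).
have txL : th2 x < th2 rb2 by exact: (theta_incr W N S2).
have gx : gap (th2 x) <= 0.
  rewrite /gap sr_theta2 //.
  have [|/andP[p1 q1] E1 _] := hsr1 (l := th2 x).
    by rewrite tx (lt_le_trans txL).
  have := tangent_line_above W N S1 p1 (ltW q1) rb10 (lexx _).
  rewrite E1 (u_rb W N S1); move: hx; rewrite mulrBr; lra.
have [t [/andP[t0 tx'] d0 hall]] := separated_by_tangent L21 (lexx _) tx txL gx.
pose d := ln (u2 (sr2 t)) - ln (u1 (sr1 t)).
have dp : 0 < d by rewrite subr_gt0.
have c : {for rb2, continuous (fun y => ln (u2 y))}.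
  exact: der_cts (ln_u_der W N S2 rb20 (lexx _)).
have lt : ln (u2 rb2) < ln b + d by rewrite (u_rb W N S2) ltrDl.
have [e e0 he] := cts_lt c lt.
pose y := Num.max x (rb2 - e / 2).
have yx : x <= y by rewrite le_max lexx.
have ye : rb2 - e / 2 <= y by rewrite le_max lexx orbT.
have yr : y < rb2 by rewrite gt_max xr /=; lra.
have y0 : 0 < y by exact: lt_le_trans yx.
have ty : th2 y < th2 rb2 by exact: (theta_incr W N S2).
have txy : t <= th2 y.
  by apply: le_trans tx' _; rewrite (theta_le W N S2) // ltW.
have ty0 : 0 < th2 y by exact: lt_le_trans txy.
have [_] := hall (th2 y) txy ty.
rewrite -/d sr_theta2 // => hd.
have [|/andP[p1 q1] E1 _] := hsr1 (l := th2 y).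
  by rewrite ty0 (lt_le_trans ty).
have bu1 := u_gt_b W N S1 p1 q1.
have : ln b < ln (u1 (sr1 (th2 y))) by rewrite ltr_ln ?posrE // (lt_trans b0).
have : ln (u2 y) < ln b + d by apply: he; rewrite ltr0_norm; lra.
move: hd; lra.
Qed.

(** Here a common tangent line would leave the tangent line of [u2] below that of
    [u1] up to the final slope of [u1], although the end point of the second curve
    lies above the last one.  So there is none; the curve of [u2] is above that of
    [u1], the solutions are ordered above the level [b], and [ordered_absurd]
    applies. *)
Lemma start_lt_absurd_earlier :
  (forall s, 0 < s -> s <= b -> level_time u1 s < level_time u2 s) -> False.
Proof.
move=> sep.
have b0 := b_gt0 N.
have r12 : rb1 < rb2 by exact: sep.
have L12 : th1 rb1 <= th2 rb2.
  rewrite /theta (u_rb W N S1) (u_rb W N S2) ler_pM2r ?invr_gt0 //.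
  by apply: (later_hG_ge W N S2 S1) => //; exact: ltW.
have T21 : T rb2 < T rb1 by exact: (tau_decr W).
have gap_pos l1 : 0 < l1 -> l1 < th1 rb1 -> 0 < gap l1.
  move=> l10 l1L; rewrite ltNge; apply/negP => g1.
  have [t [/andP[t0 tl1] _ hall]] := separated_by_tangent (lexx _) L12 l10 l1L g1.
  have [|/andP[p1 q1] E1 _] := hsr1 (l := l1); first by rewrite l10.
  have [x [x0 mx xr hx]] := tangent_at_level_b S1 T21 q1.
  have tx : th1 x < th1 rb1 by exact: (theta_incr W N S1).
  have l1x : l1 <= th1 x by rewrite -E1 (theta_le W N S1) // ltW.
  have C1 := slope_curve_of W N S1 (lexx _) hsr1.
  have C2 := slope_curve_of W N S2 L12 hsr2.
  have gapE l : gap l = ln (u2 (sr2 l)) - ln (u1 (sr1 l)) - l * (T (sr2 l) - T (sr1 l)).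
    by rewrite /gap; ring.
  have := @gap_stays_le0 R _ _ _ _ _ _ _ _ _ _ _ _ _ C1 C2 l1 (th1 x) l10 _ l1x tx _.
  rewrite -!gapE => /(_ g1) gx.
  have {gx} gx : gap (th1 x) <= 0.
    apply: gx => l ll lL; rewrite subr_gt0.
    by have [] := hall l (le_trans tl1 ll) lL.
  move: gx; rewrite /gap sr_theta1 //.
  have [|/andP[p2 q2] E2 _] := hsr2 (l := th1 x).
    by rewrite (lt_le_trans l10 l1x) (lt_le_trans tx).
  have := tangent_line_above W N S2 p2 (ltW q2) rb20 (lexx _).
  rewrite E2 (u_rb W N S2); move: hx; rewrite mulrBr; lra.
have ord r : 0 < r -> r <= rb1 -> u1 r < u2 r.
  move=> r0 rr.
  have rr2 : r < rb2 by exact: le_lt_trans r12.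
  have u1p := u_gt0_rb W N S1 r0 rr; have u2p := u_gt0_rb W N S2 r0 (ltW rr2).
  have t0 := theta_gt0 W N S2 r0 u2p.
  rewrite -ltr_ln ?posrE //.
  have [tL|Lt] := ltP (th2 r) (th1 rb1).
    have := gap_pos _ t0 tL; rewrite /gap sr_theta2 //.
    have [|/andP[p1 q1] E1 _] := hsr1 (l := th2 r); first by rewrite t0.
    have := tangent_line_above W N S1 p1 (ltW q1) r0 rr.
    rewrite E1; lra.
  have H2 := tangent_line_above W N S2 r0 (ltW rr2) rb20 (lexx _).
  rewrite (u_rb W N S2) in H2.
  have H1 : ln (u1 r) - th2 r * T r <= ln (u1 rb1) - th2 r * T rb1.
    apply: (@der_ge0_le R (fun x => ln (u1 x) - th2 r * T x)
      (fun x => - (th1 x / h x) - (0 * T x + th2 r * - (h x)^-1))) => //.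
      move=> x /andP[x1 x2]; have x0 : 0 < x by exact: lt_le_trans x1.
      exact: derB (ln_u_der W N S1 x0 x2) (derM (der_cst (th2 r) x) (tau_der W x0)).
    move=> x /andP[x1 x2]; have x0 : 0 < x by exact: lt_trans x1.
    have -> : - (th1 x / h x) - (0 * T x + th2 r * - (h x)^-1) = (th2 r - th1 x) / h x.
      by field; rewrite gt_eqF // (h_gt0 W).
    rewrite divr_ge0 ?(ltW (h_gt0 W x0)) // subr_ge0 (le_trans _ Lt) //.
    by rewrite (theta_le W N S1) // ltW.
  rewrite (u_rb W N S1) in H1.
  have : th2 r * T rb2 < th2 r * T rb1 by rewrite ltr_pM2l.
  lra.
apply: (ordered_absurd W N S1 S2 u12).
  move=> s bs su; have s0 : 0 < s by exact: lt_le_trans bs.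
  have r0 := level_time_gt0 W N S1 s0 su; have E1 := level_timeE W N S1 s0 su.
  have su2 : s < u2 0 by exact: lt_trans u12.
  have r20 := level_time_gt0 W N S2 s0 su2; have E2 := level_timeE W N S2 s0 su2.
  have rr : level_time u1 s <= rb1.
    rewrite leNgt; apply/negP => lt.
    have := u_decr W N S1 rb10 lt; rewrite (u_rb W N S1) E1 => /(_ b0).
    by rewrite ltNge bs.
  have := ord _ r0 rr; rewrite E1 => su2r.
  rewrite ltNge; apply/negP => le.
  have := u_noninc W N S2 r20 le; rewrite E2 => le2.
  by have := lt_le_trans su2r le2; rewrite ltxx.
exact: (later_G_lt W N S2 S1).
Qed.

End Comparison.

Section GroundStateUniqueness.
Context {R : realType}.
Context (q dq h dh J f df F : R -> R) (b M : R).
Context (W : weight q dq h dh J) (N : nonlinearity f df F b M).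

Lemma start_lt_absurd (u1 G1 u2 G2 : R -> R) :
  ground_state q f M u1 G1 -> ground_state q f M u2 G2 -> u1 0 < u2 0 -> False.
Proof.
move=> S1 S2 u12.
have [sr1 h1] := slope_time_exists W N S1.
have [sr2 h2] := slope_time_exists W N S2.
have ne : exists2 r, 0 <= r & u1 r <> u2 r.
  by exists 0 => // e; move: u12; rewrite e ltxx.
have [sep|sep] := separation W N S1 S2 ne.
- exact: (start_lt_absurd_later W N S1 S2 u12 h1 h2 sep).
- exact: (start_lt_absurd_earlier W N S1 S2 u12 h1 h2 sep).
Qed.

Lemma ground_state_unique (u1 G1 u2 G2 : R -> R) :
  ground_state q f M u1 G1 -> ground_state q f M u2 G2 ->
  forall r, 0 <= r -> u1 r = u2 r.
Proof.
move=> S1 S2; case: (ltgtP (u1 0) (u2 0)) => [lt|lt|]; last exact: (unique_start W N S1 S2).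
- by case: (start_lt_absurd S1 S2 lt).
- by case: (start_lt_absurd S2 S1 lt).
Qed.

End GroundStateUniqueness.
(** * From the given equation to the abstract one *)

Section Bridge.
Context {R : realType}.
Implicit Types (g u q f : R -> R) (r s t x a b M : R).
Local Notation mu := (@lebesgue_measure R).

Lemma derivable_is_derive g x : derivable g x 1 -> is_derive x 1 g (derive1 g x).
Proof. by move=> d; rewrite derive1E; exact: derivableP. Qed.

Lemma rderive_right_cts g l : is_rderive g 0 l -> g x @[x --> 0^'+] --> g 0.
Proof.
move=> d.
have idl : (x : R) @[x --> 0^'+] --> (0 : R) by apply: cvg_at_right_filter; exact: cvg_id.
have lim : (x * (x^-1 *: (g (x + 0) - g 0)) + g 0) @[x --> 0^'+] --> g 0.
  by have H := cvgD (cvgM idl d) (@cvg_cst _ (g 0) _ (0 : R)^'+ _);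
    rewrite mul0r add0r in H; exact: H.
have eqg : {near (0 : R)^'+, (fun x => x * (x^-1 *: (g (x + 0) - g 0)) + g 0) =1 g}.
  near=> x; have x0 : 0 < x by near: x; exact: nbhs_right_gt.
  by rewrite addr0 /GRing.scale /= mulrA divff ?gt_eqF // mul1r subrK.
exact: cvg_trans (near_eq_cvg eqg) lim.
Unshelve. all: by end_near. Qed.

Lemma cts_max0 g : (forall x, 0 < x -> {for x, continuous g}) ->
  g x @[x --> 0^'+] --> g 0 -> continuous (fun x => g (Num.max 0 x)).
Proof.
move=> cg g0 x; have [x0|x0|<-] := ltgtP 0 x.
- have cm : {for x, continuous (fun y : R => Num.max 0 y)}.
    by apply: continuous_max; [exact: cst_continuous|exact: cvg_id].
  by apply: continuous_comp cm _ => /=; rewrite max_r ?ltW //; exact: cg.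
- apply: (near_cst_continuous (g 0)).
  near=> y; rewrite max_l // ltW //; near: y; exact: lt_nbhsl.
- apply/cvgrPdist_lt => e e0; rewrite maxxx.
  have /nbhs_ballP[d /= d0 hd] : nbhs (0 : R) [set y | 0 < y -> `|g 0 - g y| < e].
    by move/cvgrPdist_lt: g0 => /(_ e e0); exact.
  apply/nbhs_ballP; exists d => // y /= yd.
  have [y0|y0] := ltP 0 y; last by rewrite subrr normr0.
  exact: hd.
Unshelve. all: by end_near. Qed.

Lemma integrable_setU (d : measure_display) (X : measurableType d)
    (nu : {measure set X -> \bar R}) (A B : set X) (f : X -> \bar R) :
  measurable A -> measurable B -> [disjoint A & B] ->
  nu.-integrable A f -> nu.-integrable B f -> nu.-integrable (A `|` B) f.
Proof.
move=> mA mB dAB /integrableP[m1 i1] /integrableP[m2 i2].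
have mU : measurable_fun (A `|` B) f by exact/measurable_funU.
apply/integrableP; split => //; rewrite ge0_integral_setU //.
- exact: lte_add_pinfty.
- exact: measurableT_comp.
Qed.

Lemma integrable_tail g a : 0 < a ->
  (forall x, 0 < x -> {for x, continuous g}) -> (forall x, 0 < x -> 0 <= g x) ->
  mu.-integrable `]1, +oo[ (EFin \o g) -> mu.-integrable `]a, +oo[ (EFin \o g).
Proof.
move=> a0 cg g0 int.
have [a1|a1] := leP 1 a.
  by apply: integrableS int => //; apply: subset_itvr; rewrite bnd_simp.
have inta : mu.-integrable `]a, 1] (EFin \o g).
  have : mu.-integrable `[a, 1] (EFin \o g).
    apply: continuous_compact_integrable; first exact: segment_compact.
    by apply: cts_within => x /andP[x1 _]; apply: cg; exact: lt_le_trans x1.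
  by apply: integrableS => //; apply: subset_itvr; rewrite bnd_simp.
have E : (`]a, +oo[ = `]a, 1%R] `|` `]1%R, +oo[)%classic.
  by rewrite -itv_bndbnd_setU // bnd_simp ltW.
rewrite E; apply: integrable_setU => //.
apply/disj_setPS => y [/=]; rewrite !in_itv /= andbT => /andP[_ y1].
by rewrite ltNge y1.
Qed.

Lemma tail_integral_der g r : 0 < r ->
  (forall x, 0 < x -> {for x, continuous g}) -> (forall x, 0 < x -> 0 <= g x) ->
  mu.-integrable `]1, +oo[ (EFin \o g) ->
  is_derive r 1 (fun x => \int[mu]_(s in `]x, +oo[) g s) (- g r).
Proof.
move=> r0 cg g0 int.
(* Any base point in [(0, r)] would do. *)
pose a := r / 2.
have a0 : 0 < a by rewrite divr_gt0.
have ar : a < r by rewrite /a; lra.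
have ia := integrable_tail a0 cg g0 int.
have r1 : r < r + 1 by rewrite ltrDl.
have iar : mu.-integrable `]a, r + 1] (EFin \o g).
  by apply: integrableS ia => //; apply: subset_itvl; rewrite bnd_simp.
have [|d e] := @continuous_FTC1 R g (BRight a) r (r + 1) r1 iar _ (cg r r0).
  exact: ar.
have D := derivable_is_derive d; rewrite e in D.
have D2 := derB (der_cst (\int[mu]_(s in `]a, +oo[) g s) r) D.
rewrite sub0r in D2; apply: der_near D2; near=> x.
have ax : a < x by near: x; exact: lt_nbhsr.
by rewrite (Rintegral_itvB ia) //; exact: ltW.
Unshelve. all: by end_near. Qed.

Lemma weight_of q : cond_q1 q -> cond_q2 q -> cond_q4 q ->
  exists J, weight q (derive1 q) (hfun q) (derive1 (hfun q)) J.
Proof.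
move=> [[l [qd qr _]] q0 q00 dq0] q2 [i1 _ hd hm _].
have qlim : q x @[x --> 0^'+] --> 0.
  by have := rderive_right_cts qr; rewrite q00; apply.
have qder r : 0 < r -> is_derive r 1 q (derive1 q r).
  by move=> r0; apply: derivable_is_derive; have [] := qd r r0.
have qgt r : 0 < r -> 0 < q r.
  move=> r0; apply: (@der_gt0_lim_lt R q (derive1 q) 0) => //.
  - by move=> x /andP[x0 _]; exact: qder.
  - by move=> x /andP[x0 _]; exact: dq0.
pose V r : R := \int[mu]_(s in `]r, +oo[) (q s)^-1.
have Vder r : 0 < r -> is_derive r 1 V (- (q r)^-1).
  move=> r0; apply: tail_integral_der => //.
  - move=> x x0; apply: continuousV; first by rewrite gt_eqF // qgt.
    exact: der_cts (qder x x0).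
  - by move=> x x0; rewrite invr_ge0 ltW // qgt.
have V0 r : 0 < r -> 0 < V r.
  move=> r0; apply: (@le_lt_trans _ _ (V (r + 1))).
    apply: Rintegral_ge0 => x /=; rewrite in_itv /= andbT => rx.
    by rewrite invr_ge0 q0 // ltW // (lt_trans _ rx) // addr_gt0.
  apply: (@der_lt0_gt R V (fun x => - (q x)^-1)); first by rewrite ltrDl.
    by move=> x /andP[rx _]; apply: Vder; exact: lt_le_trans rx.
  by move=> x /andP[rx _]; rewrite oppr_lt0 invr_gt0 qgt // (lt_trans r0).
have hder r : 0 < r -> is_derive r 1 (hfun q) (derive1 (hfun q) r).
  by move=> r0; apply: derivable_is_derive; have [] := hd r r0.
have dhE r : 0 < r -> derive1 (hfun q) r = derive1 q r * V r - 1.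
  move=> r0; apply: (der_unique (hder r r0)).
  apply: der_eq (derM (qder r r0) (Vder r r0)) _.
  by rewrite mulrN divff // gt_eqF // qgt.
have cq : continuous (fun x => q (Num.max 0 x)).
  by apply: cts_max0; [move=> x /qder /der_cts|rewrite q00].
have [Phi hPhi] := antiderivative (- 1) cq.
have m10 : (-1 : R) < 0 by rewrite oppr_lt0.
exists (fun x => Phi x - Phi 0); split => //.
- by move=> r r0; rewrite mulr_gt0 ?qgt ?V0.
- by move=> r r0; have [] := hd r r0.
- by move=> r r0; rewrite dhE // addrC subrK /hfun mulrAC mulrA.
- move=> r r0; rewrite -[q r]subr0; apply: derB (der_cst _ _).
  have := hPhi r (lt_trans m10 r0); by rewrite max_r // ltW.
- rewrite -[X in _ --> X](subrr (Phi 0)); apply: cvgB; last exact: cvg_cst.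
  by apply: cvg_at_right_filter; exact: der_cts (hPhi 0 m10).
Qed.

Lemma sym_itv_open (c : \bar R) : (0 < c)%E -> open (sym_itv c).
Proof.
case: c => [c| |] //= c0.
  have -> : sym_itv c%:E = [set` `]- c, c[].
    by apply/seteqP; split => x; rewrite /sym_itv /= in_itv /= !lte_fin.
  exact: interval_open.
have -> : sym_itv (+oo : \bar R) = setT; last exact: openT.
by apply/seteqP; split => x // _; rewrite /sym_itv /= ltNyr ltry.
Qed.

Lemma sym_itv_ge0 (c : \bar R) x : (0 < c)%E -> 0 <= x -> (x%:E < c)%E -> sym_itv c x.
Proof.
move=> c0 x0 xc; rewrite /sym_itv /= xc andbT.
by apply: (@lt_le_trans _ _ 0%E); [rewrite oppe_lt0|rewrite lee_fin].
Qed.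

Lemma nonlinearity_of (c : \bar R) f b beta M : (0 < c)%E -> 0 <= M -> (M%:E < c)%E ->
  {within sym_itv c, continuous f} -> cond_f1 c f b beta -> cond_f2 c f ->
  cond_f4 c f b -> exists F, nonlinearity f (derive1 f) F b M.
Proof.
move=> c0 M0 Mc cf [_ _ [b0 _ _] [fgt [fle _]] _] [fd _] f4.
have lec x : x <= M -> (x%:E < c)%E.
  by move=> xM; apply: le_lt_trans Mc; rewrite lee_fin.
have cfx x : 0 <= x -> x <= M -> {for x, continuous f}.
  move=> x0 xM; have := cf; rewrite continuous_open_subspace; last exact: sym_itv_open.
  by apply; rewrite inE; apply: sym_itv_ge0 => //; exact: lec.
(* Extending [f] by constants outside [[0, M]] makes it continuous on the line. *)
pose cl x := Num.min M (Num.max 0 x).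
have cl_rng x : 0 <= cl x <= M.
  by rewrite /cl le_min M0 /= le_max lexx /= ge_min lexx.
have ccl : continuous cl.
  move=> x; apply: continuous_min; first exact: cst_continuous.
  by apply: continuous_max; [exact: cst_continuous|exact: cvg_id].
have cfc : continuous (fun x => f (cl x)).
  move=> x; apply: continuous_comp; first exact: ccl.
  by have /andP[x0 xM] := cl_rng x; exact: cfx.
have [F hF] := antiderivative (- 1) cfc.
exists F; split => //.
- move=> s /andP[s0 sM]; apply: derivable_is_derive.
  by have [] := fd s s0 (lec s sM).
- by move=> s /andP[s0 sM]; have [] := fd s s0 (lec s sM).
- by move=> s /andP[bs sM]; apply: fgt => //; exact: lec.
- by move=> s t bs st tM; apply: f4 => //; exact: lec.
- move=> s /andP[s0 sM].
  have -> : f s = f (cl s) by rewrite /cl max_r // min_r.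
  by apply: hF; rewrite (lt_le_trans _ s0) // oppr_lt0.
Qed.

Lemma solution_lim (c : \bar R) f q u : is_solution c f q u ->
  u x @[x --> 0^'+] --> u 0.
Proof. by move=> [_ [_ d _] _ _ _]; exact: rderive_right_cts d. Qed.

Lemma solution_inf (c : \bar R) f q u : is_solution c f q u ->
  forall e, 0 < e -> exists X, forall r, X < r -> u r < e.
Proof.
move=> [_ _ _ _ l] e e0.
have : \forall r \near +oo, u r < e by exact: (cvgr_lt 0 l e e0).
by move=> [X [_ hX]]; exists X.
Qed.

Lemma solution_max (c : \bar R) f q u : is_solution c f q u -> 0 < u 0 ->
  exists2 M, (M%:E < c)%E & forall r, 0 <= r -> u r <= M.
Proof.
move=> S u00.
have [X hX] := solution_inf S u00.
have ul := solution_lim S.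
have [rng [ud _ _] _ _ _] := S.
pose Y := Num.max X 0 + 1.
have Y0 : 0 < Y by rewrite ltr_wpDl // le_max lexx orbT.
have XY : X < Y by rewrite (le_lt_trans (_ : X <= Num.max X 0)) ?le_max ?lexx // ltrDl.
have ucts x : 0 < x -> {for x, continuous u}.
  by move=> x0; apply: der_cts (derivable_is_derive _); have [] := ud x x0.
have cu : {within `[0, Y], continuous u}.
  apply/(continuous_within_itvP _ Y0); split => //.
    by move=> x; rewrite in_itv /= => /andP[x0 _]; exact: ucts.
  by apply: cvg_at_left_filter; exact: ucts.
have [m mY hm] := EVT_max (ltW Y0) cu.
have m0 : 0 <= m by move: mY; rewrite in_itv /= => /andP[].
exists (u m); first by have /andP[] := rng m m0.
move=> r r0; have [rY|Yr] := leP r Y.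
  by apply: hm; rewrite in_itv /= r0.
apply: (@le_trans _ _ (u 0)); first by apply/ltW/hX; exact: lt_trans Yr.
by apply: hm; rewrite in_itv /= lexx ltW.
Qed.

Lemma ground_state_of (c : \bar R) f q u M : is_solution c f q u ->
  (forall r, 0 <= r -> 0 <= u r) -> 0 < u 0 -> (forall r, 0 <= r -> u r <= M) ->
  ground_state q f M u (fun r => - derive1 u r).
Proof.
move=> S u0 u00 uM; have inf := solution_inf S; have ul := solution_lim S.
have [_ [ud _ dl] qd eq _] := S.
split => //.
- move=> r r0; rewrite opprK; apply: derivable_is_derive; by have [] := ud r r0.
- move=> r r0; have d := derN (derivable_is_derive (qd r r0)).
  have -> : q r * f (u r) = - derive1 (fun s => q s * derive1 u s) r.
    by apply/eqP; rewrite -addr_eq0 addrC eq.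
  by apply: der_near d; near=> x; rewrite mulrN.
- by move=> r r0; rewrite u0 // uM.
- by have := cvgN dl; rewrite oppr0; apply.
Unshelve. all: by end_near. Qed.

End Bridge.

Theorem theorem2 (R : realType) (c : \bar R) (f q : R -> R) (b beta : R)
  (c_gt0 : (0 < c)%E)
  (f_cont : {within sym_itv c, continuous f})
  (f1 : cond_f1 c f b beta)
  (f2 : cond_f2 c f)
  (q1 : cond_q1 q)
  (q2 : cond_q2 q)
  (q4 : cond_q4 q)
  (f4 : cond_f4 c f b)
  (u v : R -> R)
  (u_sol : is_solution c f q u)
  (u_ge0 : forall r : R, 0 <= r -> 0 <= u r)
  (u0_gt0 : 0 < u 0)
  (v_sol : is_solution c f q v)
  (v_ge0 : forall r : R, 0 <= r -> 0 <= v r)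
  (v0_gt0 : 0 < v 0) :
  forall r : R, 0 <= r -> u r = v r.
Proof.
have [Mu Muc uM] := solution_max u_sol u0_gt0.
have [Mv Mvc vM] := solution_max v_sol v0_gt0.
pose M := Num.max Mu Mv.
have Mc : (M%:E < c)%E by rewrite /M; case: (leP Mu Mv).
have uMM r : 0 <= r -> u r <= M by move=> /uM h; rewrite le_max h.
have vMM r : 0 <= r -> v r <= M by move=> /vM h; rewrite le_max h orbT.
have M0 : 0 <= M by rewrite (le_trans (ltW u0_gt0)) // uMM.
have [J W] := weight_of q1 q2 q4.
have [F N] := nonlinearity_of c_gt0 M0 Mc f_cont f1 f2 f4.
exact: (ground_state_unique W N (ground_state_of u_sol u_ge0 u0_gt0 uMM)
  (ground_state_of v_sol v_ge0 v0_gt0 vMM)).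
Qed.
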